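(* Let $L>0$, $I=[0,L]$, and let $f_0:[0,L]\to\mathbb{R}^2$ be a $C^\infty$-smooth planar curve parametrized by arclength ($|\partial_s f_0|\equiv 1$), with end points $p_-=f_0(0)$, $p_+=f_0(L)$, $\triangle p=p_+-p_-$, and $L>|\triangle p|$. Let $\kappa_0=\partial_s^2 f_0$ and suppose that $\kappa_0^{(\ell)}(0)=\kappa_0^{(\ell)}(L)=0$ for all integers $\ell\ge 0$. Then there exists a $C^\infty$-smooth global solution $T:[0,L]\times[0,\infty)\to\mathbb{S}^1\subset\mathbb{R}^2$ of the $L^2$-flow $$\partial_t T=\nabla_s^2 T-\langle\vec\lambda,T^\perp\rangle T^\perp ,\qquad T(\cdot,0)=\partial_s f_0,$$ with the hinged boundary condition $\kappa=\partial_s T=0$ on $\partial I=\{0,L\}$ for all $t\ge 0$, and with $\int_I T(s,t)\,ds=\triangle p$ for all $t\ge 0$. Moreover, the corresponding inextensible curves $f(s,t)=p_-+\int_0^s T(\sigma,t)\,d\sigma$ subconverge, as $t\to\infty$, to an inextensible elastica, i.e. to an equilibrium configuration of the bending energy $\mathcal{E}$ among inextensible curves of length $L$, with the hinged boundary condition $\kappa=0$ on $\partial I$ and with fixed end points $f_0(0)$, $f_0(L)$.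
   Context: $T^\perp$ is the unit normal obtained by rotating $T$ counterclockwise by $\pi/2$; $\kappa=\partial_s T$ is the curvature vector; $\nabla_s g:=\langle\partial_s g,T^\perp\rangle T^\perp$, so that $\nabla_s T=\kappa$ and $\nabla_s^2T=\nabla_s\kappa$. The bending energy is $\mathcal{E}[f]=\int_I\frac12|\kappa|^2\,ds$. Inextensible deformations of a curve are smooth families of arclength-parametrized curves ($|\partial_s f(s,\varepsilon)|=1$). The Lagrange multiplier $\vec\lambda=\vec\lambda(t)\in\mathbb{R}^2$ (a row vector) associated with the constraint $\int_I T\,ds=\triangle p$ is $$\vec\lambda=\Big(\int_I|\kappa|^2\,T\,ds\Big)\cdot A_T^{-1},\qquad A_T:=\int_I (T^\perp)^{t}\,T^\perp\,ds\in\mathbb{M}_{2\times2},$$ where $T^\perp$ is regarded as a row vector. (The flow is the $L^2$-gradient flow of $\int_I\frac12|\partial_sT|^2ds+\vec\lambda\cdot[\int_I T\,ds-\triangle p]$.) ''Subconverge'' means that there is a sequence $t_i\to\infty$ such that $f(\cdot,t_i)$ converges smoothly (in $C^\infty([0,L])$) to a limit curve $f_\infty$. An equilibrium configuration is an arclength-parametrized smooth curve $f_\infty:[0,L]\to\mathbb{R}^2$ with the stated end points and boundary condition whose tangent $T=\partial_s f_\infty$ satisfies the Euler–Lagrange equation $\nabla_s^2T-\langle\vec\lambda_\infty,T^\perp\rangle T^\perp=0$ on $[0,L]$ for some constant vector $\vec\lambda_\infty\in\mathbb{R}^2$. *)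

(* Defs.v *)
From Stdlib Require Import Reals.
From Coquelicot Require Import Coquelicot.

(* Stdlib's real numbers with Coquelicot.  The plane is [R * R] with Coquelicot's
   product normed-module structure, whose [norm] is the Euclidean norm. *)

Open Scope R_scope.

Notation R2 := (R * R)%type.

Definition dot (u v : R2) : R := fst u * fst v + snd u * snd v.

Definition perp (v : R2) : R2 := (- snd v, fst v).

Definition vint (g : R -> R2) (a b : R) : R2 :=
  (RInt (fun x => fst (g x)) a b, RInt (fun x => snd (g x)) a b).

(* Derivative relative to a set [D] of reals; one-sided at the end points of an
   interval, so that values of the function outside [D] play no role. *)
Definition is_derive_in {V : NormedModule R_AbsRing}
    (D : R -> Prop) (g : R -> V) (x : R) (l : V) : Prop :=
  filterdiff g (within D (locally x)) (fun h : R => scal h l).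

Definition ex_derive_in {V : NormedModule R_AbsRing}
    (D : R -> Prop) (g : R -> V) (x : R) : Prop :=
  exists l : V, is_derive_in D g x l.

(* Total operator in the style of [RInt]; meaningful where [ex_derive_in] holds
   and [x] is an accumulation point of [D]. *)
Definition Derive_in (D : R -> Prop) (g : R -> R2) (x : R) : R2 :=
  (iota (is_derive_in D (fun y => fst (g y)) x),
   iota (is_derive_in D (fun y => snd (g y)) x)).

Fixpoint Derive_n_in (D : R -> Prop) (g : R -> R2) (n : nat) : R -> R2 :=
  match n with
  | O => g
  | S k => Derive_in D (Derive_n_in D g k)
  end.

Definition smooth_in (D : R -> Prop) (g : R -> R2) : Prop :=
  forall (n : nat) (x : R), D x -> ex_derive_in D (Derive_n_in D g n) x.

Definition seg (L x : R) : Prop := 0 <= x <= L.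

Definition ray (t : R) : Prop := 0 <= t.

Definition Ds (L : R) (F : R -> R -> R2) (s t : R) : R2 :=
  Derive_in (seg L) (fun x => F x t) s.

Definition Dt (F : R -> R -> R2) (s t : R) : R2 :=
  Derive_in ray (fun y => F s y) t.

Definition continuous_strip (L : R) (F : R -> R -> R2) : Prop :=
  forall s t : R, seg L s -> ray t ->
    filterlim (fun p : R2 => F (fst p) (snd p))
      (within (fun p : R2 => seg L (fst p) /\ ray (snd p)) (locally (s, t)))
      (locally (F s t)).

Fixpoint Ck_strip (L : R) (k : nat) (F : R -> R -> R2) : Prop :=
  continuous_strip L F /\
  match k with
  | O => True
  | S j =>
      (forall s t : R, seg L s -> ray t ->
         ex_derive_in (seg L) (fun x => F x t) s /\
         ex_derive_in ray (fun y => F s y) t) /\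
      Ck_strip L j (Ds L F) /\ Ck_strip L j (Dt F)
  end.

Definition smooth_strip (L : R) (F : R -> R -> R2) : Prop :=
  forall k : nat, Ck_strip L k F.

(* Normal part of the arclength derivative of a field [g] along an
   arclength-parametrized curve on [0, L] with unit tangent [T]. *)
Definition nabla_s (L : R) (T g : R -> R2) (s : R) : R2 :=
  scal (dot (Derive_in (seg L) g s) (perp (T s))) (perp (T s)).

(* nabla_s^2 T - <lam, T^perp> T^perp *)
Definition flow_rhs (L : R) (T : R -> R2) (lam : R2) (s : R) : R2 :=
  minus (nabla_s L T (nabla_s L T T) s)
        (scal (dot lam (perp (T s))) (perp (T s))).

Definition row (v : R2) : matrix 1 2 :=
  mk_matrix 1 2 (fun _ j => match j with O => fst v | _ => snd v end).

Definition col (v : R2) : matrix 2 1 :=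
  mk_matrix 2 1 (fun i _ => match i with O => fst v | _ => snd v end).

Definition A_mat (L : R) (T : R -> R2) : matrix 2 2 :=
  mk_matrix 2 2 (fun i j =>
    RInt (fun s => coeff_mat 0 (Mmult (col (perp (T s))) (row (perp (T s)))) i j)
         0 L).

(* lam = (int |kappa|^2 T ds) A_T^{-1}; the invertibility of A_T is part of the
   assertion. *)
Definition is_multiplier (L : R) (T : R -> R2) (lam : R2) : Prop :=
  exists B : matrix 2 2,
    Mmult (A_mat L T) B = Mone /\ Mmult B (A_mat L T) = Mone /\
    row lam =
      Mmult (row (vint (fun s => scal (norm (Derive_in (seg L) T s) ^ 2) (T s)) 0 L)) B.

Definition curve_of (p : R2) (T : R -> R2) (s : R) : R2 := plus p (vint T 0 s).

Definition cvg_smooth (L : R) (g : nat -> R -> R2) (h : R -> R2) : Prop :=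
  forall (k : nat) (eps : posreal),
    eventually (fun n => forall s : R, seg L s ->
      norm (minus (Derive_n_in (seg L) (g n) k s) (Derive_n_in (seg L) h k s)) < eps).

Definition is_equilibrium (L : R) (p q : R2) (f : R -> R2) : Prop :=
  smooth_in (seg L) f /\
  (forall s : R, seg L s -> norm (Derive_in (seg L) f s) = 1) /\
  f 0 = p /\ f L = q /\
  Derive_n_in (seg L) f 2 0 = zero /\ Derive_n_in (seg L) f 2 L = zero /\
  exists lam : R2, forall s : R, seg L s ->
    flow_rhs L (Derive_in (seg L) f) lam s = zero.

(* Main.v *)
Require Import Defs.
From Stdlib Require Import Reals Lra Lia Factorial ClassicalEpsilon.
From Coquelicot Require Import Coquelicot.

Open Scope R_scope.

(** Write the tangent as T = (cos theta, sin theta).  The flow becomes a scalar heat equation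
    theta_t = theta_ss - <lambda, T^perp> with a nonlocal forcing and the Neumann condition
    theta_s = 0.  Since all derivatives of the initial curvature vanish at the end points,
    theta(., 0) has a rapidly decreasing cosine series on the segment, and everything is done with
    the coefficients a_k(t) of cos(k pi s / L), which solve a_k' = - mu_k a_k + N_k(a) with
    mu_k = (k pi / L)^2.

    Existence.  Clamping the curvature inside N_k and the determinant of A_T from below makes N_k
    bounded and Lipschitz with constants of order 1/(1+k) in the norm sum (1+k)|a_k|
    ([forcing_bl]).  In Duhamel form the Picard map is then a contraction on the whole half-line
    for a norm weighted by exp(Lam t), because sum 1/(mu_k + Lam) is small for large Lam
    ([mild_solution]).

    Regularity.  N_k decays as fast as a_k does ([forcing_decay]: integrate by parts and use that
    the derivatives of cos theta and sin theta are products with theta_s), and the heat semigroup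
    gains two powers of 1/k.  Hence all modes decrease rapidly, uniformly in time ([a_rapid]), and
    the equation turns time derivatives into space derivatives ([ang_reg]).

    Removal of the truncation.  While it is inactive, the choice of lambda conserves the integral
    of T ([constraint_conserved]) and the energy decreases ([energy_deriv]).  As |int T| < L, the
    curve is never close to a straight segment, so the energy bound keeps the determinant of A_T
    away from zero ([det_lower_bound]); lambda is then bounded by the energy, and so is the
    curvature.  With the truncation thresholds chosen beyond these bounds, a continuity argument
    shows that they are never reached ([global_solution]).

    Subconvergence.  The energy is bounded below, so the dissipation int theta_t^2 tends to zero
    along some times t_n.  Uniform rapid decay makes the coefficients at these times precompact by
    a diagonal argument, the mean angle being reduced modulo 2 pi; the limit coefficients are
    stationary, which is the equation of an elastica ([stationary_limit]), and dominated
    convergence of the series upgrades convergence of the coefficients to smooth convergence of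
    the curves ([curves_converge]). *)

(** * Limits and one-sided derivatives of real functions *)

Notation flim F f l := (filterlim f F (locally (l : R))).

Lemma flim_eps {T} (F : (T -> Prop) -> Prop) {FF : Filter F} (f : T -> R) (l : R) :
  flim F f l <-> (forall eps, 0 < eps -> F (fun x => Rabs (f x - l) < eps)).
Proof.
  split.
  - intros H eps He. apply (proj1 (filterlim_locally f l) H (mkposreal eps He)).
  - intros H. apply filterlim_locally. intros eps. apply (H eps (cond_pos eps)).
Qed.

Ltac flim_unfold H :=
  let H' := fresh in pose proof (proj1 (flim_eps _ _ _) H) as H'; clear H; rename H' into H.

Lemma flim_const {T} (F : (T -> Prop) -> Prop) {FF : Filter F} (c : R) :
  flim F (fun _ : T => c) c.
Proof. apply filterlim_const. Qed.

Lemma flim_plus {T} (F : (T -> Prop) -> Prop) {FF : Filter F} (f g : T -> R) (l m : R) :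
  flim F f l -> flim F g m -> flim F (fun x => f x + g x) (l + m).
Proof.
  intros Hf Hg. apply (filterlim_comp_2 f g Rplus Hf Hg).
  apply (filterlim_plus (V := R_NormedModule) l m).
Qed.

Lemma flim_mult {T} (F : (T -> Prop) -> Prop) {FF : Filter F} (f g : T -> R) (l m : R) :
  flim F f l -> flim F g m -> flim F (fun x => f x * g x) (l * m).
Proof.
  intros Hf Hg. apply (filterlim_comp_2 f g Rmult Hf Hg).
  apply (filterlim_mult (K := R_AbsRing) l m).
Qed.

Lemma flim_comp {T} (F : (T -> Prop) -> Prop) (f : T -> R) (g : R -> R) (l : R) :
  flim F f l -> continuous g l -> flim F (fun x => g (f x)) (g l).
Proof. intros Hf Hg. eapply filterlim_comp; [apply Hf | apply Hg]. Qed.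

Lemma within_flim {T : UniformSpace} (D : T -> Prop) (f : T -> R) (x : T) (l : R) :
  flim (locally x) f l -> flim (within D (locally x)) f l.
Proof. intros H. eapply filterlim_filter_le_1; [|exact H]. apply filter_le_within. Qed.

(** Limit of difference quotients along [D]: the notion of [is_derive_in] for real functions, in a
    form to which theorems on limits, such as dominated convergence, apply directly. *)
Definition deriv_in (D : R -> Prop) (g : R -> R) (x l : R) : Prop :=
  flim (within (fun y => D y /\ y <> x) (locally x))
       (fun y => (g y - g x) / (y - x)) l.

Lemma deriv_in_eps (D : R -> Prop) (g : R -> R) (x l : R) :
  deriv_in D g x l <->
  forall eps, 0 < eps -> exists d, 0 < d /\
    forall y, D y -> Rabs (y - x) < d -> Rabs (g y - g x - l * (y - x)) <= eps * Rabs (y - x).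
Proof.
  unfold deriv_in. split.
  - intros H eps He.
    flim_unfold H.
    destruct (H eps He) as [d Hd].
    exists d; split; [apply cond_pos|]. intros y Dy Hy.
    destruct (Req_dec y x) as [->|Hne].
    + replace (g x - g x - l * (x - x)) with 0 by ring. rewrite Rabs_R0.
      apply Rmult_le_pos; [lra|apply Rabs_pos].
    + specialize (Hd y Hy (conj Dy Hne)).
      replace (g y - g x - l * (y - x)) with (((g y - g x) / (y - x) - l) * (y - x))
        by (field; lra).
      rewrite Rabs_mult. apply Rmult_le_compat_r; [apply Rabs_pos|lra].
  - intros H. apply (proj2 (flim_eps _ _ _)). intros eps He.
    destruct (H (eps / 2)) as [d [Hd H']]; [lra|].
    exists (mkposreal d Hd). intros y Hy [Dy Hne].
    specialize (H' y Dy Hy).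
    replace ((g y - g x) / (y - x) - l) with ((g y - g x - l * (y - x)) / (y - x)) by (field; lra).
    unfold Rdiv. rewrite Rabs_mult, Rabs_inv.
    assert (0 < Rabs (y - x)) by (apply Rabs_pos_lt; lra).
    apply Rle_lt_trans with (eps / 2); [|lra].
    apply Rmult_le_reg_r with (Rabs (y - x)); [assumption|].
    rewrite Rmult_assoc, Rinv_l, Rmult_1_r; lra.
Qed.

Lemma is_derive_in_deriv (D : R -> Prop) (g : R -> R) (x l : R) : D x ->
  is_derive_in (V := R_NormedModule) D g x l <-> deriv_in D g x l.
Proof.
  intros Dx. rewrite deriv_in_eps. split.
  - intros [_ H] eps He.
    assert (Hl : is_filter_lim (within D (locally x)) x).
    { intros P HP. unfold within. revert HP. apply filter_imp. auto. }
    destruct (H x Hl (mkposreal eps He)) as [d Hd].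
    exists d; split; [apply cond_pos|]. intros y Dy Hy.
    specialize (Hd y Hy Dy). simpl in Hd.
    unfold norm, minus, plus, opp, scal in Hd; simpl in Hd.
    unfold mult in Hd; simpl in Hd. unfold abs in Hd; simpl in Hd.
    replace (g y - g x - l * (y - x)) with (g y + - g x + - ((y + - x) * l)) by ring.
    exact Hd.
  - intros H. split; [apply (is_linear_scal_l (K := R_AbsRing) (V := R_NormedModule) l)|].
    intros x' Hx'.
    assert (x' = x).
    { apply eq_sym, (eq_close x x'). intros eps.
      assert (Hb : locally x' (fun y => ball x' eps y)) by (exists eps; auto).
      specialize (Hx' _ Hb). apply locally_singleton in Hx'. apply ball_sym. auto. }
    subst x'. intros eps.
    destruct (H eps (cond_pos eps)) as [d [Hd H']].
    exists (mkposreal d Hd). intros y Hy Dy. specialize (H' y Dy Hy).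
    unfold norm, minus, plus, opp, scal; simpl.
    unfold mult; simpl. unfold abs; simpl.
    replace (g y + - g x + - ((y + - x) * l)) with (g y - g x - l * (y - x)) by ring.
    exact H'.
Qed.

Lemma deriv_in_ext (D : R -> Prop) (f g : R -> R) (x l : R) :
  D x -> (forall y, D y -> f y = g y) -> deriv_in D f x l -> deriv_in D g x l.
Proof.
  intros Dx H. unfold deriv_in. apply filterlim_within_ext.
  intros y [Dy _]. rewrite !H; auto.
Qed.

Lemma deriv_in_eq (D : R -> Prop) (g : R -> R) (x l m : R) :
  l = m -> deriv_in D g x l -> deriv_in D g x m.
Proof. intros ->. auto. Qed.

Lemma deriv_in_const (D : R -> Prop) (c x : R) : deriv_in D (fun _ => c) x 0.
Proof.
  apply deriv_in_eps. intros eps He. exists 1; split; [lra|]. intros y _ _.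
  replace (c - c - 0 * (y - x)) with 0 by ring. rewrite Rabs_R0.
  apply Rmult_le_pos; [lra|apply Rabs_pos].
Qed.

Lemma deriv_in_id (D : R -> Prop) (x : R) : deriv_in D (fun y => y) x 1.
Proof.
  apply deriv_in_eps. intros eps He. exists 1; split; [lra|]. intros y _ _.
  replace (y - x - 1 * (y - x)) with 0 by ring. rewrite Rabs_R0.
  apply Rmult_le_pos; [lra|apply Rabs_pos].
Qed.

Lemma deriv_in_cont (D : R -> Prop) (g : R -> R) (x l : R) :
  deriv_in D g x l -> flim (within D (locally x)) g (g x).
Proof.
  intros H. rewrite deriv_in_eps in H. apply (proj2 (flim_eps _ _ _)). intros eps He.
  destruct (H 1) as [d [Hd H']]; [lra|].
  assert (Hp : 0 < Rmin d (eps / (2 + Rabs l))).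
  { apply Rmin_glb_lt; auto. apply Rdiv_lt_0_compat; auto. pose proof (Rabs_pos l); lra. }
  exists (mkposreal _ Hp). intros y Hy Dy.
  assert (H1 : Rabs (y - x) < Rmin d (eps / (2 + Rabs l))) by exact Hy.
  assert (H2 : Rabs (y - x) < d) by (eapply Rlt_le_trans; [exact H1|apply Rmin_l]).
  assert (H3 : Rabs (y - x) < eps / (2 + Rabs l)) by (eapply Rlt_le_trans; [exact H1|apply Rmin_r]).
  specialize (H' y Dy H2).
  replace (g y - g x) with ((g y - g x - l * (y - x)) + l * (y - x)) by ring.
  eapply Rle_lt_trans; [apply Rabs_triang|]. rewrite Rabs_mult.
  pose proof (Rabs_pos l). pose proof (Rabs_pos (y - x)).
  apply Rle_lt_trans with ((1 + Rabs l) * Rabs (y - x)); [lra|].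
  apply Rle_lt_trans with ((2 + Rabs l) * Rabs (y - x)).
  { apply Rmult_le_compat_r; lra. }
  apply Rlt_le_trans with ((2 + Rabs l) * (eps / (2 + Rabs l))).
  - apply Rmult_lt_compat_l; lra.
  - right. field. lra.
Qed.

Lemma within_punctured (D : R -> Prop) (g : R -> R) (x l : R) :
  flim (within D (locally x)) g l ->
  flim (within (fun y => D y /\ y <> x) (locally x)) g l.
Proof.
  intros H. eapply filterlim_filter_le_1; [|exact H].
  intros P HP. unfold within in *. revert HP. apply filter_imp. intuition.
Qed.

Lemma deriv_in_plus (D : R -> Prop) (f g : R -> R) (x l m : R) :
  deriv_in D f x l -> deriv_in D g x m -> deriv_in D (fun y => f y + g y) x (l + m).
Proof.
  intros Hf Hg. unfold deriv_in in *.
  eapply filterlim_within_ext; [|apply (flim_plus _ _ _ _ _ Hf Hg)].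
  intros y [_ Hy]. simpl. field. lra.
Qed.

Lemma deriv_in_mult (D : R -> Prop) (f g : R -> R) (x l m : R) :
  deriv_in D f x l -> deriv_in D g x m ->
  deriv_in D (fun y => f y * g y) x (l * g x + f x * m).
Proof.
  intros Hf Hg. pose proof (deriv_in_cont _ _ _ _ Hg) as Cg.
  apply within_punctured in Cg. unfold deriv_in in *.
  assert (H := flim_plus _ _ _ _ _ (flim_mult _ _ _ _ _ Hf Cg)
     (flim_mult _ _ _ _ _ (flim_const _ (f x)) Hg)).
  eapply filterlim_within_ext; [|exact H].
  intros y [_ Hy]. simpl. field. lra.
Qed.

Lemma deriv_in_scal (D : R -> Prop) (c : R) (g : R -> R) (x m : R) :
  deriv_in D g x m -> deriv_in D (fun y => c * g y) x (c * m).
Proof.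
  intros Hg. replace (c * m) with (0 * g x + c * m) by ring.
  apply deriv_in_mult; [apply deriv_in_const|exact Hg].
Qed.

Lemma deriv_in_comp (D : R -> Prop) (g phi : R -> R) (x l m : R) :
  deriv_in D g x l -> is_derive phi (g x) m ->
  deriv_in D (fun y => phi (g y)) x (m * l).
Proof.
  intros Hg Hp.
  (* the difference quotient of [phi] at [g x], completed by its limit *)
  set (q := fun z => if Req_EM_T z (g x) then m else (phi z - phi (g x)) / (z - g x)).
  assert (Cq : continuous q (g x)).
  { apply is_derive_Reals in Hp.
    apply filterlim_locally. intros eps. destruct (Hp eps (cond_pos eps)) as [d Hd].
    exists d. intros z Hz. unfold q at 1. unfold ball; simpl. unfold AbsRing_ball; simpl.
    unfold abs, minus, plus, opp; simpl.
    unfold q. destruct (Req_EM_T (g x) (g x)) as [_|]; [|congruence].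
    destruct (Req_EM_T z (g x)) as [->|Hne].
    - rewrite Rplus_opp_r, Rabs_R0. apply cond_pos.
    - specialize (Hd (z - g x)). rewrite (Rplus_minus (g x) z) in Hd.
      apply Hd; [lra|exact Hz]. }
  pose proof (deriv_in_cont _ _ _ _ Hg) as Cg. apply within_punctured in Cg.
  assert (H := flim_mult _ _ _ _ _ (flim_comp _ _ _ _ Cg Cq) Hg).
  replace (q (g x)) with m in H
    by (unfold q; destruct (Req_EM_T (g x) (g x)); [reflexivity|congruence]).
  unfold deriv_in. eapply filterlim_within_ext; [|exact H].
  intros y [_ Hy]. simpl. unfold q. destruct (Req_EM_T (g y) (g x)) as [E|E].
  - rewrite E. field. lra.
  - field. lra.
Qed.

Definition accum (D : R -> Prop) (x : R) : Prop :=
  forall d, 0 < d -> exists y, D y /\ y <> x /\ Rabs (y - x) < d.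

Lemma deriv_in_unique (D : R -> Prop) (g : R -> R) (x l m : R) :
  accum D x -> deriv_in D g x l -> deriv_in D g x m -> l = m.
Proof.
  intros A Hl Hm.
  assert (PF : ProperFilter' (within (fun y => D y /\ y <> x) (locally x))).
  { constructor; [|typeclasses eauto].
    intros [d Hd]. destruct (A d (cond_pos d)) as [y [Dy [Hy Hb]]]. apply (Hd y); auto. }
  apply (filterlim_locally_unique (F := within (fun y => D y /\ y <> x) (locally x))
    (fun y => (g y - g x) / (y - x))); auto.
Qed.

Lemma is_derive_eps (g : R -> R) (x l : R) :
  is_derive g x l <-> deriv_in (fun _ => True) g x l.
Proof.
  rewrite <- is_derive_in_deriv by trivial. unfold is_derive, is_derive_in.
  split; intros [H1 H2]; split; trivial.
  - intros x' Hx'.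
    assert (Hx'2 : is_filter_lim (locally x) x').
    { intros P HP. specialize (Hx' P HP). unfold within in Hx'. revert Hx'. apply filter_imp. auto. }
    intros eps. specialize (H2 x' Hx'2 eps). unfold within. revert H2. apply filter_imp. auto.
  - intros x' Hx'.
    assert (Hx'2 : is_filter_lim (within (fun _ => True) (locally x)) x').
    { intros P HP. specialize (Hx' P HP). unfold within. revert Hx'. apply filter_imp. auto. }
    intros eps. specialize (H2 x' Hx'2 eps). unfold within in H2. revert H2. apply filter_imp. auto.
Qed.

Lemma deriv_in_sub (D D' : R -> Prop) (g : R -> R) (x l : R) :
  (forall y, D' y -> D y) -> deriv_in D g x l -> deriv_in D' g x l.
Proof.
  intros S H. rewrite deriv_in_eps in *. intros eps He.
  destruct (H eps He) as [d [Hd H']]. exists d; split; auto.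
Qed.

Lemma is_derive_deriv_in (D : R -> Prop) (g : R -> R) (x l : R) :
  is_derive g x l -> deriv_in D g x l.
Proof. rewrite is_derive_eps. apply deriv_in_sub. auto. Qed.

Definition clamp (a b x : R) : R := Rmax a (Rmin x b).

Lemma clamp_in a b x : a <= b -> a <= clamp a b x <= b.
Proof. intros. unfold clamp, Rmax, Rmin. destruct (Rle_dec x b); destruct (Rle_dec a _); lra. Qed.

Lemma clamp_id a b x : a <= x <= b -> clamp a b x = x.
Proof. intros. unfold clamp, Rmax, Rmin. destruct (Rle_dec x b); destruct (Rle_dec a _); lra. Qed.

Lemma clamp_lip a b x y : a <= b -> Rabs (clamp a b x - clamp a b y) <= Rabs (x - y).
Proof.
  intros. unfold clamp, Rmax, Rmin.
  destruct (Rle_dec x b); destruct (Rle_dec y b);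
  repeat match goal with |- context [Rle_dec ?u ?v] => destruct (Rle_dec u v) end;
  unfold Rabs; repeat match goal with |- context [Rcase_abs ?u] => destruct (Rcase_abs u) end; lra.
Qed.

(** Reduces one-sided continuity at the end points to continuity on the line. *)
Lemma clamp_continuous (D : R -> Prop) (a b : R) (g : R -> R) : a <= b ->
  (forall x, a <= x <= b -> D x) ->
  (forall x, a <= x <= b -> flim (within D (locally x)) g (g x)) ->
  forall x, continuous (fun y => g (clamp a b y)) x.
Proof.
  intros Hab HD H x.
  assert (Hx := H _ (clamp_in a b x Hab)).
  apply filterlim_locally. intros eps.
  flim_unfold Hx. destruct (Hx eps (cond_pos eps)) as [d Hd].
  exists d. intros y Hy.
  apply Hd; [|apply HD, clamp_in; auto].
  eapply Rle_lt_trans; [apply clamp_lip; auto|exact Hy].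
Qed.

(** The composition with [clamp] is continuous on the line, so the two-sided mean value theorem
    applies to it. *)
Lemma deriv_in_mvt (D : R -> Prop) (g g' : R -> R) (a b : R) : a <= b ->
  (forall x, a <= x <= b -> D x) ->
  (forall x, a <= x <= b -> deriv_in D g x (g' x)) ->
  exists c, a <= c <= b /\ g b - g a = g' c * (b - a).
Proof.
  intros Hab HD Hg.
  destruct (MVT_gen (fun y => g (clamp a b y)) a b g') as [c [Hc E]].
  - rewrite Rmin_left, Rmax_right by auto. intros x Hx.
    apply is_derive_eps. rewrite deriv_in_eps. intros eps He.
    assert (H := Hg x ltac:(lra)). rewrite deriv_in_eps in H.
    destruct (H eps He) as [d [Hd H']].
    exists (Rmin d (Rmin (x - a) (b - x))). split.
    { repeat apply Rmin_glb_lt; lra. }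
    intros y _ Hy.
    assert (Rabs (y - x) < d /\ Rabs (y - x) < x - a /\ Rabs (y - x) < b - x).
    { repeat split; eapply Rlt_le_trans; try exact Hy;
      [apply Rmin_l|eapply Rle_trans; [apply Rmin_r|apply Rmin_l]|
        eapply Rle_trans; [apply Rmin_r|apply Rmin_r]]. }
    assert (a <= y <= b).
    { destruct H0 as [_ [H1 H2]]. apply Rabs_def2 in H1. apply Rabs_def2 in H2. lra. }
    rewrite !clamp_id by lra. apply H'; [apply HD; lra|tauto].
  - rewrite Rmin_left, Rmax_right by auto. intros x Hx.
    apply continuity_pt_filterlim. apply (clamp_continuous D); auto.
    intros z Hz. eapply deriv_in_cont. apply Hg; auto.
  - rewrite Rmin_left, Rmax_right in Hc by auto. exists c. split; auto.
    rewrite !clamp_id in E by lra. exact E.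
Qed.

Lemma deriv_in_zero (D : R -> Prop) (g : R -> R) (a b : R) : a <= b ->
  (forall x, a <= x <= b -> D x) ->
  (forall x, a <= x <= b -> deriv_in D g x 0) -> g b = g a.
Proof.
  intros Hab HD Hg. destruct (deriv_in_mvt D g (fun _ => 0) a b Hab HD Hg) as [c [_ E]]. lra.
Qed.

Lemma deriv_in_lip (D : R -> Prop) (g g' : R -> R) (M : R) :
  (forall x y z, D x -> D y -> x <= z <= y -> D z) ->
  (forall x, D x -> deriv_in D g x (g' x)) -> (forall x, D x -> Rabs (g' x) <= M) ->
  forall x y, D x -> D y -> Rabs (g y - g x) <= M * Rabs (y - x).
Proof.
  intros Hc Hg HM.
  assert (W : forall x y, D x -> D y -> x <= y -> Rabs (g y - g x) <= M * Rabs (y - x)).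
  { intros x y Dx Dy Hxy.
    destruct (deriv_in_mvt D g g' x y Hxy) as [c [Hc' E]].
    - intros z Hz. apply (Hc x y z); auto.
    - intros z Hz. apply Hg. apply (Hc x y z); auto.
    - rewrite E, Rabs_mult. apply Rmult_le_compat_r; [apply Rabs_pos|].
      apply HM. apply (Hc x y); auto. }
  intros x y Dx Dy. destruct (Rle_dec x y); [auto|].
  rewrite Rabs_minus_sym, (Rabs_minus_sym y x). apply W; auto. lra.
Qed.

(** * Dominated series *)

Lemma ex_series_le_R (a b : nat -> R) :
  (forall n, Rabs (a n) <= b n) -> ex_series b -> ex_series a.
Proof. intros H. apply (ex_series_le (K := R_AbsRing) (V := R_CompleteNormedModule) a b). exact H. Qed.

Lemma Series_abs_le (a b : nat -> R) :
  (forall n, Rabs (a n) <= b n) -> ex_series b -> Rabs (Series a) <= Series b.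
Proof.
  intros H Hb.
  eapply Rle_trans; [apply Series_Rabs|].
  - apply (ex_series_le_R _ b); auto. intros n. rewrite Rabs_Rabsolu. auto.
  - apply Series_le; auto. intros n. split; [apply Rabs_pos|auto].
Qed.

Lemma ex_series_dom (a M : nat -> R) :
  (forall n, Rabs (a (S n)) <= M (S n)) -> ex_series M -> ex_series a.
Proof.
  intros H HM. apply ex_series_incr_1. apply (ex_series_le_R _ (fun n => M (S n))); auto.
  apply (ex_series_incr_1 M); auto.
Qed.

Lemma Series_split (a : nat -> R) (n : nat) : ex_series a ->
  Series a = sum_n a n + Series (fun k => a (S n + k)%nat).
Proof.
  intros H. rewrite (Series_incr_n a (S n)); [|lia|exact H]. simpl pred.
  rewrite sum_n_Reals. reflexivity.
Qed.

Lemma tail_small (M : nat -> R) : ex_series M -> forall eps, 0 < eps ->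
  exists n, Rabs (Series (fun k => M (S n + k)%nat)) < eps.
Proof.
  intros H eps He. assert (Hs := Series_correct _ H).
  destruct (proj1 (filterlim_locally _ _) Hs (mkposreal eps He)) as [n Hn].
  exists n. specialize (Hn n (le_n _)).
  assert (E := Series_split M n H).
  assert (Hb : Rabs (sum_n M n - Series M) < eps) by exact Hn.
  rewrite Rabs_minus_sym in Hb.
  replace (Series (fun k => M (S n + k)%nat)) with (Series M - sum_n M n) by lra. exact Hb.
Qed.

Lemma flim_sum {T} (F : (T -> Prop) -> Prop) {FF : Filter F} (u : nat -> T -> R) (l : nat -> R) n :
  (forall k, flim F (u k) (l k)) ->
  flim F (fun x => sum_n (fun k => u k x) n) (sum_n l n).
Proof.
  intros H. induction n.
  - rewrite sum_O. eapply filterlim_ext; [|apply H]. intros x. rewrite sum_O. reflexivity.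
  - rewrite sum_Sn. eapply filterlim_ext; [|apply (flim_plus F _ _ _ _ IHn (H (S n)))].
    intros x. simpl. rewrite sum_Sn. reflexivity.
Qed.

(** Dominated convergence for series.  The domination starts at index 1, because the Fourier mean
    of a solution may drift while all other modes stay bounded. *)
Lemma flim_series {T} (F : (T -> Prop) -> Prop) {FF : Filter F}
  (u : nat -> T -> R) (l M : nat -> R) :
  ex_series M ->
  F (fun x => forall k, Rabs (u (S k) x) <= M (S k)) ->
  (forall k, Rabs (l (S k)) <= M (S k)) ->
  (forall k, flim F (u k) (l k)) ->
  flim F (fun x => Series (fun k => u k x)) (Series l).
Proof.
  intros HM Hu Hl Hk. apply (proj2 (flim_eps _ _ _)). intros eps He.
  destruct (tail_small M HM (eps / 3)) as [n Hn]; [lra|].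
  assert (Hs := flim_sum F u l n Hk). flim_unfold Hs.
  specialize (Hs (eps / 3) ltac:(lra)).
  generalize (filter_and _ _ Hu Hs). apply filter_imp. intros x [Hx Hsx].
  rewrite (Series_split (fun k => u k x) n) by (apply (ex_series_dom _ M); auto).
  rewrite (Series_split l n) by (apply (ex_series_dom _ M); auto).
  assert (HMn : ex_series (fun k => M (S n + k)%nat)) by (apply (ex_series_incr_n M (S n)); auto).
  assert (T1 : Rabs (Series (fun k => u (S n + k)%nat x)) <= Series (fun k => M (S n + k)%nat)).
  { apply Series_abs_le; auto. intros k. apply Hx. }
  assert (T2 : Rabs (Series (fun k => l (S n + k)%nat)) <= Series (fun k => M (S n + k)%nat)).
  { apply Series_abs_le; auto. intros k. apply Hl. }
  apply Rabs_def2 in Hn. apply Rabs_def2 in Hsx. apply Rabs_le_between in T1. apply Rabs_le_between in T2.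
  apply Rabs_def1; lra.
Qed.

(** Dominated convergence of the difference quotients, whose bounds are the Lipschitz constants
    of the terms. *)
Lemma deriv_in_series (D : R -> Prop) (u : nat -> R -> R) (l M : nat -> R) (x : R) :
  ex_series M ->
  (exists M0, ex_series M0 /\ forall y, D y -> forall k, Rabs (u (S k) y) <= M0 (S k)) ->
  D x ->
  (forall k y, D y -> Rabs (u (S k) y - u (S k) x) <= M (S k) * Rabs (y - x)) ->
  (forall k, Rabs (l (S k)) <= M (S k)) ->
  (forall k, deriv_in D (u k) x (l k)) ->
  deriv_in D (fun y => Series (fun k => u k y)) x (Series l).
Proof.
  intros HM [M0 [HM0 Hu0]] Dx Hlip Hl Hd. unfold deriv_in in *.
  eapply filterlim_within_ext; [|apply (flim_series (within (fun y => D y /\ y <> x) (locally x))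
     (fun k y => (u k y - u k x) / (y - x)) l M HM)]; auto.
  - intros y [Dy Hy]. simpl. unfold Rdiv. rewrite Series_scal_r. f_equal.
    rewrite Series_minus; [reflexivity| |]; apply (ex_series_dom _ M0); auto.
  - unfold within. apply filter_forall. intros y [Dy Hy] k.
    unfold Rdiv. rewrite Rabs_mult, Rabs_inv.
    assert (0 < Rabs (y - x)) by (apply Rabs_pos_lt; lra).
    apply Rmult_le_reg_r with (Rabs (y - x)); auto.
    rewrite Rmult_assoc, Rinv_l, Rmult_1_r by lra. auto.
Qed.

(** * Calculus on a closed segment with one-sided derivatives *)

Definition cseg (L : R) (g : R -> R) : Prop :=
  forall s, seg L s -> flim (within (seg L) (locally s)) g (g s).

Lemma cseg_const L c : cseg L (fun _ => c).
Proof. intros s _. apply flim_const. typeclasses eauto. Qed.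

Lemma cseg_plus L f g : cseg L f -> cseg L g -> cseg L (fun s => f s + g s).
Proof. intros Hf Hg s Hs. apply flim_plus; auto. typeclasses eauto. Qed.

Lemma cseg_mult L f g : cseg L f -> cseg L g -> cseg L (fun s => f s * g s).
Proof. intros Hf Hg s Hs. apply flim_mult; auto. typeclasses eauto. Qed.

Lemma cseg_comp L (phi : R -> R) g :
  (forall x, continuous phi x) -> cseg L g -> cseg L (fun s => phi (g s)).
Proof. intros Hp Hg s Hs. apply (flim_comp _ g phi); auto. Qed.

Lemma cseg_opp L g : cseg L g -> cseg L (fun s => - g s).
Proof.
  apply (cseg_comp L Ropp). intros x.
  apply (continuous_opp (V := R_NormedModule) (fun y => y)), continuous_id.
Qed.

Lemma cseg_minus L f g : cseg L f -> cseg L g -> cseg L (fun s => f s - g s).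
Proof. intros Hf Hg. apply (cseg_plus L f (fun s => - g s)); auto. apply cseg_opp; auto. Qed.

Lemma cseg_continuous L g : (forall s, continuous g s) -> cseg L g.
Proof. intros H s _. apply within_flim, H. Qed.

Lemma cseg_deriv L g g' : (forall s, seg L s -> deriv_in (seg L) g s (g' s)) -> cseg L g.
Proof. intros H s Hs. eapply deriv_in_cont; eauto. Qed.

Lemma cseg_ext L f g : (forall s, seg L s -> f s = g s) -> cseg L f -> cseg L g.
Proof.
  intros E Hf s Hs. rewrite <- E by auto. eapply filterlim_within_ext; [|apply Hf; auto]. auto.
Qed.

Lemma cos_cont x : continuous cos x.
Proof. apply continuity_pt_filterlim, continuity_cos. Qed.

Lemma sin_cont x : continuous sin x.
Proof. apply continuity_pt_filterlim, continuity_sin. Qed.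

Lemma Rabs_cont x : continuous Rabs x.
Proof. apply continuity_pt_filterlim, Rcontinuity_abs. Qed.

Lemma cseg_id L : cseg L (fun s => s).
Proof. apply cseg_continuous. intros s. apply continuous_id. Qed.

Lemma cseg_cos L g : cseg L g -> cseg L (fun s => cos (g s)).
Proof. apply cseg_comp, cos_cont. Qed.

Lemma cseg_sin L g : cseg L g -> cseg L (fun s => sin (g s)).
Proof. apply cseg_comp, sin_cont. Qed.

Lemma cseg_abs L g : cseg L g -> cseg L (fun s => Rabs (g s)).
Proof. apply cseg_comp, Rabs_cont. Qed.

Lemma cseg_pow L g n : cseg L g -> cseg L (fun s => g s ^ n).
Proof.
  intros H. induction n; simpl; [apply cseg_const|]. apply cseg_mult; auto.
Qed.

Create HintDb cseg.
#[export] Hint Resolve cseg_const cseg_plus cseg_mult cseg_minus cseg_opp cseg_cos cseg_sin cseg_abs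
  cseg_id cseg_pow : cseg.

Definition integ (L : R) (g : R -> R) : R := RInt g 0 L.

Section Segment.
Variable L : R.
Hypothesis HL : 0 < L.

Notation Int := (integ L).

Lemma cseg_clamp (g : R -> R) : cseg L g -> forall s, continuous (fun y => g (clamp 0 L y)) s.
Proof. intros H. apply (clamp_continuous (seg L)); auto; lra. Qed.

Lemma cseg_ex_RInt_sub (g : R -> R) (a : R) (b : R) : 0 <= a <= b -> b <= L -> cseg L g -> ex_RInt g a b.
Proof.
  intros Ha Hb H. apply (ex_RInt_ext (fun y => g (clamp 0 L y))).
  - intros x. rewrite Rmin_left, Rmax_right by lra. intros Hx. rewrite clamp_id; [reflexivity|lra].
  - apply (ex_RInt_continuous (V := R_CompleteNormedModule)). intros z _. apply cseg_clamp; auto.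
Qed.

Lemma cseg_ex_RInt (g : R -> R) : cseg L g -> ex_RInt g 0 L.
Proof. apply cseg_ex_RInt_sub; lra. Qed.

Lemma Int_ext (f g : R -> R) : (forall s, seg L s -> f s = g s) -> Int f = Int g.
Proof.
  intros H. unfold integ. apply (RInt_ext (V := R_CompleteNormedModule)). intros x. rewrite Rmin_left, Rmax_right by lra.
  intros Hx. apply H. unfold seg. lra.
Qed.

Lemma Int_plus (f g : R -> R) : cseg L f -> cseg L g -> Int (fun s => f s + g s) = Int f + Int g.
Proof. intros Hf Hg. unfold integ. apply (RInt_plus (V := R_CompleteNormedModule)); apply cseg_ex_RInt; auto. Qed.

Lemma Int_scal (c : R) (f : R -> R) : cseg L f -> Int (fun s => c * f s) = c * Int f.
Proof. intros Hf. unfold integ. apply (RInt_scal (V := R_CompleteNormedModule)); apply cseg_ex_RInt; auto. Qed.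

Lemma Int_minus (f g : R -> R) : cseg L f -> cseg L g -> Int (fun s => f s - g s) = Int f - Int g.
Proof. intros Hf Hg. unfold integ. apply (RInt_minus (V := R_CompleteNormedModule)); apply cseg_ex_RInt; auto. Qed.

Lemma Int_opp (f : R -> R) : cseg L f -> Int (fun s => - f s) = - Int f.
Proof. intros Hf. unfold integ. apply (RInt_opp (V := R_CompleteNormedModule)); apply cseg_ex_RInt; auto. Qed.

Lemma Int_const (c : R) : Int (fun _ => c) = L * c.
Proof. unfold integ. rewrite (RInt_const (V := R_CompleteNormedModule)). unfold scal; simpl. unfold mult; simpl. ring. Qed.

Lemma Int_le (f g : R -> R) : cseg L f -> cseg L g -> (forall s, seg L s -> f s <= g s) -> Int f <= Int g.
Proof.
  intros Hf Hg H. unfold integ. apply RInt_le; [lra| | |]; try (apply cseg_ex_RInt; auto).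
  intros x Hx. apply H. unfold seg. lra.
Qed.

Lemma Int_abs_le (f g : R -> R) : cseg L f -> cseg L g -> (forall s, seg L s -> Rabs (f s) <= g s) ->
  Rabs (Int f) <= Int g.
Proof.
  intros Hf Hg H. eapply Rle_trans.
  - unfold integ. apply abs_RInt_le; [lra|apply cseg_ex_RInt; auto].
  - apply Int_le; auto with cseg.
Qed.

Lemma Int_bound (f : R -> R) (M : R) : cseg L f -> (forall s, seg L s -> Rabs (f s) <= M) -> Rabs (Int f) <= L * M.
Proof. intros Hf H. rewrite <- Int_const. apply Int_abs_le; auto with cseg. Qed.

Lemma Int_nonneg (f : R -> R) : cseg L f -> (forall s, seg L s -> 0 <= f s) -> 0 <= Int f.
Proof.
  intros Hf H. apply Rle_trans with (Int (fun _ : R => 0)).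
  - rewrite Int_const. lra.
  - apply Int_le; auto with cseg.
Qed.

Lemma seg_bounded (f : R -> R) : cseg L f -> exists M, forall s, seg L s -> Rabs (f s) <= M.
Proof.
  intros Hf. destruct (continuity_ab_maj (fun y => Rabs (f (clamp 0 L y))) 0 L) as [m [Hm _]]; [lra| |].
  - intros c _. apply continuity_pt_filterlim.
    apply (continuous_comp (fun y => f (clamp 0 L y)) Rabs); [apply cseg_clamp; auto|apply Rabs_cont].
  - exists (Rabs (f (clamp 0 L m))). intros s Hs. specialize (Hm s Hs). cbv beta in Hm.
    rewrite (clamp_id 0 L s) in Hm; auto.
Qed.

Lemma RInt_deriv_in (g : R -> R) : cseg L g ->
  forall s, seg L s -> deriv_in (seg L) (fun x => RInt g 0 x) s (g s).
Proof.
  intros Hg s Hs.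
  assert (H : is_derive (fun x => RInt (fun y => g (clamp 0 L y)) 0 x) s (g (clamp 0 L s))).
  { apply (is_derive_RInt (V := R_NormedModule) (fun y => g (clamp 0 L y)) _ 0).
    - apply filter_forall. intros x. apply (RInt_correct (V := R_CompleteNormedModule)), ex_RInt_continuous.
      intros z _. apply cseg_clamp; auto.
    - apply cseg_clamp; auto. }
  rewrite clamp_id in H by auto.
  eapply deriv_in_ext; [exact Hs| |apply is_derive_deriv_in; exact H].
  intros y [Hy0 Hy]. apply (RInt_ext (V := R_CompleteNormedModule)).
  intros x. rewrite Rmin_left, Rmax_right by lra. intros Hx. rewrite clamp_id; auto. lra.
Qed.

(** The difference of [g] and the primitive of [g'] has zero derivative. *)
Lemma FTC (g g' : R -> R) (s : R) : (forall x, seg L x -> deriv_in (seg L) g x (g' x)) -> cseg L g' ->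
  seg L s -> RInt g' 0 s = g s - g 0 :> R.
Proof.
  intros Hd Hc Hs.
  assert (E : g s + -1 * RInt g' 0 s = g 0 + -1 * RInt g' 0 0).
  { apply (deriv_in_zero (seg L) (fun x => g x + -1 * RInt g' 0 x) 0 s); [apply Hs| |].
    - intros x Hx. destruct Hs; split; lra.
    - intros x Hx. apply (deriv_in_eq _ _ _ (g' x + -1 * g' x)); [ring|].
      assert (seg L x) by (destruct Hs; split; lra).
      apply deriv_in_plus; [apply Hd; auto|].
      apply deriv_in_scal. apply RInt_deriv_in; auto. }
  rewrite (RInt_point (V := R_CompleteNormedModule) 0 g') in E. unfold zero in E; simpl in E. lra.
Qed.

Lemma seg_0 : seg L 0. Proof. unfold seg; lra. Qed.
Lemma seg_L : seg L L. Proof. unfold seg; lra. Qed.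

Lemma Int_FTC (g g' : R -> R) : (forall x, seg L x -> deriv_in (seg L) g x (g' x)) -> cseg L g' ->
  Int g' = g L - g 0.
Proof. intros H1 H2. apply FTC; auto. apply seg_L. Qed.

Lemma Int_by_parts (f g f' g' : R -> R) :
  (forall x, seg L x -> deriv_in (seg L) f x (f' x)) -> cseg L f' ->
  (forall x, seg L x -> deriv_in (seg L) g x (g' x)) -> cseg L g' ->
  Int (fun x => f' x * g x) = f L * g L - f 0 * g 0 - Int (fun x => f x * g' x).
Proof.
  intros Hf Cf Hg Cg.
  pose proof (cseg_deriv _ _ _ Hf) as Cf0. pose proof (cseg_deriv _ _ _ Hg) as Cg0.
  rewrite <- (Int_FTC (fun x => f x * g x) (fun x => f' x * g x + f x * g' x)).
  - rewrite Int_plus by auto with cseg. ring.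
  - intros x Hx. apply deriv_in_mult; auto.
  - auto with cseg.
Qed.

Lemma cseg_series (u : nat -> R -> R) (M : nat -> R) : ex_series M ->
  (forall k, cseg L (u k)) -> (forall k s, seg L s -> Rabs (u (S k) s) <= M (S k)) ->
  cseg L (fun s => Series (fun k => u k s)).
Proof.
  intros HM Hu Hb s Hs. apply (flim_series _ u (fun k => u k s) M); auto.
  - unfold within. apply filter_forall. auto.
  - intros k. apply Hu; auto.
Qed.

Lemma Int_sum (u : nat -> R -> R) n : (forall k, cseg L (u k)) ->
  cseg L (fun s => sum_n (fun k => u k s) n) /\
  Int (fun s => sum_n (fun k => u k s) n) = sum_n (fun k => Int (u k)) n.
Proof.
  intros Hu. induction n as [|n [IH1 IH2]].
  - split; [eapply cseg_ext; [|apply (Hu O)]; intros s _; rewrite sum_O; reflexivity|].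
    rewrite sum_O. apply Int_ext. intros s _. rewrite sum_O; reflexivity.
  - split.
    + eapply cseg_ext; [|apply (cseg_plus _ _ _ IH1 (Hu (S n)))].
      intros s _. rewrite sum_Sn. reflexivity.
    + rewrite sum_Sn. unfold plus; simpl. rewrite <- IH2, <- Int_plus by auto.
      apply Int_ext. intros s _. rewrite sum_Sn. reflexivity.
Qed.

(** The remainders of a dominated series are uniformly small. *)
Lemma Int_series (u : nat -> R -> R) (M : nat -> R) : ex_series M ->
  (forall k, cseg L (u k)) -> (forall k s, seg L s -> Rabs (u (S k) s) <= M (S k)) ->
  Int (fun s => Series (fun k => u k s)) = Series (fun k => Int (u k)).
Proof.
  intros HM Hu Hb. symmetry. apply is_series_unique.
  apply (proj2 (filterlim_locally (F := eventually) _ _)). intros eps.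
  assert (Hs := Series_correct _ HM).
  assert (Hp : 0 < eps / (2 * L)) by (apply Rdiv_lt_0_compat; [apply cond_pos|lra]).
  destruct (proj1 (filterlim_locally (F := eventually) _ _) Hs (mkposreal _ Hp)) as [n0 Hn0].
  exists n0. intros n Hn. specialize (Hn0 n Hn).
  destruct (Int_sum u n Hu) as [C E].
  pose proof (cseg_series u M HM Hu Hb) as CS.
  change (Rabs (sum_n (fun k => Int (u k)) n - Int (fun s => Series (fun k => u k s))) < eps).
  rewrite <- E.
  rewrite <- Int_minus by auto.
  apply Rle_lt_trans with (L * (eps / (2 * L))).
  - apply Int_bound; [auto with cseg|]. intros s Hss.
    rewrite (Series_split (fun k => u k s) n) by (apply (ex_series_dom _ M); auto).
    match goal with |- Rabs ?x <= _ => replace x with (- Series (fun k => u (S n + k)%nat s)) by ring end.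
    rewrite Rabs_Ropp.
    eapply Rle_trans; [apply (Series_abs_le _ (fun k => M (S n + k)%nat))|].
    + intros k. apply Hb; auto.
    + apply (ex_series_incr_n M (S n)); auto.
    + assert (Hb' : Rabs (sum_n M n - Series M) < eps / (2 * L)) by exact Hn0.
      rewrite (Series_split M n HM) in Hb'. apply Rabs_def2 in Hb'.
      lra.
  - replace (L * (eps / (2 * L))) with (eps / 2) by (field; lra).
    pose proof (cond_pos eps). lra.
Qed.

End Segment.

(** * Cosine series on a segment *)

Definition freq (L : R) : R := PI / L.

Definition cosw (L : R) (k : nat) (s : R) : R := cos (INR k * freq L * s).
Definition sinw (L : R) (k : nat) (s : R) : R := sin (INR k * freq L * s).

Section Fourier.
Variable L : R.
Hypothesis HL : 0 < L.
Notation w := (freq L).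
Notation Int := (integ L).

Lemma freq_pos : 0 < w.
Proof. apply Rdiv_lt_0_compat; [apply PI_RGT_0|exact HL]. Qed.

Lemma freq_L : w * L = PI.
Proof. unfold freq. field. lra. Qed.

Lemma freq_seg s : seg L s -> 0 <= w * s <= PI.
Proof.
  intros [H1 H2]. pose proof freq_pos. split; [apply Rmult_le_pos; lra|].
  rewrite <- freq_L. apply Rmult_le_compat_l; lra.
Qed.

Lemma accum_seg s : seg L s -> accum (seg L) s.
Proof.
  intros [H1 H2] d Hd. destruct (Rlt_dec s L).
  - exists (s + Rmin (d / 2) (L - s)).
    assert (0 < Rmin (d / 2) (L - s)) by (apply Rmin_glb_lt; lra).
    pose proof (Rmin_l (d / 2) (L - s)). pose proof (Rmin_r (d / 2) (L - s)).
    repeat split; try lra. rewrite Rabs_right; lra.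
  - exists (s - Rmin (d / 2) L).
    assert (0 < Rmin (d / 2) L) by (apply Rmin_glb_lt; lra).
    pose proof (Rmin_l (d / 2) L). pose proof (Rmin_r (d / 2) L).
    repeat split; try lra. rewrite Rabs_left; lra.
Qed.

(** The primitive is monotone with equal end values, hence constant. *)
Lemma Int_zero_nonneg (f : R -> R) : cseg L f -> (forall s, seg L s -> 0 <= f s) -> Int f = 0 ->
  forall s, seg L s -> f s = 0.
Proof.
  intros Cf Hf HI.
  assert (Mono : forall x y, seg L x -> seg L y -> x <= y -> RInt f 0 x <= RInt f 0 y).
  { intros x y Hx Hy Hxy.
    destruct (deriv_in_mvt (seg L) (fun z => RInt f 0 z) f x y Hxy) as [c [Hc E]].
    - intros z Hz. destruct Hx, Hy; split; lra.
    - intros z Hz. apply RInt_deriv_in; auto. destruct Hx, Hy; split; lra.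
    - assert (seg L c) by (destruct Hx, Hy; split; lra).
      assert (0 <= f c * (y - x)) by (apply Rmult_le_pos; [auto|lra]). lra. }
  assert (Z : forall x, seg L x -> RInt f 0 x = 0).
  { intros x Hx. apply Rle_antisym.
    - apply Rle_trans with (Int f); [|rewrite HI; lra].
      unfold integ. apply Mono; auto; [apply seg_L; auto|apply Hx].
    - pose proof (Mono 0 x (seg_0 L HL) Hx (proj1 Hx)) as H.
      rewrite (RInt_point (V := R_CompleteNormedModule) 0 f) in H. exact H. }
  intros s Hs.
  apply (deriv_in_unique (seg L) (fun z => RInt f 0 z) s); [apply accum_seg; auto| |].
  - apply RInt_deriv_in; auto.
  - apply (deriv_in_ext _ (fun _ => 0)); auto.
    + intros y Hy. symmetry. auto.
    + apply deriv_in_const.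
Qed.

Lemma cosw_is_derive k s : is_derive (cosw L k) s (- (INR k * w) * sinw L k s).
Proof. unfold cosw, sinw. auto_derive; auto. ring. Qed.

Lemma sinw_is_derive k s : is_derive (sinw L k) s (INR k * w * cosw L k s).
Proof. unfold cosw, sinw. auto_derive; auto. ring. Qed.

Lemma cosw_cseg k : cseg L (cosw L k).
Proof. unfold cosw. auto with cseg. Qed.

Lemma sinw_cseg k : cseg L (sinw L k).
Proof. unfold sinw. auto with cseg. Qed.

Lemma sinw_0 k : sinw L k 0 = 0.
Proof. unfold sinw. rewrite Rmult_0_r. apply sin_0. Qed.

Lemma sinw_L k : sinw L k L = 0.
Proof.
  unfold sinw. rewrite Rmult_assoc, freq_L. apply sin_eq_0_1. exists (Z.of_nat k).
  rewrite <- INR_IZR_INZ. reflexivity.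
Qed.

Lemma cosw_bound k s : Rabs (cosw L k s) <= 1.
Proof. apply Rabs_le, COS_bound. Qed.

Lemma sinw_bound k s : Rabs (sinw L k s) <= 1.
Proof. apply Rabs_le, SIN_bound. Qed.

Lemma cosw_O s : cosw L 0 s = 1.
Proof. unfold cosw. simpl. rewrite !Rmult_0_l. apply cos_0. Qed.

Lemma Int_cosw k : Int (cosw L (S k)) = 0.
Proof.
  assert (HI : INR (S k) * w <> 0).
  { apply Rgt_not_eq, Rmult_lt_0_compat; [apply lt_0_INR; lia|apply freq_pos]. }
  rewrite (Int_FTC L HL (fun s => / (INR (S k) * w) * sinw L (S k) s)).
  - rewrite sinw_0, sinw_L. ring.
  - intros x _. apply is_derive_deriv_in.
    apply (is_derive_ext (fun s => scal (/ (INR (S k) * w)) (sinw L (S k) s))); [reflexivity|].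
    replace (cosw L (S k) x) with (scal (/ (INR (S k) * w)) (INR (S k) * w * cosw L (S k) x)).
    + apply is_derive_scal, sinw_is_derive.
    + unfold scal; simpl; unfold mult; simpl. field.
      apply Rmult_neq_0_reg in HI. destruct HI. split; auto.
  - apply cosw_cseg.
Qed.

Definition dist_nat (j k : nat) : nat := (j - k) + (k - j).

Lemma cosw_dist j k s : cosw L (dist_nat j k) s = cos ((INR j - INR k) * w * s).
Proof.
  unfold cosw, dist_nat. destruct (Nat.le_ge_cases j k).
  - replace (j - k)%nat with O by lia. rewrite Nat.add_0_l, minus_INR by auto.
    rewrite <- cos_neg. f_equal. ring.
  - replace (k - j)%nat with O by lia. rewrite Nat.add_0_r, minus_INR by auto. reflexivity.
Qed.

Lemma cosw_cosw j k s :
  cosw L j s * cosw L k s = / 2 * (cosw L (dist_nat j k) s + cosw L (j + k) s).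
Proof.
  rewrite cosw_dist. unfold cosw. rewrite plus_INR.
  rewrite !Rmult_plus_distr_r. unfold Rminus. rewrite !Rmult_plus_distr_r, !cos_plus.
  replace (- INR k * w * s) with (- (INR k * w * s)) by ring.
  rewrite cos_neg, sin_neg. field.
Qed.

Lemma sinw_sinw j k s :
  sinw L j s * sinw L k s = / 2 * (cosw L (dist_nat j k) s - cosw L (j + k) s).
Proof.
  rewrite cosw_dist. unfold cosw, sinw. rewrite plus_INR.
  rewrite !Rmult_plus_distr_r. unfold Rminus. rewrite !Rmult_plus_distr_r, !cos_plus.
  replace (- INR k * w * s) with (- (INR k * w * s)) by ring.
  rewrite cos_neg, sin_neg. field.
Qed.

(** Squared norms of the cosine modes. *)
Definition mass (k : nat) : R := match k with O => L | _ => L / 2 end.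

Lemma mass_pos k : 0 < mass k.
Proof. destruct k; simpl; lra. Qed.

Lemma Int_cosw_cosw j k :
  Int (fun s => cosw L j s * cosw L k s) = if Nat.eq_dec j k then mass k else 0.
Proof.
  rewrite (Int_ext L HL _ (fun s => / 2 * (cosw L (dist_nat j k) s + cosw L (j + k) s)))
    by (intros; apply cosw_cosw).
  pose proof cosw_cseg as C.
  rewrite Int_scal, Int_plus by auto with cseg.
  assert (E0 : Int (cosw L 0) = L).
  { rewrite (Int_ext L HL _ (fun _ => 1)) by (intros; apply cosw_O). rewrite Int_const. ring. }
  unfold dist_nat. destruct (Nat.eq_dec j k) as [->|Hne].
  - replace (k - k + (k - k))%nat with O by lia. rewrite E0.
    destruct k; simpl mass.
    + change (0 + 0)%nat with O; rewrite E0. field.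
    + replace (S k + S k)%nat with (S (k + S k)) by lia. rewrite Int_cosw. field.
  - destruct (j - k + (k - j))%nat as [|d] eqn:Ed; [lia|].
    destruct (j + k)%nat as [|e] eqn:Ee; [lia|].
    rewrite !Int_cosw. ring.
Qed.

Definition all_coef_zero (u : R -> R) : Prop :=
  cseg L u /\ forall k, Int (fun s => u s * cosw L k s) = 0.

(** By the product formula, multiplication by cos(ws) only mixes neighbouring coefficients. *)
Lemma all_coef_zero_mult u : all_coef_zero u -> all_coef_zero (fun s => u s * cosw L 1 s).
Proof.
  intros [Cu H]. pose proof cosw_cseg as C. split; [auto with cseg|]. intros k.
  rewrite (Int_ext L HL _ (fun s => / 2 * (u s * cosw L (dist_nat 1 k) s + u s * cosw L (1 + k) s))).
  - rewrite Int_scal, Int_plus by auto with cseg. rewrite !H. ring.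
  - intros s _. rewrite Rmult_assoc, cosw_cosw. ring.
Qed.

Lemma all_coef_zero_lin a u v : all_coef_zero u -> all_coef_zero v ->
  all_coef_zero (fun s => a * u s + v s).
Proof.
  intros [Cu Hu] [Cv Hv]. pose proof cosw_cseg as C. split; [auto with cseg|]. intros k.
  rewrite (Int_ext L HL _ (fun s => a * (u s * cosw L k s) + v s * cosw L k s)) by (intros; ring).
  rewrite Int_plus, Int_scal by auto with cseg. rewrite Hu, Hv. ring.
Qed.

Lemma all_coef_zero_ext u v : (forall s, seg L s -> u s = v s) -> all_coef_zero u -> all_coef_zero v.
Proof.
  intros E [Cu Hu]. split; [apply (cseg_ext _ u); auto|]. intros k. rewrite <- (Hu k).
  apply Int_ext; auto. intros s Hs. rewrite E; auto.
Qed.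

Lemma all_coef_zero_peak c n u : all_coef_zero u ->
  all_coef_zero (fun s => u s * (1 - (cosw L 1 s - c) ^ 2 / 4) ^ n).
Proof.
  intros Hu. induction n as [|n IH].
  - apply (all_coef_zero_ext u); auto. intros s _. simpl. ring.
  - set (v := fun s => u s * (1 - (cosw L 1 s - c) ^ 2 / 4) ^ n) in *.
    assert (H1 := all_coef_zero_mult _ IH). assert (H2 := all_coef_zero_mult _ H1).
    assert (H3 := all_coef_zero_lin (- c ^ 2 / 4) _ _ IH IH).
    assert (H4 := all_coef_zero_lin (2 * c / 4) _ _ H1 H3).
    assert (H5 := all_coef_zero_lin (- / 4) _ _ H2 H4).
    eapply all_coef_zero_ext; [|exact H5]. intros s _. unfold v. simpl. field.
Qed.

(** Strict monotonicity of the cosine on [0, PI]. *)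
Lemma cos_gap s0 d : seg L s0 -> 0 < d ->
  exists m, 0 < m <= 1 /\ forall s, seg L s -> d <= Rabs (s - s0) ->
    m <= Rabs (cosw L 1 s - cosw L 1 s0).
Proof.
  intros H0 Hd. pose proof freq_pos as Hw.
  assert (Lt : forall x y, seg L x -> seg L y -> x < y -> cosw L 1 y < cosw L 1 x).
  { intros x y Hx Hy Hxy. unfold cosw. simpl INR. rewrite !Rmult_1_l.
    pose proof (freq_seg x Hx). pose proof (freq_seg y Hy).
    apply cos_decreasing_1; try lra. apply Rmult_lt_compat_l; lra. }
  assert (Le : forall x y, seg L x -> seg L y -> x <= y -> cosw L 1 y <= cosw L 1 x).
  { intros x y Hx Hy [Hxy| ->]; [left; apply Lt; auto|lra]. }
  assert (R1 : exists m, 0 < m <= 1 /\ forall s, seg L s -> d <= s - s0 ->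
      m <= cosw L 1 s0 - cosw L 1 s).
  { destruct (Rle_dec (s0 + d) L).
    - assert (seg L (s0 + d)) by (destruct H0; split; lra).
      exists (Rmin 1 (cosw L 1 s0 - cosw L 1 (s0 + d))). split.
      + split; [|apply Rmin_l]. apply Rmin_glb_lt; [lra|].
        pose proof (Lt s0 (s0 + d) H0 H ltac:(lra)). lra.
      + intros s Hs Hds. eapply Rle_trans; [apply Rmin_r|].
        pose proof (Le (s0 + d) s H Hs ltac:(lra)). lra.
    - exists 1. split; [lra|]. intros s [_ Hs] Hds. lra. }
  assert (R2 : exists m, 0 < m <= 1 /\ forall s, seg L s -> d <= s0 - s ->
      m <= cosw L 1 s - cosw L 1 s0).
  { destruct (Rle_dec 0 (s0 - d)).
    - assert (seg L (s0 - d)) by (destruct H0; split; lra).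
      exists (Rmin 1 (cosw L 1 (s0 - d) - cosw L 1 s0)). split.
      + split; [|apply Rmin_l]. apply Rmin_glb_lt; [lra|].
        pose proof (Lt (s0 - d) s0 H H0 ltac:(lra)). lra.
      + intros s Hs Hds. eapply Rle_trans; [apply Rmin_r|].
        pose proof (Le s (s0 - d) Hs H ltac:(lra)). lra.
    - exists 1. split; [lra|]. intros s [Hs _] Hds. lra. }
  destruct R1 as [m1 [Hm1 B1]]. destruct R2 as [m2 [Hm2 B2]].
  exists (Rmin m1 m2). split.
  - split; [apply Rmin_glb_lt; lra|]. eapply Rle_trans; [apply Rmin_l|lra].
  - intros s Hs Hds. pose proof (Rmin_l m1 m2). pose proof (Rmin_r m1 m2).
    destruct (Rle_dec s0 s).
    + rewrite Rabs_right in Hds by lra. specialize (B1 s Hs Hds).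
      rewrite Rabs_minus_sym. eapply Rle_trans; [|apply Rle_abs]. lra.
    + rewrite Rabs_left in Hds by lra. specialize (B2 s Hs ltac:(lra)).
      eapply Rle_trans; [|apply Rle_abs]. lra.
Qed.

(** Bernoulli's inequality for (r1/r)^n. *)
Lemma pow_ratio_unbounded (r r1 A B : R) : 0 < r < r1 -> 0 < A ->
  ~ (forall n, A * r1 ^ n <= B * r ^ n).
Proof.
  intros [Hr Hr1] HA H.
  set (x := r1 / r - 1).
  assert (Hx : 0 < x).
  { unfold x. assert (1 < r1 / r) by (apply Rmult_lt_reg_r with r; [lra|]; unfold Rdiv; rewrite Rmult_assoc, Rinv_l; lra). lra. }
  destruct (INR_unbounded (B / (A * x))) as [n Hn].
  specialize (H n). pose proof (poly n x Hx) as Hp.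
  replace (1 + x) with (r1 / r) in Hp by (unfold x; ring).
  assert (Hrn : 0 < r ^ n) by (apply pow_lt; auto).
  assert (E : r1 ^ n = (r1 / r) ^ n * r ^ n).
  { rewrite <- Rpow_mult_distr. f_equal. field. lra. }
  rewrite E, <- Rmult_assoc in H. apply Rmult_le_reg_r in H; auto.
  assert (B < A * x * INR n).
  { apply Rmult_lt_reg_l with (/ (A * x)).
    - apply Rinv_0_lt_compat, Rmult_lt_0_compat; auto.
    - rewrite <- Rmult_assoc, Rinv_l by (apply Rgt_not_eq, Rmult_lt_0_compat; auto).
      rewrite Rmult_comm. unfold Rdiv in Hn. lra. }
  assert (A * (1 + INR n * x) <= A * (r1 / r) ^ n) by (apply Rmult_le_compat_l; lra).
  lra.
Qed.

(** If u(s0) > 0, then u is orthogonal to all powers of 1 - (cos(ws) - cos(ws0))^2/4, which are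
    nonnegative and concentrate at s0: a contradiction. *)
Lemma coef_zero_nonpos (u : R -> R) : all_coef_zero u -> forall s0, seg L s0 -> u s0 <= 0.
Proof.
  intros Hu s0 Hs0. apply Rnot_lt_le. intros Hpos.
  destruct Hu as [Cu Hu].
  destruct (seg_bounded L HL u Cu) as [M HM].
  pose proof (Cu s0 Hs0) as C0. flim_unfold C0.
  destruct (C0 (u s0 / 2) ltac:(lra)) as [d Hd].
  destruct (cos_gap s0 d Hs0 (cond_pos d)) as [m [Hm Hgap]].
  pose proof freq_pos as Hw.
  set (d' := Rmin d (m / (2 * w))).
  assert (Hd' : 0 < d') by (apply Rmin_glb_lt; [apply cond_pos|apply Rdiv_lt_0_compat; lra]).
  (* the tent function of width d' around s0, written with |.| as a positive part *)
  set (phi := fun s => (1 - / d' * Rabs (s - s0) + Rabs (1 - / d' * Rabs (s - s0))) / 2).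
  assert (Cphi : cseg L phi).
  { unfold phi, Rdiv. auto 10 with cseg. }
  assert (Hphi : forall s, (Rabs (s - s0) < d' -> 0 <= phi s <= 1) /\ (d' <= Rabs (s - s0) -> phi s = 0)).
  { intros s. unfold phi. pose proof (Rabs_pos (s - s0)).
    assert (0 < / d') by (apply Rinv_0_lt_compat; auto). split; intros Hlt.
    - assert (0 <= / d' * Rabs (s - s0)) by (apply Rmult_le_pos; lra).
      assert (/ d' * Rabs (s - s0) <= 1).
      { rewrite <- (Rinv_l d') by lra. apply Rmult_le_compat_l; lra. }
      rewrite (Rabs_right (1 - _)); lra.
    - assert (1 <= / d' * Rabs (s - s0)).
      { rewrite <- (Rinv_l d') by lra. apply Rmult_le_compat_l; lra. }
      rewrite (Rabs_left1 (1 - _)); lra. }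
  assert (Hc : 0 < Int phi).
  { assert (0 <= Int phi).
    { apply Int_nonneg; auto. intros s _. destruct (Hphi s) as [A B].
      destruct (Rlt_dec (Rabs (s - s0)) d'); [apply A; auto|rewrite B; lra]. }
    destruct H as [H|H]; auto. exfalso.
    assert (Z := Int_zero_nonneg phi Cphi).
    assert (Z0 : phi s0 = 0).
    { apply Z; auto. intros s _. destruct (Hphi s) as [A B].
      destruct (Rlt_dec (Rabs (s - s0)) d'); [apply A; auto|rewrite B; lra]. }
    unfold phi in Z0. replace (s0 - s0) with 0 in Z0 by ring. rewrite Rabs_R0, Rmult_0_r, Rminus_0_r, Rabs_R1 in Z0. lra. }
  set (q := fun s => 1 - (cosw L 1 s - cosw L 1 s0) ^ 2 / 4).
  assert (Cq : cseg L q) by (pose proof cosw_cseg; unfold q, Rdiv; auto 10 with cseg).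
  set (r := 1 - m ^ 2 / 4). set (r1 := 1 - m ^ 2 / 16).
  assert (Hm2 : 0 < m ^ 2 <= 1) by (simpl; split; nra).
  assert (Q01 : forall s, 0 <= q s <= 1).
  { intros s. unfold q. pose proof (COS_bound (INR 1 * w * s)). pose proof (COS_bound (INR 1 * w * s0)).
    fold (cosw L 1 s) in H. fold (cosw L 1 s0) in H0.
    set (a := cosw L 1 s - cosw L 1 s0). assert (Ha : -2 <= a <= 2) by (unfold a; lra).
    assert (0 <= a ^ 2 <= 4) by nra. lra. }
  assert (Qfar : forall s, seg L s -> d <= Rabs (s - s0) -> q s <= r).
  { intros s Hs Hds. unfold q, r. specialize (Hgap s Hs Hds).
    rewrite <- (pow2_abs (cosw L 1 s - cosw L 1 s0)). nra. }
  assert (Qnear : forall s, Rabs (s - s0) < d' -> r1 <= q s).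
  { intros s Hs. unfold q, r1.
    assert (Rabs (cosw L 1 s - cosw L 1 s0) <= w * Rabs (s - s0)).
    { destruct (MVT_gen (cosw L 1) s0 s (fun x => - (INR 1 * w) * sinw L 1 x)) as [c [_ E]].
      - intros x _. apply cosw_is_derive.
      - intros x _. apply continuity_pt_filterlim.
        apply (ex_derive_continuous (V := R_NormedModule)). eexists; apply cosw_is_derive.
      - rewrite E, Rabs_mult. apply Rmult_le_compat_r; [apply Rabs_pos|].
        simpl INR. rewrite Rabs_mult, Rabs_Ropp, Rmult_1_l, (Rabs_right w) by lra.
        pose proof (sinw_bound 1 c). nra. }
    assert (w * Rabs (s - s0) <= m / 2).
    { apply Rle_trans with (w * (m / (2 * w))).
      - apply Rmult_le_compat_l; [lra|]. left. eapply Rlt_le_trans; [exact Hs|apply Rmin_r].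
      - right. field. lra. }
    pose proof (Rabs_pos (cosw L 1 s - cosw L 1 s0)).
    rewrite <- (pow2_abs (cosw L 1 s - cosw L 1 s0)). nra. }
  apply (pow_ratio_unbounded r r1 (u s0 / 2 * Int phi) (L * M)); [unfold r, r1; lra|nra|].
  intros n.
  assert (HM0 : 0 <= M) by (eapply Rle_trans; [apply Rabs_pos|apply (HM s0 Hs0)]).
  assert (Hr0 : 0 <= r ^ n) by (apply pow_le; unfold r; lra).
  assert (Hr1 : 0 <= r1 ^ n) by (apply pow_le; unfold r1; lra).
  assert (Z : Int (fun s => u s * q s ^ n) = 0).
  { destruct (all_coef_zero_peak (cosw L 1 s0) n u (conj Cu Hu)) as [_ H]. specialize (H O).
    rewrite <- H. apply Int_ext; auto. intros s _. rewrite cosw_O. unfold q. ring. }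
  assert (Hle : Int (fun s => u s0 / 2 * r1 ^ n * phi s - M * r ^ n) <= Int (fun s => u s * q s ^ n)).
  { apply Int_le; auto with cseg. intros s Hs. destruct (Hphi s) as [P1 P2].
    destruct (Rlt_dec (Rabs (s - s0)) d) as [Hn|Hf].
    - assert (Hus : u s0 / 2 <= u s).
      { specialize (Hd s Hn Hs). apply Rabs_def2 in Hd. lra. }
      assert (0 <= M * r ^ n) by (apply Rmult_le_pos; auto).
      destruct (Q01 s) as [Q0 _].
      assert (0 <= q s ^ n) by (apply pow_le; auto).
      destruct (Rlt_dec (Rabs (s - s0)) d') as [Hn'|Hf'].
      + specialize (P1 Hn').
        assert (r1 ^ n <= q s ^ n) by (apply pow_incr; split; [unfold r1; lra|apply Qnear; auto]).
        assert (u s0 / 2 * r1 ^ n * phi s <= u s0 / 2 * r1 ^ n * 1).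
        { apply Rmult_le_compat_l; [apply Rmult_le_pos; lra|lra]. }
        assert (u s0 / 2 * r1 ^ n <= u s * q s ^ n) by (apply Rmult_le_compat; lra).
        lra.
      + rewrite P2 by lra. assert (0 <= u s * q s ^ n) by (apply Rmult_le_pos; lra). lra.
    - assert (Hds : d <= Rabs (s - s0)) by lra.
      rewrite P2 by (eapply Rle_trans; [apply Rmin_l|exact Hds]).
      assert (q s ^ n <= r ^ n) by (apply pow_incr; split; [apply Q01|apply Qfar; auto]).
      assert (0 <= q s ^ n) by (apply pow_le; apply Q01).
      specialize (HM s Hs). apply Rabs_le_between in HM. nra. }
  rewrite Z, Int_minus, Int_scal, Int_const in Hle by auto with cseg. lra.
Qed.

Lemma cos_coef_unique (u : R -> R) : cseg L u ->
  (forall k, Int (fun s => u s * cosw L k s) = 0) -> forall s, seg L s -> u s = 0.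
Proof.
  intros Cu Hu s Hs. pose proof cosw_cseg as C. apply Rle_antisym.
  - apply coef_zero_nonpos; auto. split; auto.
  - assert (H : all_coef_zero (fun s => - u s)).
    { split; [auto with cseg|]. intros k.
      rewrite (Int_ext L HL _ (fun s => - (u s * cosw L k s))) by (intros; ring).
      rewrite Int_opp by auto with cseg. rewrite Hu. ring. }
    pose proof (coef_zero_nonpos _ H s Hs). lra.
Qed.

Lemma cos_series_cseg (a M : nat -> R) : ex_series M -> (forall k, Rabs (a (S k)) <= M (S k)) ->
  cseg L (fun s => Series (fun k => a k * cosw L k s)).
Proof.
  intros HM Ha. pose proof cosw_cseg as C.
  apply (cseg_series L (fun k s => a k * cosw L k s) M); auto with cseg.
  intros k s _. rewrite Rabs_mult. pose proof (cosw_bound (S k) s). pose proof (Rabs_pos (a (S k))).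
  specialize (Ha k). pose proof (Rabs_pos (cosw L (S k) s)). nra.
Qed.

Lemma Series_single (a : nat -> R) (k : nat) : (forall j, j <> k -> a j = 0) -> Series a = a k.
Proof.
  intros H. apply is_series_unique.
  apply (proj2 (filterlim_locally (F := eventually) _ _)). intros eps.
  exists k. intros n Hn.
  assert (E : sum_n a n = a k).
  { assert (Z : forall m, (m < k)%nat -> sum_n a m = 0).
    { induction m; intros Hm; [rewrite sum_O; apply H; lia|].
      rewrite sum_Sn, IHm, H by lia. apply Rplus_0_l. }
    induction Hn as [|n Hn IH].
    - destruct k; [apply sum_O|]. rewrite sum_Sn, Z by lia. apply Rplus_0_l.
    - rewrite sum_Sn, IH, (H (S n)) by lia. apply Rplus_0_r. }
  change (Rabs (sum_n a n - a k) < eps). rewrite E, Rminus_diag, Rabs_R0. apply cond_pos.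
Qed.

Lemma cos_series_coef (a M : nat -> R) (k : nat) :
  ex_series M -> (forall j, Rabs (a (S j)) <= M (S j)) ->
  Int (fun s => Series (fun j => a j * cosw L j s) * cosw L k s) = mass k * a k.
Proof.
  intros HM Ha. pose proof cosw_cseg as C.
  rewrite (Int_ext L HL _ (fun s => Series (fun j => a j * (cosw L j s * cosw L k s)))).
  - rewrite (Int_series L HL (fun j s => a j * (cosw L j s * cosw L k s)) M); auto with cseg.
    + rewrite (Series_single _ k).
      * rewrite Int_scal, Int_cosw_cosw by auto with cseg.
        destruct (Nat.eq_dec k k); [ring|congruence].
      * intros j Hj. rewrite Int_scal, Int_cosw_cosw by auto with cseg.
        destruct (Nat.eq_dec j k); [congruence|ring].
    + intros j s _. rewrite !Rabs_mult.
      pose proof (cosw_bound (S j) s). pose proof (Rabs_pos (a (S j))). pose proof (cosw_bound k s).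
      specialize (Ha j). pose proof (Rabs_pos (cosw L (S j) s)). pose proof (Rabs_pos (cosw L k s)).
      assert (Rabs (cosw L (S j) s) * Rabs (cosw L k s) <= 1) by nra.
      assert (0 <= Rabs (cosw L (S j) s) * Rabs (cosw L k s)) by nra. nra.
  - intros s _. rewrite <- Series_scal_r. apply Series_ext. intros j. ring.
Qed.

(** Fourier inversion: the function and the series are continuous with equal coefficients. *)
Lemma cos_series_repr (u : R -> R) (a M : nat -> R) : cseg L u -> ex_series M ->
  (forall j, Rabs (a (S j)) <= M (S j)) ->
  (forall k, Int (fun s => u s * cosw L k s) = mass k * a k) ->
  forall s, seg L s -> u s = Series (fun k => a k * cosw L k s).
Proof.
  intros Cu HM Ha Hk s Hs. pose proof cosw_cseg as C.
  pose proof (cos_series_cseg a M HM Ha) as CS.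
  apply Rminus_diag_uniq.
  apply (cos_coef_unique (fun s => u s - Series (fun k => a k * cosw L k s))); auto with cseg.
  intros k.
  rewrite (Int_ext L HL _ (fun s => u s * cosw L k s - Series (fun j => a j * cosw L j s) * cosw L k s))
    by (intros; ring).
  rewrite Int_minus by auto with cseg. rewrite Hk, (cos_series_coef a M) by auto. ring.
Qed.

End Fourier.
#[export] Hint Resolve cosw_cseg sinw_cseg : cseg.

(** * Regularity of functions on a space-time strip *)

Definition convex_set (J : R -> Prop) : Prop :=
  forall x y z, J x -> J y -> x <= z <= y -> J z.

Lemma ray_convex : convex_set ray.
Proof. intros x y z Hx Hy Hz. unfold ray in *. lra. Qed.

Section Strip.
Variable L : R.
Hypothesis HL : 0 < L.
Variable J : R -> Prop.

Definition cstrip (F : R -> R -> R) : Prop :=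
  forall s t, seg L s -> J t ->
    flim (within (fun p : R2 => seg L (fst p) /\ J (snd p)) (locally (s, t)))
         (fun p => F (fst p) (snd p)) (F s t).

Definition ds_rel (F Fs : R -> R -> R) : Prop :=
  forall s t, seg L s -> J t -> deriv_in (seg L) (fun x => F x t) s (Fs s t).

Definition dt_rel (F Ft : R -> R -> R) : Prop :=
  forall s t, seg L s -> J t -> deriv_in J (fun y => F s y) t (Ft s t).

(** [strip_reg m k F]: all mixed derivatives of [F] of order at most [m] in space and [k] in
    time, taken in any order, exist and are continuous on the strip.  Keeping the two orders
    apart is what lets the heat equation trade one time derivative for two space derivatives. *)
Inductive strip_reg : nat -> nat -> (R -> R -> R) -> Prop :=
| strip_reg_intro m k F :
    cstrip F ->
    (forall m', m = S m' -> exists Fs, ds_rel F Fs /\ strip_reg m' k Fs) ->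
    (forall k', k = S k' -> exists Ft, dt_rel F Ft /\ strip_reg m k' Ft) ->
    strip_reg m k F.

Lemma strip_reg_cstrip m k F : strip_reg m k F -> cstrip F.
Proof. destruct 1; auto. Qed.

Lemma strip_reg_s m k F : strip_reg (S m) k F -> exists Fs, ds_rel F Fs /\ strip_reg m k Fs.
Proof. intros H. inversion H; subst. auto. Qed.

Lemma strip_reg_t m k F : strip_reg m (S k) F -> exists Ft, dt_rel F Ft /\ strip_reg m k Ft.
Proof. intros H. inversion H; subst. auto. Qed.

Lemma strip_ind (P : nat -> nat -> Prop) :
  (forall m k, (forall m' k', (m' + k' < m + k)%nat -> P m' k') -> P m k) -> forall m k, P m k.
Proof.
  intros H.
  assert (forall n m k, (m + k <= n)%nat -> P m k).
  { induction n; intros m k Hmk; apply H; intros m' k' Hlt; [lia|apply IHn; lia]. }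
  intros m k. eauto.
Qed.

Lemma cstrip_ext F G : (forall s t, seg L s -> J t -> F s t = G s t) -> cstrip F -> cstrip G.
Proof.
  intros E H s t Hs Ht. rewrite <- E by auto.
  eapply filterlim_within_ext; [|apply H; auto]. intros [x y] [Hx Hy]; apply E; auto.
Qed.

Lemma ds_rel_ext F G Fs : (forall s t, seg L s -> J t -> F s t = G s t) -> ds_rel F Fs -> ds_rel G Fs.
Proof. intros E H s t Hs Ht. apply (deriv_in_ext _ (fun x => F x t)); auto. Qed.

Lemma dt_rel_ext F G Ft : (forall s t, seg L s -> J t -> F s t = G s t) -> dt_rel F Ft -> dt_rel G Ft.
Proof. intros E H s t Hs Ht. apply (deriv_in_ext _ (fun x => F s x)); auto. Qed.

Lemma strip_reg_ext m k F G : (forall s t, seg L s -> J t -> F s t = G s t) ->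
  strip_reg m k F -> strip_reg m k G.
Proof.
  intros E H. inversion H as [m0 k0 F0 C S T]; subst. constructor.
  - apply (cstrip_ext F); auto.
  - intros m' Hm. destruct (S m' Hm) as [Fs [D R]]. exists Fs; split; auto. apply (ds_rel_ext F); auto.
  - intros k' Hk. destruct (T k' Hk) as [Ft [D R]]. exists Ft; split; auto. apply (dt_rel_ext F); auto.
Qed.

Lemma strip_reg_le m k : forall m' k' F, (m' <= m)%nat -> (k' <= k)%nat ->
  strip_reg m k F -> strip_reg m' k' F.
Proof.
  revert m k. apply (strip_ind (fun m k => forall m' k' F, (m' <= m)%nat -> (k' <= k)%nat ->
    strip_reg m k F -> strip_reg m' k' F)).
  intros m k IH m' k' F Hm Hk H. inversion H as [m0 k0 F0 C S T]; subst. constructor; auto.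
  - intros m1 E. destruct m as [|m]; [lia|]. destruct (S m eq_refl) as [Fs [D R]].
    exists Fs; split; auto. apply (IH m k); auto; lia.
  - intros k1 E. destruct k as [|k]; [lia|]. destruct (T k eq_refl) as [Ft [D R]].
    exists Ft; split; auto. apply (IH m k); auto; lia.
Qed.

Lemma ds_rel_unique F Fs Gs : ds_rel F Fs -> ds_rel F Gs ->
  forall s t, seg L s -> J t -> Fs s t = Gs s t.
Proof.
  intros H1 H2 s t Hs Ht. apply (deriv_in_unique (seg L) (fun x => F x t) s); auto.
  apply accum_seg; auto.
Qed.

(** Derivatives on the segment are unique, so any candidate agrees with the derivative that
    [strip_reg] provides. *)
Lemma strip_reg_ds m k F Fs : strip_reg (S m) k F -> ds_rel F Fs -> strip_reg m k Fs.
Proof.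
  intros H D. destruct (strip_reg_s _ _ _ H) as [Gs [D' R]].
  apply (strip_reg_ext m k Gs); auto. apply (ds_rel_unique F); auto.
Qed.

Lemma strip_reg_const m k c : strip_reg m k (fun _ _ => c).
Proof.
  revert c. pattern m, k. apply strip_ind. clear m k. intros m k IH c. constructor.
  - intros s t _ _. apply flim_const. typeclasses eauto.
  - intros m' ->. exists (fun _ _ => 0). split; [intros s t _ _; apply deriv_in_const|apply IH; lia].
  - intros k' ->. exists (fun _ _ => 0). split; [intros s t _ _; apply deriv_in_const|apply IH; lia].
Qed.

Lemma strip_reg_plus m k : forall F G,
  strip_reg m k F -> strip_reg m k G -> strip_reg m k (fun s t => F s t + G s t).
Proof.
  pattern m, k. apply strip_ind. clear m k. intros m k IH F G HF HG.
  inversion HF as [? ? ? CF SF TF]; subst. inversion HG as [? ? ? CG SG TG]; subst.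
  constructor.
  - intros s t Hs Ht. apply (flim_plus _ (fun p => F (fst p) (snd p)) (fun p => G (fst p) (snd p))); auto.
  - intros m' E. destruct (SF m' E) as [Fs [DF RF]]. destruct (SG m' E) as [Gs [DG RG]].
    exists (fun s t => Fs s t + Gs s t). split.
    + intros s t Hs Ht. apply (deriv_in_plus _ (fun x => F x t) (fun x => G x t)); auto.
    + apply IH; auto; lia.
  - intros k' E. destruct (TF k' E) as [Ft [DF RF]]. destruct (TG k' E) as [Gt [DG RG]].
    exists (fun s t => Ft s t + Gt s t). split.
    + intros s t Hs Ht. apply (deriv_in_plus _ (fun x => F s x) (fun x => G s x)); auto.
    + apply IH; auto; lia.
Qed.

Lemma strip_reg_mult m k : forall F G,
  strip_reg m k F -> strip_reg m k G -> strip_reg m k (fun s t => F s t * G s t).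
Proof.
  pattern m, k. apply strip_ind. clear m k. intros m k IH F G HF HG.
  inversion HF as [? ? ? CF SF TF]; subst. inversion HG as [? ? ? CG SG TG]; subst.
  constructor.
  - intros s t Hs Ht. apply (flim_mult _ (fun p => F (fst p) (snd p)) (fun p => G (fst p) (snd p))); auto.
  - intros m' E. destruct (SF m' E) as [Fs [DF RF]]. destruct (SG m' E) as [Gs [DG RG]].
    exists (fun s t => Fs s t * G s t + F s t * Gs s t). split.
    + intros s t Hs Ht. apply (deriv_in_mult _ (fun x => F x t) (fun x => G x t)); auto.
    + apply strip_reg_plus; apply IH; auto; try lia; [apply (strip_reg_le m k _ _ G)|apply (strip_reg_le m k _ _ F)];
        auto; lia.
  - intros k' E. destruct (TF k' E) as [Ft [DF RF]]. destruct (TG k' E) as [Gt [DG RG]].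
    exists (fun s t => Ft s t * G s t + F s t * Gt s t). split.
    + intros s t Hs Ht. apply (deriv_in_mult _ (fun x => F s x) (fun x => G s x)); auto.
    + apply strip_reg_plus; apply IH; auto; try lia; [apply (strip_reg_le m k _ _ G)|apply (strip_reg_le m k _ _ F)];
        auto; lia.
Qed.

Lemma strip_reg_scal m k c F : strip_reg m k F -> strip_reg m k (fun s t => c * F s t).
Proof. intros H. apply (strip_reg_mult m k (fun _ _ => c)); auto. apply strip_reg_const. Qed.

Lemma strip_reg_opp m k F : strip_reg m k F -> strip_reg m k (fun s t => - F s t).
Proof.
  intros H. apply (strip_reg_ext m k (fun s t => -1 * F s t)); [intros; ring|].
  apply strip_reg_scal; auto.
Qed.

Lemma strip_reg_minus m k F G :
  strip_reg m k F -> strip_reg m k G -> strip_reg m k (fun s t => F s t - G s t).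
Proof. intros HF HG. apply (strip_reg_plus m k F (fun s t => - G s t)); auto. apply strip_reg_opp; auto. Qed.

Lemma cos_is_derive x : is_derive cos x (- sin x).
Proof. auto_derive; auto. ring. Qed.

Lemma sin_is_derive x : is_derive sin x (cos x).
Proof. auto_derive; auto. ring. Qed.

(** The chain rule reproduces itself when the outer function is one of a sequence closed under
    differentiation, which spares all formulas for higher derivatives of a composition. *)
Lemma strip_reg_comp (U : R -> Prop) (phi : nat -> R -> R) :
  (forall i x, U x -> is_derive (phi i) x (phi (S i) x)) ->
  forall m k i F, (forall s t, seg L s -> J t -> U (F s t)) ->
  strip_reg m k F -> strip_reg m k (fun s t => phi i (F s t)).
Proof.
  intros Hphi m k. pattern m, k. apply strip_ind. clear m k. intros m k IH i F HU HF.
  inversion HF as [? ? ? CF SF TF]; subst. constructor.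
  - intros s t Hs Ht. apply (flim_comp _ (fun p => F (fst p) (snd p)) (phi i)); auto.
    apply (ex_derive_continuous (V := R_NormedModule)). eexists. apply Hphi; auto.
  - intros m' E. destruct (SF m' E) as [Fs [DF RF]].
    exists (fun s t => phi (S i) (F s t) * Fs s t). split.
    + intros s t Hs Ht. apply (deriv_in_comp _ (fun x => F x t) (phi i)); auto.
    + apply (strip_reg_mult m' k (fun s t => phi (S i) (F s t))); auto.
      apply IH; auto; [lia|]. apply (strip_reg_le m k); auto; lia.
  - intros k' E. destruct (TF k' E) as [Ft [DF RF]].
    exists (fun s t => phi (S i) (F s t) * Ft s t). split.
    + intros s t Hs Ht. apply (deriv_in_comp _ (fun x => F s x) (phi i)); auto.
    + apply (strip_reg_mult m k' (fun s t => phi (S i) (F s t))); auto.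
      apply IH; auto; [lia|]. apply (strip_reg_le m k); auto; lia.
Qed.

Lemma strip_reg_cos_shift m k i F : strip_reg m k F ->
  strip_reg m k (fun s t => cos (F s t + INR i * (PI / 2))).
Proof.
  intros H. apply (strip_reg_comp (fun _ => True) (fun i x => cos (x + INR i * (PI / 2)))); auto.
  intros j x _. rewrite S_INR.
  replace (x + (INR j + 1) * (PI / 2)) with (x + INR j * (PI / 2) + PI / 2) by ring.
  rewrite cos_plus, cos_PI2, sin_PI2. auto_derive; auto. ring.
Qed.

Lemma strip_reg_cos m k F : strip_reg m k F -> strip_reg m k (fun s t => cos (F s t)).
Proof.
  intros H. apply (strip_reg_ext m k _ _) with (2 := strip_reg_cos_shift m k 0 F H).
  intros s t _ _. f_equal. simpl. ring.
Qed.

Lemma strip_reg_sin m k F : strip_reg m k F -> strip_reg m k (fun s t => sin (F s t)).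
Proof.
  intros H. apply (strip_reg_ext m k _ _) with (2 := strip_reg_cos_shift m k 3 F H).
  intros s t _ _. replace (INR 3) with 3 by (simpl; ring).
  rewrite cos_plus, cos_3PI2, sin_3PI2. ring.
Qed.

Lemma strip_reg_inv m k F : (forall s t, seg L s -> J t -> F s t <> 0) ->
  strip_reg m k F -> strip_reg m k (fun s t => / F s t).
Proof.
  intros Hnz H.
  apply (strip_reg_ext m k (fun s t => (-1) ^ 0 * INR (fact 0) / F s t ^ 1)).
  { intros s t Hs Ht. simpl. field. auto. }
  apply (strip_reg_comp (fun x => x <> 0) (fun i x => (-1) ^ i * INR (fact i) / x ^ S i)); auto.
  intros i x Hx. rewrite fact_simpl, mult_INR. auto_derive.
  - apply (pow_nonzero x (S i)); auto.
  - change (match i with O => 1 | S _ => INR i + 1 end) with (INR (S i)). simpl pow. field.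
    split; auto. apply pow_nonzero; auto.
Qed.

Lemma cstrip_slice F t : cstrip F -> J t -> cseg L (fun s => F s t).
Proof.
  intros H Ht s Hs. apply flim_eps; [typeclasses eauto|]. intros eps He.
  pose proof (H s t Hs Ht) as H0. flim_unfold H0.
  destruct (H0 eps He) as [d Hd]. exists d. intros y Hy Sy.
  apply (Hd (y, t)); [|split; auto]. split; [exact Hy|apply ball_center].
Qed.

(** Compactness of the segment makes continuity in time uniform in space. *)
Lemma cstrip_tube F t0 : cstrip F -> J t0 -> forall eps, 0 < eps ->
  exists d, 0 < d /\ forall s t, seg L s -> J t -> Rabs (t - t0) < d -> Rabs (F s t - F s t0) < eps.
Proof.
  intros H H0 eps He.
  assert (Loc : forall s, exists d : posreal, seg L s -> forall x y, seg L x -> J y ->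
     Rabs (x - s) < d -> Rabs (y - t0) < d -> Rabs (F x y - F s t0) < eps / 2).
  { intros s. destruct (excluded_middle_informative (seg L s)) as [Hs|Hs].
    - pose proof (H s t0 Hs H0) as H1. flim_unfold H1.
      destruct (H1 (eps / 2)) as [d Hd]; [lra|]. exists d. intros _ x y Hx Hy Bx By.
      apply (Hd (x, y)); split; auto.
    - exists (mkposreal 1 Rlt_0_1). tauto. }
  set (delta := fun s => proj1_sig (constructive_indefinite_description _ (Loc s))).
  destruct (compactness_value_1d 0 L delta) as [d Hd].
  exists d. split; [apply cond_pos|]. intros s t Hs Ht Hst.
  apply Rnot_le_lt. intros Hle. apply (Hd s Hs). intros [x [Hx [Hsx Hdx]]].
  unfold delta in Hsx, Hdx.
  destruct (constructive_indefinite_description _ (Loc x)) as [dx Px]. simpl in Hsx, Hdx.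
  assert (A := Px Hx s t Hs Ht Hsx ltac:(lra)).
  assert (B := Px Hx s t0 Hs H0 Hsx). rewrite Rminus_diag, Rabs_R0 in B.
  specialize (B (cond_pos dx)).
  apply Rabs_def2 in A. apply Rabs_def2 in B.
  assert (Rabs (F s t - F s t0) < eps) by (apply Rabs_def1; lra). lra.
Qed.

Lemma integ_t_cont F t0 : cstrip F -> J t0 ->
  flim (within J (locally t0)) (fun t => integ L (fun s => F s t)) (integ L (fun s => F s t0)).
Proof.
  intros H H0. apply flim_eps; [typeclasses eauto|]. intros eps He.
  destruct (cstrip_tube F t0 H H0 (eps / (2 * L))) as [d [Hd Hb]].
  { apply Rdiv_lt_0_compat; lra. }
  exists (mkposreal d Hd). intros t Ht Jt.
  pose proof (cstrip_slice F t H Jt). pose proof (cstrip_slice F t0 H H0).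
  rewrite <- Int_minus by auto.
  apply Rle_lt_trans with (L * (eps / (2 * L))).
  - apply Int_bound; auto with cseg. intros s Hs. left. apply Hb; auto.
  - replace (L * (eps / (2 * L))) with (eps / 2) by (field; lra). lra.
Qed.

(** For each s the error of the linear approximation is controlled by the mean value theorem, and
    [cstrip_tube] makes this uniform in s. *)
Lemma integ_t_deriv F Ft t0 : convex_set J -> cstrip F -> cstrip Ft -> dt_rel F Ft -> J t0 ->
  deriv_in J (fun t => integ L (fun s => F s t)) t0 (integ L (fun s => Ft s t0)).
Proof.
  intros Hc HF HFt D H0. apply deriv_in_eps. intros eps He.
  destruct (cstrip_tube Ft t0 HFt H0 (eps / L)) as [d [Hd Hb]].
  { apply Rdiv_lt_0_compat; lra. }
  exists d; split; auto. intros t Jt Ht.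
  pose proof (cstrip_slice F t HF Jt). pose proof (cstrip_slice F t0 HF H0).
  pose proof (cstrip_slice Ft t0 HFt H0).
  rewrite (Rmult_comm (integ _ _)), <- Int_scal, <- !Int_minus by auto with cseg.
  replace (eps * Rabs (t - t0)) with (L * (eps / L * Rabs (t - t0))) by (field; lra).
  apply Int_bound; auto with cseg. intros s Hs.
  replace (F s t - F s t0 - (t - t0) * Ft s t0)
    with ((F s t + - Ft s t0 * t) - (F s t0 + - Ft s t0 * t0)) by ring.
  apply (deriv_in_lip (fun x => J x /\ Rabs (x - t0) < d) (fun x => F s x + - Ft s t0 * x)
    (fun x => Ft s x + - Ft s t0 * 1)).
  - intros x y z [Jx Bx] [Jy By] Hz. split; [apply (Hc x y); auto|].
    apply Rabs_def2 in Bx. apply Rabs_def2 in By. apply Rabs_def1; lra.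
  - intros x [Jx Bx]. apply (deriv_in_sub J); [tauto|].
    apply (deriv_in_plus J (fun x => F s x) (fun x => - Ft s t0 * x)); [apply D; auto|].
    apply deriv_in_scal, deriv_in_id.
  - intros x [Jx Bx]. replace (Ft s x + - Ft s t0 * 1) with (Ft s x - Ft s t0) by ring.
    left. apply Hb; auto.
  - split; auto. rewrite Rminus_diag, Rabs_R0. auto.
  - split; auto.
Qed.

Lemma cstrip_time (g : R -> R) : (forall t, J t -> flim (within J (locally t)) g (g t)) ->
  cstrip (fun _ t => g t).
Proof.
  intros H s t Hs Ht. apply flim_eps; [typeclasses eauto|]. intros eps He.
  pose proof (H t Ht) as H0. flim_unfold H0. destruct (H0 eps He) as [d Hd].
  exists d. intros [x y] [_ By] [_ Jy]. apply Hd; auto.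
Qed.

Lemma strip_reg_integ m0 m k : forall F, (k = O \/ convex_set J) ->
  strip_reg m0 k F -> strip_reg m k (fun _ t => integ L (fun s => F s t)).
Proof.
  pattern m, k. apply strip_ind. clear m k. intros m k IH F Hc HF.
  inversion HF as [? ? ? CF SF TF]; subst. constructor.
  - apply cstrip_time. intros t Ht. apply integ_t_cont; auto.
  - intros m' ->. exists (fun _ _ => 0). split; [intros s t _ _; apply deriv_in_const|].
    apply strip_reg_const.
  - intros k' ->. destruct (TF k' eq_refl) as [Ft [D R]]. destruct Hc as [Hc|Hc]; [lia|].
    exists (fun _ t => integ L (fun s => Ft s t)). split.
    + intros s t Hs Ht. apply integ_t_deriv; auto. eapply strip_reg_cstrip; eauto.
    + apply IH; auto; lia.
Qed.

End Strip.

(** * Polynomial weights and differentiated cosine series *)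

Definition wt (p k : nat) : R := / (1 + INR k) ^ p.

Lemma one_INR_pos k : 0 < 1 + INR k.
Proof. pose proof (pos_INR k). lra. Qed.

Lemma wt_pos p k : 0 < wt p k.
Proof. apply Rinv_0_lt_compat, pow_lt, one_INR_pos. Qed.

Lemma wt_S p k : wt (S p) k = wt p k / (1 + INR k).
Proof.
  unfold wt, Rdiv. simpl. rewrite Rinv_mult. ring.
Qed.

Lemma wt_mult p q k : wt (p + q) k = wt p k * wt q k.
Proof. unfold wt. rewrite pow_add, Rinv_mult. reflexivity. Qed.

Lemma wt_le_1 p k : wt p k <= 1.
Proof.
  unfold wt. rewrite <- Rinv_1. apply Rinv_le_contravar; [lra|].
  apply pow_R1_Rle. pose proof (pos_INR k); lra.
Qed.

Lemma wt_anti p q k : (p <= q)%nat -> wt q k <= wt p k.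
Proof.
  intros H. replace q with (p + (q - p))%nat by lia. rewrite wt_mult.
  pose proof (wt_pos p k). pose proof (wt_le_1 (q - p) k). pose proof (wt_pos (q - p) k). nra.
Qed.

Lemma sum_wt2 n : sum_n (wt 2) n <= 2 - / (1 + INR n).
Proof.
  induction n.
  - rewrite sum_O. unfold wt. simpl. lra.
  - rewrite sum_Sn. unfold plus; simpl plus.
    assert (wt 2 (S n) <= / (1 + INR n) - / (1 + INR (S n))).
    { unfold wt. rewrite S_INR. pose proof (pos_INR n).
      replace (/ (1 + INR n) - / (1 + (INR n + 1))) with (/ ((1 + INR n) * (1 + (INR n + 1)))) by (field; lra).
      apply Rinv_le_contravar; [nra|]. simpl. nra. }
    change (sum_n (wt 2) n + wt 2 (S n) <= 2 - / (1 + INR (S n))). lra.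
Qed.

Lemma ex_series_bounded (a : nat -> R) (B : R) : (forall k, 0 <= a k) ->
  (forall n, sum_n a n <= B) -> ex_series a.
Proof.
  intros Ha HB.
  destruct (ex_finite_lim_seq_incr (sum_n a) B) as [l Hl].
  - intros n. rewrite sum_Sn. unfold plus; simpl. specialize (Ha (S n)). lra.
  - exact HB.
  - exists l. exact Hl.
Qed.

Lemma Series_bounded (a : nat -> R) (B : R) : (forall k, 0 <= a k) ->
  (forall n, sum_n a n <= B) -> Series a <= B.
Proof.
  intros Ha HB. pose proof (ex_series_bounded a B Ha HB) as H.
  apply Series_correct in H.
  assert (Rbar_le (Series a) B); [|auto].
  apply (is_lim_seq_le (sum_n a) (fun _ => B)); auto. apply is_lim_seq_const.
Qed.

Lemma ex_series_wt2 : ex_series (wt 2).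
Proof.
  apply (ex_series_bounded _ 2).
  - intros k. left. apply wt_pos.
  - intros n. pose proof (sum_wt2 n). pose proof (Rinv_0_lt_compat _ (one_INR_pos n)). lra.
Qed.

Lemma ex_series_scal_R c (a : nat -> R) : ex_series a -> ex_series (fun k => c * a k).
Proof. apply (ex_series_scal_l c a). Qed.

Lemma ex_series_plus_R (a b : nat -> R) : ex_series a -> ex_series b -> ex_series (fun k => a k + b k).
Proof. apply (ex_series_plus (K := R_AbsRing) (V := R_NormedModule)). Qed.

Lemma cos_lip x y : Rabs (cos x - cos y) <= Rabs (x - y).
Proof.
  replace (Rabs (x - y)) with (1 * Rabs (x - y)) by ring.
  apply (deriv_in_lip (fun _ => True) cos (fun x => - sin x)); auto.
  - intros z _. apply is_derive_deriv_in, cos_is_derive.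
  - intros z _. rewrite Rabs_Ropp. apply Rabs_le, SIN_bound.
Qed.

Lemma sin_lip x y : Rabs (sin x - sin y) <= Rabs (x - y).
Proof.
  replace (Rabs (x - y)) with (1 * Rabs (x - y)) by ring.
  apply (deriv_in_lip (fun _ => True) sin cos); auto.
  - intros z _. apply is_derive_deriv_in, sin_is_derive.
  - intros z _. apply Rabs_le, COS_bound.
Qed.

Section CosSeries.
Variable L : R.
Hypothesis HL : 0 < L.
Notation w := (freq L).

Lemma pow_S (x : R) n : x ^ S n = x * x ^ n.
Proof. reflexivity. Qed.

(** Differentiating a cosine shifts its phase by PI/2, so all derivatives of a cosine series have
    the same shape. *)
Definition phase (i k : nat) (s : R) : R := cos (INR k * w * s + INR i * (PI / 2)).

(** The [i]-th derivative of the cosine series with coefficients [x]. *)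
Definition fser (i : nat) (x : nat -> R) (s : R) : R :=
  Series (fun k => x k * (INR k * w) ^ i * phase i k s).

Lemma phase_0 k s : phase 0 k s = cosw L k s.
Proof. unfold phase, cosw. f_equal. simpl. ring. Qed.

Lemma phase_1 k s : phase 1 k s = - sinw L k s.
Proof.
  unfold phase, sinw. simpl INR. rewrite Rmult_1_l, cos_plus, cos_PI2, sin_PI2. ring.
Qed.

Lemma fser_0 x s : fser 0 x s = Series (fun k => x k * cosw L k s).
Proof. apply Series_ext. intros k. rewrite phase_0. simpl. ring. Qed.

Lemma phase_bound i k s : Rabs (phase i k s) <= 1.
Proof. apply Rabs_le, COS_bound. Qed.

Lemma phase_lip i k s t : Rabs (phase i k s - phase i k t) <= INR k * w * Rabs (s - t).
Proof.
  unfold phase. eapply Rle_trans; [apply cos_lip|].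
  replace (INR k * w * s + INR i * (PI / 2) - (INR k * w * t + INR i * (PI / 2)))
    with (INR k * w * (s - t)) by ring.
  rewrite Rabs_mult, (Rabs_right (INR k * w)); [lra|].
  apply Rle_ge, Rmult_le_pos; [apply pos_INR|left; apply freq_pos; auto].
Qed.

Lemma kw_nonneg k : 0 <= INR k * w.
Proof. apply Rmult_le_pos; [apply pos_INR|left; apply freq_pos; auto]. Qed.

Lemma kw_pow_nonneg k i : 0 <= (INR k * w) ^ i.
Proof. apply pow_le, kw_nonneg. Qed.

Lemma fser_term_bound i (x : nat -> R) k s : Rabs (x k * (INR k * w) ^ i * phase i k s) <= Rabs (x k) * (INR k * w) ^ i.
Proof.
  rewrite !Rabs_mult, (Rabs_right ((INR k * w) ^ i)) by (apply Rle_ge, kw_pow_nonneg).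
  pose proof (phase_bound i k s). pose proof (Rabs_pos (phase i k s)).
  assert (0 <= Rabs (x k) * (INR k * w) ^ i) by (apply Rmult_le_pos; [apply Rabs_pos|apply kw_pow_nonneg]).
  nra.
Qed.

Lemma kw_S_ge k : w <= INR (S k) * w.
Proof. pose proof (freq_pos L HL). rewrite S_INR. pose proof (pos_INR k). nra. Qed.

Lemma kw_S_pos k : 0 < INR (S k) * w.
Proof. apply Rlt_le_trans with w; [apply freq_pos; auto|apply kw_S_ge]. Qed.

Lemma inv_kw_wt k : / (INR (S k) * w) <= 2 / w * wt 1 (S k).
Proof.
  pose proof (freq_pos L HL). pose proof (pos_INR k). unfold wt. rewrite pow_1, S_INR.
  replace (2 / w * / (1 + (INR k + 1))) with (/ ((1 + (INR k + 1)) * w / 2)) by (field; lra).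
  apply Rinv_le_contravar; [|nra]. apply Rdiv_lt_0_compat; [apply Rmult_lt_0_compat|]; lra.
Qed.

Lemma fser_deriv (D : R -> Prop) i (x : nat -> R) s :
  ex_series (fun k => Rabs (x k) * (INR k * w) ^ (S i)) -> D s ->
  deriv_in D (fser i x) s (fser (S i) x s).
Proof.
  intros Hx Ds. unfold fser.
  apply (deriv_in_series D (fun k s => x k * (INR k * w) ^ i * phase i k s) _
           (fun k => Rabs (x k) * (INR k * w) ^ (S i))); auto.
  - exists (fun k => / w * (Rabs (x k) * (INR k * w) ^ (S i))). split.
    { apply ex_series_scal_R; auto. }
    intros y _ k. eapply Rle_trans; [apply fser_term_bound|].
    pose proof (freq_pos L HL). pose proof (kw_S_ge k).
    assert (0 <= Rabs (x (S k)) * (INR (S k) * w) ^ i) by (apply Rmult_le_pos; [apply Rabs_pos|apply kw_pow_nonneg]).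
    apply Rmult_le_reg_l with w; auto.
    rewrite <- (Rmult_assoc w (/ w)), Rinv_r, Rmult_1_l by lra.
    rewrite (pow_S (INR (S k) * w)), <- (Rmult_assoc _ (INR (S k) * w)), (Rmult_comm _ (INR (S k) * w)), Rmult_assoc.
    apply Rmult_le_compat_r; auto.
  - intros k y _. rewrite <- Rmult_minus_distr_l.
    rewrite !Rabs_mult, (Rabs_right ((INR _ * w) ^ i)) by (apply Rle_ge, kw_pow_nonneg).
    pose proof (phase_lip i (S k) y s).
    assert (0 <= Rabs (x (S k)) * (INR (S k) * w) ^ i) by (apply Rmult_le_pos; [apply Rabs_pos|apply kw_pow_nonneg]).
    rewrite (pow_S (INR (S k) * w)).
    replace (Rabs (x (S k)) * (INR (S k) * w * (INR (S k) * w) ^ i) * Rabs (y - s))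
      with (Rabs (x (S k)) * (INR (S k) * w) ^ i * (INR (S k) * w * Rabs (y - s))) by ring.
    apply Rmult_le_compat_l; auto.
  - intros k. apply fser_term_bound.
  - intros k.
    apply (deriv_in_eq _ _ _ (x k * (INR k * w) ^ i * (INR k * w * phase (S i) k s))); [simpl; ring|].
    apply deriv_in_scal. apply is_derive_deriv_in.
    unfold phase. rewrite S_INR.
    replace (INR k * w * s + (INR i + 1) * (PI / 2)) with (INR k * w * s + INR i * (PI / 2) + PI / 2) by ring.
    rewrite cos_plus, cos_PI2, sin_PI2. auto_derive; auto. ring.
Qed.

Lemma fser_cseg i x : ex_series (fun k => Rabs (x k) * (INR k * w) ^ i) -> cseg L (fser i x).
Proof.
  intros H. apply (cseg_series L (fun k s => x k * (INR k * w) ^ i * phase i k s)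
    (fun k => Rabs (x k) * (INR k * w) ^ i)); auto.
  - intros k. unfold phase. auto 10 with cseg.
  - intros k s _. apply fser_term_bound.
Qed.

Lemma fser_minus i x y s : ex_series (fun k => Rabs (x k) * (INR k * w) ^ i) ->
  ex_series (fun k => Rabs (y k) * (INR k * w) ^ i) ->
  fser i x s - fser i y s = fser i (fun k => x k - y k) s.
Proof.
  intros Hx Hy. unfold fser. rewrite <- Series_minus.
  - apply Series_ext. intros k. ring.
  - apply (ex_series_le_R _ _ (fun k => fser_term_bound i x k s)); auto.
  - apply (ex_series_le_R _ _ (fun k => fser_term_bound i y k s)); auto.
Qed.

Lemma fser_plus i x y s : ex_series (fun k => Rabs (x k) * (INR k * w) ^ i) ->
  ex_series (fun k => Rabs (y k) * (INR k * w) ^ i) ->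
  fser i (fun k => x k + y k) s = fser i x s + fser i y s.
Proof.
  intros Hx Hy. unfold fser. rewrite <- Series_plus.
  - apply Series_ext. intros k. ring.
  - apply (ex_series_le_R _ _ (fun k => fser_term_bound i x k s)); auto.
  - apply (ex_series_le_R _ _ (fun k => fser_term_bound i y k s)); auto.
Qed.

Lemma fser_bound i x s : ex_series (fun k => Rabs (x k) * (INR k * w) ^ i) ->
  Rabs (fser i x s) <= Series (fun k => Rabs (x k) * (INR k * w) ^ i).
Proof. intros H. apply Series_abs_le; auto. intros k. apply fser_term_bound. Qed.

Lemma fser_1_0 x : fser 1 x 0 = 0.
Proof.
  unfold fser. rewrite (Series_ext _ (fun k => 0 * 0)); [rewrite Series_scal_l; ring|].
  intros k. rewrite phase_1, sinw_0. ring.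
Qed.

Lemma fser_1_L x : fser 1 x L = 0.
Proof.
  unfold fser. rewrite (Series_ext _ (fun k => 0 * 0)); [rewrite Series_scal_l; ring|].
  intros k. rewrite phase_1, sinw_L by auto. ring.
Qed.

(** Rapid decrease concerns the modes k >= 1: the mean angle may drift in time. *)
Definition rapid (x : nat -> R) : Prop :=
  forall p, exists C, forall k, Rabs (x (S k)) <= C * wt p (S k).

Definition rapid_on (J : R -> Prop) (x : nat -> R -> R) : Prop :=
  forall p, exists C, forall k t, J t -> Rabs (x (S k) t) <= C * wt p (S k).

Lemma kw_wt i k : (INR k * w) ^ i * wt (i + 2) k <= w ^ i * wt 2 k.
Proof.
  pose proof (freq_pos L HL). rewrite Rpow_mult_distr, wt_mult.
  assert (INR k ^ i * wt i k <= 1).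
  { unfold wt. apply Rmult_le_reg_r with ((1 + INR k) ^ i); [apply pow_lt, one_INR_pos|].
    rewrite Rmult_assoc, Rinv_l, Rmult_1_r, Rmult_1_l by (apply pow_nonzero; pose proof (one_INR_pos k); lra).
    apply pow_incr. pose proof (pos_INR k). lra. }
  replace (INR k ^ i * w ^ i * (wt i k * wt 2 k)) with (w ^ i * wt 2 k * (INR k ^ i * wt i k)) by ring.
  assert (0 < w ^ i) by (apply pow_lt; auto). pose proof (wt_pos 2 k).
  assert (0 < w ^ i * wt 2 k) by (apply Rmult_lt_0_compat; auto). nra.
Qed.

Lemma rapid_on_dom J x i : rapid_on J x -> exists M, ex_series M /\
  forall k t, J t -> Rabs (x (S k) t) * (INR (S k) * w) ^ i <= M (S k).
Proof.
  intros H. destruct (H (i + 2)%nat) as [C HC].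
  exists (fun k => Rabs C * w ^ i * wt 2 k). split.
  { apply ex_series_scal_R, ex_series_wt2. }
  intros k t Ht. specialize (HC k t Ht).
  apply Rle_trans with (Rabs C * wt (i + 2) (S k) * (INR (S k) * w) ^ i).
  - apply Rmult_le_compat_r; [apply kw_pow_nonneg|].
    eapply Rle_trans; [exact HC|]. apply Rmult_le_compat_r; [left; apply wt_pos|apply Rle_abs].
  - rewrite !Rmult_assoc. apply Rmult_le_compat_l; [apply Rabs_pos|].
    rewrite (Rmult_comm (wt _ _)). apply kw_wt.
Qed.

Lemma rapid_on_rapid J x t : J t -> rapid_on J x -> rapid (fun k => x k t).
Proof. intros Ht H p. destruct (H p) as [C HC]. exists C. auto. Qed.

Lemma rapid_ex x i : rapid x -> ex_series (fun k => Rabs (x k) * (INR k * w) ^ i).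
Proof.
  intros H. destruct (rapid_on_dom (fun _ => True) (fun k _ => x k) i) as [M [HM HD]].
  { intros p. destruct (H p) as [C HC]. exists C; auto. }
  apply (ex_series_dom _ M); auto. intros k.
  rewrite Rabs_mult, Rabs_Rabsolu, (Rabs_right (_ ^ i)) by (apply Rle_ge, kw_pow_nonneg).
  apply (HD k 0); auto.
Qed.

Lemma fser_cstrip J x i : rapid_on J x ->
  (forall k t, J t -> flim (within J (locally t)) (x k) (x k t)) ->
  cstrip L J (fun s t => fser i (fun k => x k t) s).
Proof.
  intros HR HC s t Hs Ht. destruct (rapid_on_dom J x i HR) as [M [HM HD]].
  unfold fser.
  apply (flim_series (within (fun p : R2 => seg L (fst p) /\ J (snd p)) (locally (s, t)))
    (fun k p => x k (snd p) * (INR k * w) ^ i * phase i k (fst p))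
    (fun k => x k t * (INR k * w) ^ i * phase i k s) M); auto.
  - unfold within. apply filter_forall. intros [y z] [Hy Hz] k.
    eapply Rle_trans; [apply (fser_term_bound i (fun k => x k z))|]. apply HD; auto.
  - intros k. eapply Rle_trans; [apply (fser_term_bound i (fun k => x k t))|]. apply HD; auto.
  - intros k.
    apply (flim_mult _ (fun p => x k (snd p) * (INR k * w) ^ i) (fun p => phase i k (fst p))).
    + apply (flim_mult _ (fun p => x k (snd p)) (fun p => (INR k * w) ^ i)).
      * apply (cstrip_time L J (x k) (HC k) s t Hs Ht).
      * apply flim_const. typeclasses eauto.
    + apply within_flim.
      apply (flim_comp (locally (s, t)) fst (phase i k)).
      * apply (continuous_fst (U := R_UniformSpace) (V := R_UniformSpace) s t).
      * apply (ex_derive_continuous (V := R_NormedModule)). unfold phase. auto_derive. auto.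
Qed.

Lemma fser_ds_rel J x i : rapid_on J x ->
  ds_rel L J (fun s t => fser i (fun k => x k t) s) (fun s t => fser (S i) (fun k => x k t) s).
Proof.
  intros HR s t Hs Ht. apply fser_deriv; auto. apply rapid_ex. eapply rapid_on_rapid; eauto.
Qed.

Lemma fser_strip_reg_s J x : rapid_on J x ->
  (forall k t, J t -> flim (within J (locally t)) (x k) (x k t)) ->
  forall m i, strip_reg L J m 0 (fun s t => fser i (fun k => x k t) s).
Proof.
  intros HR HC. induction m; intros i; constructor; try (intros; discriminate);
    try (apply fser_cstrip; auto).
  intros m' E. injection E as <-. exists (fun s t => fser (S i) (fun k => x k t) s).
  split; [apply fser_ds_rel; auto|apply IHm].
Qed.

Lemma fser_dt_rel J x x' i : convex_set J -> rapid_on J x -> rapid_on J x' ->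
  (forall k t, J t -> deriv_in J (x k) t (x' k t)) ->
  dt_rel L J (fun s t => fser i (fun k => x k t) s) (fun s t => fser i (fun k => x' k t) s).
Proof.
  intros Hc HR HR' HD s t Hs Ht. unfold fser.
  destruct (rapid_on_dom J x i HR) as [M0 [HM0 HD0]].
  destruct (rapid_on_dom J x' i HR') as [M [HM HD']].
  apply (deriv_in_series J (fun k t => x k t * (INR k * w) ^ i * phase i k s) _ M); auto.
  - exists M0. split; auto. intros y Hy k.
    eapply Rle_trans; [apply (fser_term_bound i (fun k => x k y))|]. apply HD0; auto.
  - intros k y Hy.
    apply (deriv_in_lip J (fun t => x (S k) t * (INR (S k) * w) ^ i * phase i (S k) s)
      (fun t => x' (S k) t * (INR (S k) * w) ^ i * phase i (S k) s)); auto.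
    + intros z Hz. apply (deriv_in_ext _ (fun t => (INR (S k) * w) ^ i * phase i (S k) s * x (S k) t)); auto.
      { intros; ring. }
      apply (deriv_in_eq _ _ _ ((INR (S k) * w) ^ i * phase i (S k) s * x' (S k) z)); [ring|].
      apply deriv_in_scal; auto.
    + intros z Hz. eapply Rle_trans; [apply (fser_term_bound i (fun k => x' k z))|]. apply HD'; auto.
  - intros k. eapply Rle_trans; [apply (fser_term_bound i (fun k => x' k t))|]. apply HD'; auto.
  - intros k. apply (deriv_in_ext _ (fun t => (INR k * w) ^ i * phase i k s * x k t)); auto.
    { intros; ring. }
    apply (deriv_in_eq _ _ _ ((INR k * w) ^ i * phase i k s * x' k t)); [ring|].
    apply deriv_in_scal; auto.
Qed.

End CosSeries.

(** * The truncated nonlinearity in Fourier coefficients *)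

(** The weight makes [dist] control the angle and the curvature uniformly on the segment. *)
Definition ell (x : nat -> R) : Prop := ex_series (fun k => (1 + INR k) * Rabs (x k)).

Definition dist (x y : nat -> R) : R := Series (fun k => (1 + INR k) * Rabs (x k - y k)).

Lemma ell_minus x y : ell x -> ell y -> ell (fun k => x k - y k).
Proof.
  intros Hx Hy. unfold ell.
  apply (ex_series_le_R _ (fun k => (1 + INR k) * Rabs (x k) + (1 + INR k) * Rabs (y k))).
  - intros k. pose proof (one_INR_pos k). pose proof (Rabs_pos (x k - y k)).
    rewrite Rabs_mult, Rabs_Rabsolu, (Rabs_right (1 + INR k)) by lra.
    rewrite <- Rmult_plus_distr_l. apply Rmult_le_compat_l; [lra|].
    unfold Rminus. eapply Rle_trans; [apply Rabs_triang|]. rewrite Rabs_Ropp. lra.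
  - apply ex_series_plus_R; auto.
Qed.

Lemma dist_nonneg x y : ell x -> ell y -> 0 <= dist x y.
Proof.
  intros Hx Hy. unfold dist.
  replace 0 with (Series (fun _ : nat => 0 * 0)) by (rewrite Series_scal_l; ring).
  apply Series_le; [|apply ell_minus; auto].
  intros k. rewrite Rmult_0_l. split; [lra|].
  apply Rmult_le_pos; [left; apply one_INR_pos|apply Rabs_pos].
Qed.

Section Nonlinearity.
Variable L : R.
Hypothesis HL : 0 < L.
Notation w := (freq L).
Notation Int := (integ L).
Notation fser := (fser L).

Lemma ell_0 x : ell x -> ex_series (fun k => Rabs (x k) * (INR k * w) ^ 0).
Proof.
  intros H. apply (ex_series_le_R _ (fun k => (1 + INR k) * Rabs (x k))); auto.
  intros k. simpl. rewrite Rmult_1_r, Rabs_Rabsolu. pose proof (pos_INR k). pose proof (Rabs_pos (x k)). nra.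
Qed.

Lemma ell_1 x : ell x -> ex_series (fun k => Rabs (x k) * (INR k * w) ^ 1).
Proof.
  intros H. apply (ex_series_le_R _ (fun k => w * ((1 + INR k) * Rabs (x k)))).
  - intros k. rewrite pow_1, Rabs_mult, Rabs_Rabsolu, (Rabs_right (INR k * w)) by (apply Rle_ge, kw_nonneg; auto).
    pose proof (pos_INR k). pose proof (Rabs_pos (x k)). pose proof (freq_pos L HL).
    assert (0 <= w * Rabs (x k)) by nra. nra.
  - apply ex_series_scal_R; auto.
Qed.

Lemma fser_0_lip x y s : ell x -> ell y -> Rabs (fser 0 x s - fser 0 y s) <= dist x y.
Proof.
  intros Hx Hy. rewrite fser_minus by (auto; apply ell_0; auto).
  eapply Rle_trans; [apply fser_bound; auto; apply ell_0, ell_minus; auto|].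
  apply Series_le; [|apply ell_minus; auto].
  intros k. simpl. pose proof (pos_INR k). pose proof (Rabs_pos (x k - y k)). nra.
Qed.

Lemma fser_1_lip x y s : ell x -> ell y -> Rabs (fser 1 x s - fser 1 y s) <= w * dist x y.
Proof.
  intros Hx Hy. rewrite fser_minus by (auto; apply ell_1; auto).
  eapply Rle_trans; [apply fser_bound; auto; apply ell_1, ell_minus; auto|].
  unfold dist. rewrite <- Series_scal_l.
  apply Series_le; [|apply ex_series_scal_R; apply ell_minus; auto].
  intros k. rewrite pow_1. pose proof (pos_INR k). pose proof (Rabs_pos (x k - y k)).
  pose proof (freq_pos L HL). assert (0 <= w * Rabs (x k - y k)) by nra. split; nra.
Qed.

(** Bounded Lipschitz functionals of the coefficients, uniformly in the mode number [k] and the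
    point [s], and continuous in [s]. *)
Definition bl (Phi : nat -> R -> (nat -> R) -> R) : Prop :=
  (forall k x, ell x -> cseg L (fun s => Phi k s x)) /\
  exists B, 0 <= B /\
    (forall k s x, seg L s -> ell x -> Rabs (Phi k s x) <= B) /\
    (forall k s x y, seg L s -> ell x -> ell y -> Rabs (Phi k s x - Phi k s y) <= B * dist x y).

Lemma bl_const (g : nat -> R -> R) : (forall k, cseg L (g k)) -> (forall k s, Rabs (g k s) <= 1) ->
  bl (fun k s _ => g k s).
Proof.
  intros Hc Hb. split; [auto|]. exists 1. repeat split; [lra|auto|].
  intros k s x y _ Hx Hy. rewrite Rminus_diag, Rabs_R0. pose proof (dist_nonneg x y Hx Hy). lra.
Qed.

Lemma bl_plus P Q : bl P -> bl Q -> bl (fun k s x => P k s x + Q k s x).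
Proof.
  intros [CP [A [HA [PA LA]]]] [CQ [B [HB [PB LB]]]]. split.
  - intros k x Hx. apply cseg_plus; auto.
  - exists (A + B). repeat split; [lra| |].
    + intros k s x Hs Hx. eapply Rle_trans; [apply Rabs_triang|]. apply Rplus_le_compat; auto.
    + intros k s x y Hs Hx Hy.
      replace (P k s x + Q k s x - (P k s y + Q k s y)) with ((P k s x - P k s y) + (Q k s x - Q k s y)) by ring.
      eapply Rle_trans; [apply Rabs_triang|]. rewrite Rmult_plus_distr_r. apply Rplus_le_compat; auto.
Qed.

Lemma bl_mult P Q : bl P -> bl Q -> bl (fun k s x => P k s x * Q k s x).
Proof.
  intros [CP [A [HA [PA LA]]]] [CQ [B [HB [PB LB]]]]. split.
  - intros k x Hx. apply cseg_mult; auto.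
  - assert (0 <= A * B) by (apply Rmult_le_pos; auto).
    exists (A * B + A * B). repeat split; [lra| |].
    + intros k s x Hs Hx. rewrite Rabs_mult.
      apply Rle_trans with (A * B); [|lra]. apply Rmult_le_compat; auto; apply Rabs_pos.
    + intros k s x y Hs Hx Hy.
      replace (P k s x * Q k s x - P k s y * Q k s y)
        with (P k s x * (Q k s x - Q k s y) + (P k s x - P k s y) * Q k s y) by ring.
      eapply Rle_trans; [apply Rabs_triang|]. rewrite !Rabs_mult.
      apply Rle_trans with (A * (B * dist x y) + A * dist x y * B); [|lra].
      apply Rplus_le_compat; apply Rmult_le_compat; auto; apply Rabs_pos.
Qed.

Lemma bl_opp P : bl P -> bl (fun k s x => - P k s x).
Proof.
  intros H. assert (H1 : bl (fun k s _ => -1)).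
  { apply (bl_const (fun _ _ => -1)); auto with cseg. intros. rewrite Rabs_left; lra. }
  destruct (bl_mult _ _ H1 H) as [C [B [HB [PB LB]]]]. split.
  - intros k x Hx. apply (cseg_ext L (fun s => -1 * P k s x)); [intros; ring|auto].
  - exists B. repeat split; auto.
    + intros k s x Hs Hx. replace (- P k s x) with (-1 * P k s x) by ring. auto.
    + intros k s x y Hs Hx Hy.
      replace (- P k s x - - P k s y) with (-1 * P k s x - -1 * P k s y) by ring. auto.
Qed.

Lemma bl_integ P : bl P -> bl (fun k _ x => Int (fun s => P k s x)).
Proof.
  intros [CP [A [HA [PA LA]]]]. split; [auto with cseg|].
  exists (L * A). repeat split; [apply Rmult_le_pos; lra| |].
  - intros k _ x _ Hx. apply Int_bound; auto.
  - intros k _ x y _ Hx Hy. rewrite <- Int_minus, Rmult_assoc by auto.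
    apply Int_bound; auto with cseg.
Qed.

Lemma bl_comp (psi : R -> R) P B K : (forall u v, Rabs (psi u - psi v) <= Rabs (u - v)) ->
  0 <= B -> 0 <= K -> (forall k s x, seg L s -> ell x -> Rabs (psi (P k s x)) <= B) ->
  (forall k x, ell x -> cseg L (fun s => P k s x)) ->
  (forall k s x y, seg L s -> ell x -> ell y -> Rabs (P k s x - P k s y) <= K * dist x y) ->
  bl (fun k s x => psi (P k s x)).
Proof.
  intros Hl HB HK Hb C HP. split.
  - intros k x Hx. apply cseg_comp; auto. intros z. apply filterlim_locally. intros eps.
    exists eps. intros y Hy. eapply Rle_lt_trans; [apply Hl|exact Hy].
  - exists (B + K). repeat split; [lra| |].
    + intros k s x Hs Hx. specialize (Hb k s x Hs Hx). lra.
    + intros k s x y Hs Hx Hy. eapply Rle_trans; [apply Hl|].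
      eapply Rle_trans; [apply HP; auto|]. apply Rmult_le_compat_r; [apply dist_nonneg; auto|lra].
Qed.

Lemma bl_cos : bl (fun _ s x => cos (fser 0 x s)).
Proof.
  apply (bl_comp cos (fun _ s x => fser 0 x s) 1 1); try lra.
  - apply cos_lip.
  - intros. apply Rabs_le, COS_bound.
  - intros _ x Hx. apply fser_cseg; auto. apply ell_0; auto.
  - intros _ s x y _ Hx Hy. rewrite Rmult_1_l. apply fser_0_lip; auto.
Qed.

Lemma bl_sin : bl (fun _ s x => sin (fser 0 x s)).
Proof.
  apply (bl_comp sin (fun _ s x => fser 0 x s) 1 1); try lra.
  - apply sin_lip.
  - intros. apply Rabs_le, SIN_bound.
  - intros _ x Hx. apply fser_cseg; auto. apply ell_0; auto.
  - intros _ s x y _ Hx Hy. rewrite Rmult_1_l. apply fser_0_lip; auto.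
Qed.

Lemma bl_clamp Rc : 0 <= Rc -> bl (fun _ s x => clamp (- Rc) Rc (fser 1 x s)).
Proof.
  intros HR. apply (bl_comp (clamp (- Rc) Rc) (fun _ s x => fser 1 x s) Rc w); auto.
  - intros u v. apply clamp_lip. lra.
  - left. apply freq_pos; auto.
  - intros k s x _ _. apply Rabs_le, clamp_in. lra.
  - intros _ x Hx. apply fser_cseg; auto. apply ell_1; auto.
  - intros _ s x y _ Hx Hy. apply fser_1_lip; auto.
Qed.

Lemma Rmax_lip c u v : Rabs (Rmax u c - Rmax v c) <= Rabs (u - v).
Proof.
  unfold Rmax. repeat destruct Rle_dec; unfold Rabs; repeat destruct Rcase_abs; lra.
Qed.

Lemma bl_inv_max P c : 0 < c -> bl P -> bl (fun k s x => / Rmax (P k s x) c).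
Proof.
  intros Hc [CP [A [HA [PA LA]]]].
  assert (M : forall u, c <= Rmax u c) by (intros; apply Rmax_r).
  assert (Lip : forall u v, Rabs (/ Rmax u c - / Rmax v c) <= / (c * c) * Rabs (u - v)).
  { intros u v. pose proof (M u). pose proof (M v).
    replace (/ Rmax u c - / Rmax v c) with (/ (Rmax u c * Rmax v c) * (Rmax v c - Rmax u c)) by (field; lra).
    assert (0 < c * c) by (apply Rmult_lt_0_compat; auto).
    assert (c * c <= Rmax u c * Rmax v c) by (apply Rmult_le_compat; lra).
    rewrite Rabs_mult, Rabs_minus_sym. apply Rmult_le_compat; try apply Rabs_pos.
    - rewrite Rabs_right; [apply Rinv_le_contravar; auto|]. apply Rle_ge. left. apply Rinv_0_lt_compat. lra.
    - eapply Rle_trans; [|apply (Rmax_lip c)]. rewrite Rabs_minus_sym. apply Rle_refl. }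
  assert (0 < / c) by (apply Rinv_0_lt_compat; auto).
  assert (0 < / (c * c)) by (apply Rinv_0_lt_compat, Rmult_lt_0_compat; auto).
  split.
  - intros k x Hx. apply (cseg_comp L (fun u => / Rmax u c)); auto. intros z.
    apply filterlim_locally. intros eps.
    assert (Hp : 0 < c * c * eps) by (apply Rmult_lt_0_compat; [apply Rmult_lt_0_compat; auto|apply cond_pos]).
    exists (mkposreal _ Hp). intros y Hy.
    eapply Rle_lt_trans; [apply Lip|].
    apply Rlt_le_trans with (/ (c * c) * (c * c * eps)).
    + apply Rmult_lt_compat_l; [auto|exact Hy].
    + right. field. lra.
  - exists (/ c + / (c * c) * A).
    assert (0 <= / (c * c) * A) by (apply Rmult_le_pos; lra).
    repeat split; [lra| |].
    + intros k s x Hs Hx. pose proof (M (P k s x)).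
      rewrite Rabs_right; [|apply Rle_ge; left; apply Rinv_0_lt_compat; lra].
      apply Rle_trans with (/ c); [apply Rinv_le_contravar; auto|lra].
    + intros k s x y Hs Hx Hy. eapply Rle_trans; [apply Lip|].
      pose proof (dist_nonneg x y Hx Hy).
      apply Rle_trans with (/ (c * c) * (A * dist x y)); [apply Rmult_le_compat_l; [lra|auto]|]. nra.
Qed.

(** The angle [fser 0 x] determines the tangent (cos, sin).  The curvature is clamped to
    [-Rc, Rc] and the determinant of A_T is kept above [dc]; for solutions of the flow neither
    truncation is active, and they make the system globally Lipschitz. *)
Variables Rc dc : R.

Definition kap (x : nat -> R) (s : R) : R := clamp (- Rc) Rc (fser 1 x s).

(** Up to signs [mss], [msc], [mcc] are the entries of A_T; [vc] and [vs] are the components of the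
    integral of |kappa|^2 T. *)
Definition mss x := Int (fun s => sin (fser 0 x s) * sin (fser 0 x s)).
Definition msc x := Int (fun s => sin (fser 0 x s) * cos (fser 0 x s)).
Definition mcc x := Int (fun s => cos (fser 0 x s) * cos (fser 0 x s)).
Definition det x := mss x * mcc x - msc x * msc x.
Definition vc x := Int (fun s => kap x s * kap x s * cos (fser 0 x s)).
Definition vs x := Int (fun s => kap x s * kap x s * sin (fser 0 x s)).

(** The multiplier, as the row vector times the adjugate of A_T over its (truncated) determinant. *)
Definition lamc x := (vc x * mcc x + vs x * msc x) * / Rmax (det x) dc.
Definition lams x := (vc x * msc x + vs x * mss x) * / Rmax (det x) dc.

(** Cosine coefficients of -<lambda, T^perp>; the modes k >= 1 are written after one integration
    by parts, so that the truncation of the curvature also controls their size. *)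
Definition forcing (k : nat) (x : nat -> R) : R :=
  match k with
  | O => - / L * Int (fun s => - lamc x * sin (fser 0 x s) + lams x * cos (fser 0 x s))
  | _ => - (2 / (L * (INR k * w))) *
         Int (fun s => (lamc x * cos (fser 0 x s) + lams x * sin (fser 0 x s)) * kap x s * sinw L k s)
  end.

Hypothesis HRc : 0 <= Rc.
Hypothesis Hdc : 0 < dc.

Lemma bl_kap : bl (fun _ s x => kap x s).
Proof. apply bl_clamp; auto. Qed.

Lemma bl_mss : bl (fun _ _ x => mss x).
Proof. apply (bl_integ (fun _ s x => sin (fser 0 x s) * sin (fser 0 x s))). apply bl_mult; apply bl_sin. Qed.
Lemma bl_msc : bl (fun _ _ x => msc x).
Proof. apply (bl_integ (fun _ s x => sin (fser 0 x s) * cos (fser 0 x s))). apply bl_mult; [apply bl_sin|apply bl_cos]. Qed.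
Lemma bl_mcc : bl (fun _ _ x => mcc x).
Proof. apply (bl_integ (fun _ s x => cos (fser 0 x s) * cos (fser 0 x s))). apply bl_mult; apply bl_cos. Qed.

Lemma bl_det : bl (fun _ _ x => det x).
Proof.
  apply (bl_plus (fun _ _ x => mss x * mcc x) (fun _ _ x => - (msc x * msc x))).
  - apply (bl_mult (fun _ _ => mss) (fun _ _ => mcc)); [apply bl_mss|apply bl_mcc].
  - apply (bl_opp (fun _ _ x => msc x * msc x)).
    apply (bl_mult (fun _ _ => msc) (fun _ _ => msc)); apply bl_msc.
Qed.

Lemma bl_vc : bl (fun _ _ x => vc x).
Proof.
  apply (bl_integ (fun _ s x => kap x s * kap x s * cos (fser 0 x s))).
  apply (bl_mult (fun _ s x => kap x s * kap x s)); [|apply bl_cos].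
  apply bl_mult; apply bl_kap.
Qed.

Lemma bl_vs : bl (fun _ _ x => vs x).
Proof.
  apply (bl_integ (fun _ s x => kap x s * kap x s * sin (fser 0 x s))).
  apply (bl_mult (fun _ s x => kap x s * kap x s)); [|apply bl_sin].
  apply bl_mult; apply bl_kap.
Qed.

Lemma bl_lamc : bl (fun _ _ x => lamc x).
Proof.
  apply (bl_mult (fun _ _ x => vc x * mcc x + vs x * msc x) (fun _ _ x => / Rmax (det x) dc)).
  - apply (bl_plus (fun _ _ x => vc x * mcc x) (fun _ _ x => vs x * msc x)).
    + apply (bl_mult (fun _ _ => vc) (fun _ _ => mcc)); [apply bl_vc|apply bl_mcc].
    + apply (bl_mult (fun _ _ => vs) (fun _ _ => msc)); [apply bl_vs|apply bl_msc].
  - apply (bl_inv_max (fun _ _ => det)); [auto|apply bl_det].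
Qed.

Lemma bl_lams : bl (fun _ _ x => lams x).
Proof.
  apply (bl_mult (fun _ _ x => vc x * msc x + vs x * mss x) (fun _ _ x => / Rmax (det x) dc)).
  - apply (bl_plus (fun _ _ x => vc x * msc x) (fun _ _ x => vs x * mss x)).
    + apply (bl_mult (fun _ _ => vc) (fun _ _ => msc)); [apply bl_vc|apply bl_msc].
    + apply (bl_mult (fun _ _ => vs) (fun _ _ => mss)); [apply bl_vs|apply bl_mss].
  - apply (bl_inv_max (fun _ _ => det)); [auto|apply bl_det].
Qed.

Lemma lam_bounded : exists B, 0 <= B /\ forall x, ell x -> Rabs (lamc x) <= B /\ Rabs (lams x) <= B.
Proof.
  destruct bl_lamc as [_ [A [HA [PA _]]]]. destruct bl_lams as [_ [B [HB [PB _]]]].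
  exists (A + B). split; [lra|]. intros x Hx.
  specialize (PA O 0 x (seg_0 L HL) Hx). specialize (PB O 0 x (seg_0 L HL) Hx). cbv beta in *. lra.
Qed.

Lemma forcing_bl : exists B, 0 <= B /\
  (forall k x, ell x -> Rabs (forcing k x) <= B / (1 + INR k)) /\
  (forall k x y, ell x -> ell y -> Rabs (forcing k x - forcing k y) <= B / (1 + INR k) * dist x y).
Proof.
  pose proof (freq_pos L HL) as Hw.
  assert (B0 : bl (fun _ _ x => Int (fun s => - lamc x * sin (fser 0 x s) + lams x * cos (fser 0 x s)))).
  { apply (bl_integ (fun _ s x => - lamc x * sin (fser 0 x s) + lams x * cos (fser 0 x s))).
    apply (bl_plus (fun _ s x => - lamc x * sin (fser 0 x s)) (fun _ s x => lams x * cos (fser 0 x s))).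
    - apply (bl_mult (fun _ _ x => - lamc x)); [|apply bl_sin]. apply (bl_opp (fun _ _ => lamc)), bl_lamc.
    - apply (bl_mult (fun _ _ x => lams x)); [apply bl_lams|apply bl_cos]. }
  assert (B1 : bl (fun k _ x => Int (fun s => (lamc x * cos (fser 0 x s) + lams x * sin (fser 0 x s)) * kap x s * sinw L k s))).
  { apply (bl_integ (fun k s x => (lamc x * cos (fser 0 x s) + lams x * sin (fser 0 x s)) * kap x s * sinw L k s)).
    apply (bl_mult (fun k s x => (lamc x * cos (fser 0 x s) + lams x * sin (fser 0 x s)) * kap x s) (fun k s _ => sinw L k s)).
    - apply (bl_mult (fun k s x => lamc x * cos (fser 0 x s) + lams x * sin (fser 0 x s)) (fun _ s x => kap x s)); [|apply bl_kap].
      apply (bl_plus (fun _ s x => lamc x * cos (fser 0 x s)) (fun _ s x => lams x * sin (fser 0 x s))).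
      + apply (bl_mult (fun _ _ x => lamc x)); [apply bl_lamc|apply bl_cos].
      + apply (bl_mult (fun _ _ x => lams x)); [apply bl_lams|apply bl_sin].
    - apply bl_const; auto with cseg. intros; apply sinw_bound. }
  destruct B0 as [_ [A [HA [PA LA]]]]. destruct B1 as [_ [B [HB [PB LB]]]].
  set (c := / L + 4 / (L * w)).
  assert (Hc0 : 0 < / L) by (apply Rinv_0_lt_compat; auto).
  assert (Hc1 : 0 < 4 / (L * w)) by (apply Rdiv_lt_0_compat; [lra|apply Rmult_lt_0_compat; auto]).
  assert (Hk : forall k, 0 <= 2 / (L * (INR (S k) * w)) <= c / (1 + INR (S k))).
  { intros k. pose proof (kw_S_pos L HL k). pose proof (wt_pos 1 (S k)) as Hw1.
    assert (0 < 2 / L) by (apply Rdiv_lt_0_compat; lra).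
    split; [apply Rlt_le, Rdiv_lt_0_compat; [lra|apply Rmult_lt_0_compat; auto]|].
    replace (2 / (L * (INR (S k) * w))) with (2 / L * / (INR (S k) * w))
      by (unfold Rdiv; rewrite (Rinv_mult L); ring).
    apply Rle_trans with (2 / L * (2 / w * wt 1 (S k))); [apply Rmult_le_compat_l; [lra|apply inv_kw_wt; auto]|].
    replace (2 / L * (2 / w * wt 1 (S k))) with (4 / (L * w) * wt 1 (S k)) by (field; lra).
    replace (c / (1 + INR (S k))) with (c * wt 1 (S k)) by (unfold wt; rewrite pow_1; reflexivity).
    apply Rmult_le_compat_r; unfold c; lra. }
  assert (Hs := seg_0 L HL).
  exists (c * (A + B)). split; [apply Rmult_le_pos; unfold c; lra|]. split.
  - intros [|k] x Hx; unfold forcing.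
    + specialize (PA O 0 x Hs Hx). simpl INR. rewrite Rabs_mult, Rabs_Ropp, (Rabs_right (/ L)) by lra.
      replace (c * (A + B) / (1 + 0)) with (c * (A + B)) by field.
      apply Rmult_le_compat; [lra|apply Rabs_pos|unfold c; lra|cbv beta in PA; lra].
    + specialize (PB (S k) 0 x Hs Hx). cbv beta in PB.
      rewrite Rabs_mult, Rabs_Ropp, (Rabs_right (2 / _)) by (apply Rle_ge, Hk).
      replace (c * (A + B) / (1 + INR (S k))) with (c / (1 + INR (S k)) * (A + B)) by (unfold Rdiv; ring).
      apply Rmult_le_compat; [apply Hk|apply Rabs_pos|apply Hk|lra].
  - intros [|k] x y Hx Hy; unfold forcing; pose proof (dist_nonneg x y Hx Hy) as Hd.
    + specialize (LA O 0 x y Hs Hx Hy). cbv beta in LA.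
      rewrite <- Rmult_minus_distr_l, Rabs_mult, Rabs_Ropp, (Rabs_right (/ L)) by lra.
      simpl INR. replace (c * (A + B) / (1 + 0) * dist x y) with (c * ((A + B) * dist x y)) by field.
      apply Rmult_le_compat; [lra|apply Rabs_pos|unfold c; lra|nra].
    + specialize (LB (S k) 0 x y Hs Hx Hy). cbv beta in LB.
      rewrite <- Rmult_minus_distr_l, Rabs_mult, Rabs_Ropp, (Rabs_right (2 / _)) by (apply Rle_ge, Hk).
      replace (c * (A + B) / (1 + INR (S k)) * dist x y)
        with (c / (1 + INR (S k)) * ((A + B) * dist x y)) by (unfold Rdiv; ring).
      apply Rmult_le_compat; [apply Hk|apply Rabs_pos|apply Hk|nra].
Qed.

End Nonlinearity.

(** * Duhamel's formula and the Picard iteration *)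

(** The solution of a' = - mu a + n, a(0) = alpha. *)
Definition duh (mu alpha : R) (n : R -> R) (t : R) : R :=
  exp (- mu * t) * (alpha + RInt (fun r => exp (mu * r) * n r) 0 t).

Lemma exp_le x y : x <= y -> exp x <= exp y.
Proof. intros [H|H]; [left; apply exp_increasing; auto|right; rewrite H; auto]. Qed.

Section Duhamel.
Variable mu : R.

Lemma exp_cont c x : continuous (fun r => exp (c * r)) x.
Proof. apply (ex_derive_continuous (V := R_NormedModule)). auto_derive. auto. Qed.

Lemma duh_integrand_cont n x : (forall t, continuous n t) -> continuous (fun r => exp (mu * r) * n r) x.
Proof. intros Hn. apply (continuous_mult (K := R_AbsRing)); [apply exp_cont|apply Hn]. Qed.

Lemma duh_ex_RInt n a b : (forall t, continuous n t) -> ex_RInt (fun r => exp (mu * r) * n r) a b.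
Proof.
  intros Hn. apply (ex_RInt_continuous (V := R_CompleteNormedModule)). intros z _.
  apply duh_integrand_cont; auto.
Qed.

Lemma duh_0 alpha n : duh mu alpha n 0 = alpha.
Proof.
  unfold duh. rewrite (RInt_point (V := R_CompleteNormedModule)), Rmult_0_r, exp_0.
  unfold zero; simpl. ring.
Qed.

Lemma duh_is_derive alpha n t : (forall t, continuous n t) ->
  is_derive (duh mu alpha n) t (- mu * duh mu alpha n t + n t).
Proof.
  intros Hn. unfold duh.
  assert (H : is_derive (fun t => RInt (fun r => exp (mu * r) * n r) 0 t) t (exp (mu * t) * n t)).
  { apply (is_derive_RInt (V := R_NormedModule) (fun r => exp (mu * r) * n r) _ 0).
    - apply filter_forall. intros x. apply (RInt_correct (V := R_CompleteNormedModule)), duh_ex_RInt; auto.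
    - apply duh_integrand_cont; auto. }
  assert (E : exp (- mu * t) * exp (mu * t) = 1).
  { rewrite <- exp_plus. replace (- mu * t + mu * t) with 0 by ring. apply exp_0. }
  set (I := fun t => RInt (fun r => exp (mu * r) * n r) 0 t) in *.
  replace (- mu * (exp (- mu * t) * (alpha + I t)) + n t)
    with (- mu * exp (- mu * t) * (alpha + I t) + exp (- mu * t) * (exp (mu * t) * n t)).
  - apply (is_derive_mult (K := R_AbsRing) (fun t => exp (- mu * t)) (fun t => alpha + I t)).
    + auto_derive; auto. ring.
    + evar_last. apply (is_derive_plus (V := R_NormedModule) (fun _ => alpha) I).
      apply is_derive_const. apply H. unfold plus, zero; simpl. ring.
    + intros; apply Rmult_comm.
  - rewrite <- Rmult_assoc, E. ring.
Qed.

Lemma duh_minus alpha n m t : (forall t, continuous n t) -> (forall t, continuous m t) ->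
  duh mu alpha n t - duh mu alpha m t = duh mu 0 (fun r => n r - m r) t.
Proof.
  intros Hn Hm. unfold duh.
  assert (E : RInt (fun r => exp (mu * r) * (n r - m r)) 0 t =
    RInt (fun r => exp (mu * r) * n r) 0 t - RInt (fun r => exp (mu * r) * m r) 0 t).
  { rewrite <- (RInt_minus (V := R_CompleteNormedModule)) by (apply duh_ex_RInt; auto).
    apply (RInt_ext (V := R_CompleteNormedModule)). intros x _. unfold minus, plus, opp; simpl. ring. }
  rewrite E. ring.
Qed.

Lemma duh_split alpha n t : duh mu alpha n t = exp (- mu * t) * alpha + duh mu 0 n t.
Proof. unfold duh. ring. Qed.

Lemma duh_bound n K Lam t : 0 < mu + Lam -> 0 <= t -> 0 <= K -> (forall t, continuous n t) ->
  (forall r, 0 <= r <= t -> Rabs (n r) <= K * exp (Lam * r)) ->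
  Rabs (duh mu 0 n t) <= K * exp (Lam * t) / (mu + Lam).
Proof.
  intros Hml Ht HK Hn Hb. unfold duh.
  rewrite Rplus_0_l, Rabs_mult, (Rabs_right (exp _)) by (apply Rle_ge, Rlt_le, exp_pos).
  assert (HI : is_RInt (fun r => K * exp ((mu + Lam) * r)) 0 t
    (K * exp ((mu + Lam) * t) / (mu + Lam) - K * exp ((mu + Lam) * 0) / (mu + Lam))).
  { apply (is_RInt_derive (fun r => K * exp ((mu + Lam) * r) / (mu + Lam))).
    - intros x _. auto_derive; auto. field. lra.
    - intros x _. apply (ex_derive_continuous (V := R_NormedModule)). auto_derive. auto. }
  assert (Rabs (RInt (fun r => exp (mu * r) * n r) 0 t) <=
     K * exp ((mu + Lam) * t) / (mu + Lam) - K * exp ((mu + Lam) * 0) / (mu + Lam)).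
  { apply (norm_RInt_le (V := R_NormedModule) (fun r => exp (mu * r) * n r)
       (fun r => K * exp ((mu + Lam) * r)) 0 t); auto.
    - intros x Hx. unfold norm; simpl. unfold abs; simpl.
      rewrite Rabs_mult, (Rabs_right (exp _)) by (apply Rle_ge, Rlt_le, exp_pos).
      rewrite Rmult_plus_distr_r, exp_plus.
      pose proof (exp_pos (mu * x)). specialize (Hb x Hx).
      replace (K * (exp (mu * x) * exp (Lam * x))) with (exp (mu * x) * (K * exp (Lam * x))) by ring.
      apply Rmult_le_compat_l; lra.
    - apply (RInt_correct (V := R_CompleteNormedModule)), duh_ex_RInt; auto. }
  assert (0 <= K * exp ((mu + Lam) * 0) / (mu + Lam)).
  { apply Rmult_le_pos; [apply Rmult_le_pos; [auto|left; apply exp_pos]|left; apply Rinv_0_lt_compat; auto]. }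
  apply Rle_trans with (exp (- mu * t) * (K * exp ((mu + Lam) * t) / (mu + Lam))).
  - apply Rmult_le_compat_l; [left; apply exp_pos|lra].
  - right. replace (Lam * t) with (- mu * t + (mu + Lam) * t) by ring. rewrite (exp_plus (- mu * t)).
    unfold Rdiv. ring.
Qed.

End Duhamel.

(** The resolvent sum is small for a large spectral shift; this is what makes the Picard map a
    contraction although the forcing gains only one order of decay. *)
Lemma resolvent_small (w B : R) : 0 < w -> 0 <= B -> exists Lam, 0 < Lam /\
  ex_series (fun k => / ((INR k * w) ^ 2 + Lam)) /\
  B * Series (fun k => / ((INR k * w) ^ 2 + Lam)) <= / 2.
Proof.
  intros Hw HB.
  (* with Lam = (w m)^2 the sum is compared to a telescoping one by k^2 + m^2 >= (k + m)^2 / 2 *)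
  set (m := 2 + 4 * B / (w * w)).
  assert (Hww : 0 < w * w) by (apply Rmult_lt_0_compat; auto).
  assert (Hm : 2 <= m).
  { unfold m. assert (0 <= 4 * B / (w * w)) by (apply Rmult_le_pos; [lra|left; apply Rinv_0_lt_compat; auto]). lra. }
  exists (w * w * (m * m)). split; [apply Rmult_lt_0_compat; nra|].
  set (a := fun k => / ((INR k * w) ^ 2 + w * w * (m * m))).
  assert (P : forall k, 0 < (INR k * w) ^ 2 + w * w * (m * m)).
  { intros k. assert (0 <= (INR k * w) ^ 2) by apply pow2_ge_0.
    assert (0 < w * w * (m * m)) by (apply Rmult_lt_0_compat; nra). lra. }
  assert (Ha : forall k, 0 <= a k) by (intros; left; apply Rinv_0_lt_compat, P).
  assert (Hb : forall k, a k <= 2 / (w * w) * (/ (INR k + (m - 1)) - / (INR (S k) + (m - 1)))).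
  { intros k. unfold a. rewrite S_INR. pose proof (pos_INR k).
    replace (2 / (w * w) * (/ (INR k + (m - 1)) - / (INR k + 1 + (m - 1))))
      with (/ (w * w * ((INR k + (m - 1)) * (INR k + m)) / 2)) by (field; repeat split; lra).
    apply Rinv_le_contravar.
    - assert (0 < w * w * ((INR k + (m - 1)) * (INR k + m))).
      { repeat apply Rmult_lt_0_compat; lra. } lra.
    - replace ((INR k * w) ^ 2 + w * w * (m * m)) with (w * w * (INR k * INR k + m * m)) by ring.
      unfold Rdiv. rewrite Rmult_assoc. apply Rmult_le_compat_l; [lra|].
      pose proof (Rle_0_sqr (INR k - m)). unfold Rsqr in *. nra. }
  assert (S : forall n, sum_n a n <= 2 / (w * w) * (/ (m - 1) - / (INR (S n) + (m - 1)))).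
  { induction n.
    - rewrite sum_O. eapply Rle_trans; [apply Hb|]. simpl INR. rewrite Rplus_0_l. lra.
    - rewrite sum_Sn. specialize (Hb (S n)).
      change (sum_n a n + a (S n) <= 2 / (w * w) * (/ (m - 1) - / (INR (S (S n)) + (m - 1)))). lra. }
  assert (S' : forall n, sum_n a n <= 2 / (w * w) * / (m - 1)).
  { intros n. eapply Rle_trans; [apply S|]. apply Rmult_le_compat_l.
    - apply Rlt_le, Rdiv_lt_0_compat; lra.
    - pose proof (pos_INR (Datatypes.S n)).
      assert (0 < / (INR (Datatypes.S n) + (m - 1))) by (apply Rinv_0_lt_compat; lra). lra. }
  split; [apply (ex_series_bounded a _ Ha S')|].
  pose proof (Series_bounded a _ Ha S') as Hs.
  apply Rle_trans with (B * (2 / (w * w) * / (m - 1))); [apply Rmult_le_compat_l; auto|].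
  apply Rmult_le_reg_r with (m - 1); [lra|].
  replace (B * (2 / (w * w) * / (m - 1)) * (m - 1)) with (/ 2 * (4 * B / (w * w))) by (field; lra).
  apply Rmult_le_compat_l; [lra|]. unfold m. lra.
Qed.

Lemma ell_dominated (x M : nat -> R) : ex_series M ->
  (forall k, (1 + INR k) * Rabs (x k) <= M k) -> ell x.
Proof.
  intros HM Hx. apply (ex_series_le_R _ M); auto. intros k.
  rewrite Rabs_right; auto. apply Rle_ge, Rmult_le_pos; [left; apply one_INR_pos|apply Rabs_pos].
Qed.

Lemma dist_flim {T} (F : (T -> Prop) -> Prop) {FF : Filter F} (X : nat -> T -> R) (z M : nat -> R) :
  ex_series M -> F (fun y => forall k, (1 + INR k) * Rabs (X k y) <= M k) ->
  (forall k, (1 + INR k) * Rabs (z k) <= M k) ->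
  (forall k, flim F (X k) (z k)) -> flim F (fun y => dist (fun k => X k y) z) 0.
Proof.
  intros HM HX Hz Hlim.
  replace 0 with (Series (fun _ : nat => 0 * 0)) by (rewrite Series_scal_l; ring).
  unfold dist. apply (flim_series F (fun k y => (1 + INR k) * Rabs (X k y - z k)) _ (fun k => M k + M k)).
  - apply ex_series_plus_R; auto.
  - revert HX. apply filter_imp. intros y Hy k.
    rewrite Rabs_mult, Rabs_Rabsolu, (Rabs_right (1 + INR (S k))) by (apply Rle_ge, Rlt_le, one_INR_pos).
    eapply Rle_trans; [|apply Rplus_le_compat; [apply Hy|apply Hz]].
    rewrite <- Rmult_plus_distr_l. apply Rmult_le_compat_l; [apply Rlt_le, one_INR_pos|].
    unfold Rminus. eapply Rle_trans; [apply Rabs_triang|]. rewrite Rabs_Ropp. lra.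
  - intros k. rewrite Rmult_0_l, Rabs_R0. specialize (Hz (S k)).
    pose proof (Rmult_le_pos _ _ (Rlt_le _ _ (one_INR_pos (S k))) (Rabs_pos (z (S k)))). lra.
  - intros k. rewrite Rmult_0_l, <- (Rmult_0_r (1 + INR k)).
    apply flim_mult; [exact FF|apply flim_const; exact FF|].
    rewrite <- Rabs_R0. apply (flim_comp F (fun y => X k y - z k) Rabs 0); [|apply Rabs_cont].
    replace 0 with (z k + - z k) by ring. apply (flim_plus F (X k) (fun _ => - z k)); auto.
    apply flim_const; exact FF.
Qed.

Lemma lip_flim {T} (F : (T -> Prop) -> Prop) {FF : Filter F} (N : (nat -> R) -> R) (C : R)
  (X : nat -> T -> R) (z M : nat -> R) :
  (forall x y, ell x -> ell y -> Rabs (N x - N y) <= C * dist x y) ->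
  ex_series M -> F (fun y => forall k, (1 + INR k) * Rabs (X k y) <= M k) ->
  (forall k, (1 + INR k) * Rabs (z k) <= M k) ->
  (forall k, flim F (X k) (z k)) -> flim F (fun y => N (fun k => X k y)) (N z).
Proof.
  intros HN HM HX Hz Hlim.
  pose proof (dist_flim F X z M HM HX Hz Hlim) as D.
  apply (flim_eps F); intros eps He.
  pose proof (flim_mult F _ _ _ _ (flim_const F C) D) as D1. rewrite Rmult_0_r in D1.
  flim_unfold D1. generalize (filter_and _ _ HX (D1 eps He)). apply filter_imp.
  intros y [Hy Hd]. rewrite Rminus_0_r in Hd.
  eapply Rle_lt_trans; [apply HN; apply (ell_dominated _ M); auto|].
  eapply Rle_lt_trans; [apply Rle_abs|exact Hd].
Qed.

Section Picard.
Variable w : R.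
Hypothesis Hw : 0 < w.
Variable N : nat -> (nat -> R) -> R.
Variable B : R.
Hypothesis HB : 0 <= B.
Hypothesis N_bound : forall k x, ell x -> Rabs (N k x) <= B / (1 + INR k).
Hypothesis N_lip : forall k x y, ell x -> ell y -> Rabs (N k x - N k y) <= B / (1 + INR k) * dist x y.
Variable alpha : nat -> R.
Hypothesis Halpha : ell alpha.

Notation mu k := ((INR k * w) ^ 2).

Variable Lam : R.
Hypothesis HLam : 0 < Lam.
Hypothesis Hres : ex_series (fun k => / (mu k + Lam)).
Hypothesis Hsmall : B * Series (fun k => / (mu k + Lam)) <= / 2.

(** The size of mode k after Duhamel integration of a forcing exp(Lam t)/(1+k). *)
Definition pw (k : nat) : R := / ((1 + INR k) * (mu k + Lam)).

Lemma mu_Lam_pos k : 0 < mu k + Lam.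
Proof. pose proof (pow2_ge_0 (INR k * w)). lra. Qed.

Lemma pw_pos k : 0 < pw k.
Proof. apply Rinv_0_lt_compat, Rmult_lt_0_compat; [apply one_INR_pos|apply mu_Lam_pos]. Qed.

Lemma pw_sum k : (1 + INR k) * pw k = / (mu k + Lam).
Proof. unfold pw. pose proof (one_INR_pos k). pose proof (mu_Lam_pos k). field. lra. Qed.

(** The space of the iteration; the factor exp(Lam t) takes the place of short times. *)
Definition good (a : nat -> R -> R) : Prop :=
  (forall k t, continuous (a k) t) /\
  exists M, 0 <= M /\ forall k t, 0 <= t -> Rabs (a k t) <= Rabs (alpha k) + M * exp (Lam * t) * pw k.

Definition forced (a : nat -> R -> R) (k : nat) (t : R) : R := N k (fun j => a j (Rmax 0 t)).

Lemma Rmax_cont (t : R) : continuous (Rmax 0) t.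
Proof.
  apply filterlim_locally. intros eps. exists eps. intros y Hy.
  eapply Rle_lt_trans; [|exact Hy].
  change (Rabs (Rmax 0 y - Rmax 0 t) <= Rabs (y - t)).
  unfold Rmax; repeat destruct Rle_dec; unfold Rabs; repeat destruct Rcase_abs; lra.
Qed.

Definition dom (M : R) (t : R) (k : nat) : R := (1 + INR k) * Rabs (alpha k) + M * exp (Lam * t) * / (mu k + Lam).

Lemma dom_ex M t : ex_series (dom M t).
Proof.
  unfold dom. apply ex_series_plus_R; [exact Halpha|].
  apply (ex_series_scal_R (M * exp (Lam * t)) (fun k => / (mu k + Lam))). exact Hres.
Qed.

Lemma good_dom a : good a -> exists M, 0 <= M /\ forall T k t, 0 <= t <= T ->
  (1 + INR k) * Rabs (a k t) <= dom M T k.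
Proof.
  intros [_ [M [HM Ha]]]. exists M. split; auto. intros T k t Ht.
  pose proof (one_INR_pos k). unfold dom. rewrite <- pw_sum.
  apply Rle_trans with ((1 + INR k) * (Rabs (alpha k) + M * exp (Lam * t) * pw k)).
  - apply Rmult_le_compat_l; [lra|apply Ha; lra].
  - assert (exp (Lam * t) <= exp (Lam * T)) by (apply exp_le; nra).
    pose proof (pw_pos k).
    assert (M * exp (Lam * t) <= M * exp (Lam * T)) by nra.
    assert (0 <= (1 + INR k) * pw k) by nra. nra.
Qed.

Lemma good_ell a t : good a -> 0 <= t -> ell (fun k => a k t).
Proof.
  intros Ha Ht. destruct (good_dom a Ha) as [M [_ HM]].
  apply (ex_series_le_R _ (dom M t)); [|apply dom_ex].
  intros k. rewrite Rabs_right; [apply HM; lra|].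
  apply Rle_ge, Rmult_le_pos; [left; apply one_INR_pos|apply Rabs_pos].
Qed.

Lemma forced_cont a k t : good a -> continuous (forced a k) t.
Proof.
  intros Ha. pose proof (one_INR_pos k). destruct (good_dom a Ha) as [M [HM0 HM]].
  set (T := Rmax 0 t + 1).
  pose proof (Rmax_l 0 t).
  apply (lip_flim (locally t) (N k) (B / (1 + INR k)) (fun j s => a j (Rmax 0 s))
     (fun j => a j (Rmax 0 t)) (dom M T)).
  - intros x y Hx Hy. auto.
  - apply dom_ex.
  - exists (mkposreal 1 Rlt_0_1). intros y Hy j. apply HM. split; [apply Rmax_l|].
    assert (Hy' : Rabs (y - t) < 1) by exact Hy. apply Rabs_def2 in Hy'.
    unfold T, Rmax. repeat destruct Rle_dec; lra.
  - intros j. apply HM. unfold T. lra.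
  - intros j. apply (flim_comp (locally t) (Rmax 0) (a j)); [apply Rmax_cont|apply Ha].
Qed.

Definition picard (a : nat -> R -> R) (k : nat) (t : R) : R :=
  duh (mu k) (alpha k) (forced a k) (Rmax 0 t).

Lemma exp_ge_1 t : 0 <= t -> 1 <= exp (Lam * t).
Proof. intros Ht. rewrite <- exp_0. apply exp_le. nra. Qed.

Lemma forced_bound a k t : good a -> Rabs (forced a k t) <= B / (1 + INR k) * exp (Lam * Rmax 0 t).
Proof.
  intros Ha. pose proof (Rmax_l 0 t) as H. unfold forced.
  eapply Rle_trans; [apply N_bound, good_ell; auto|].
  assert (0 <= B / (1 + INR k)) by (apply Rmult_le_pos; [auto|left; apply Rinv_0_lt_compat, one_INR_pos]).
  pose proof (exp_ge_1 _ H). nra.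
Qed.

Lemma duh_forced_bound a k t : good a -> 0 <= t ->
  Rabs (duh (mu k) 0 (forced a k) t) <= B * exp (Lam * t) * pw k.
Proof.
  intros Ha Ht. pose proof (one_INR_pos k). pose proof (mu_Lam_pos k).
  replace (B * exp (Lam * t) * pw k) with (B / (1 + INR k) * exp (Lam * t) / (mu k + Lam))
    by (unfold pw; field; lra).
  apply duh_bound; auto.
  - apply Rmult_le_pos; [auto|left; apply Rinv_0_lt_compat, one_INR_pos].
  - intros s. apply forced_cont; auto.
  - intros r Hr. pose proof (forced_bound a k r Ha) as Hb. rewrite (Rmax_right 0 r) in Hb by lra. exact Hb.
Qed.

Lemma exp_neg_le_1 k t : 0 <= t -> exp (- mu k * t) <= 1.
Proof. intros Ht. rewrite <- exp_0. apply exp_le. pose proof (pow2_ge_0 (INR k * w)). nra. Qed.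

Lemma heat_bound k t : 0 <= t -> Rabs (exp (- mu k * t) * alpha k) <= Rabs (alpha k).
Proof.
  intros Ht. rewrite Rabs_mult, (Rabs_right (exp _)) by (apply Rle_ge, Rlt_le, exp_pos).
  pose proof (exp_neg_le_1 k t Ht). pose proof (Rabs_pos (alpha k)). nra.
Qed.

Lemma picard_good a : good a -> good (picard a).
Proof.
  intros Ha. split.
  - intros k t. unfold picard. apply (continuous_comp (Rmax 0) (duh (mu k) (alpha k) (forced a k))).
    + apply Rmax_cont.
    + apply (ex_derive_continuous (V := R_NormedModule)). eexists. apply duh_is_derive.
      intros s. apply forced_cont; auto.
  - exists B. split; auto. intros k t Ht. unfold picard. rewrite Rmax_right, duh_split by auto.
    eapply Rle_trans; [apply Rabs_triang|]. apply Rplus_le_compat; [apply heat_bound; auto|].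
    apply duh_forced_bound; auto.
Qed.

(** Duhamel integration turns 1/(1+k) into [pw k], and summing (1+k) [pw k] gives the resolvent
    sum. *)
Lemma picard_contract a b D : good a -> good b -> 0 <= D ->
  (forall k t, 0 <= t -> Rabs (a k t - b k t) <= D * exp (Lam * t) * pw k) ->
  forall k t, 0 <= t -> Rabs (picard a k t - picard b k t) <= D / 2 * exp (Lam * t) * pw k.
Proof.
  intros Ha Hb HD Hab k t Ht. unfold picard. rewrite !Rmax_right by auto.
  rewrite duh_minus by (intros; apply forced_cont; auto).
  pose proof (one_INR_pos k). pose proof (mu_Lam_pos k).
  replace (D / 2 * exp (Lam * t) * pw k) with (D / 2 / (1 + INR k) * exp (Lam * t) / (mu k + Lam))
    by (unfold pw; field; lra).
  apply duh_bound; auto.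
  - apply Rmult_le_pos; [lra|left; apply Rinv_0_lt_compat; auto].
  - intros s. apply (continuous_minus (V := R_NormedModule)); apply forced_cont; auto.
  - intros r Hr. unfold forced. rewrite Rmax_right by lra.
    eapply Rle_trans; [apply N_lip; apply good_ell; auto; lra|].
    assert (Hdist : dist (fun j => a j r) (fun j => b j r) <= D * exp (Lam * r) * Series (fun k => / (mu k + Lam))).
    { unfold dist. rewrite <- Series_scal_l. apply Series_le; [|apply ex_series_scal_R; auto].
      intros j. pose proof (one_INR_pos j). split; [apply Rmult_le_pos; [lra|apply Rabs_pos]|].
      rewrite <- pw_sum.
      replace (D * exp (Lam * r) * ((1 + INR j) * pw j)) with ((1 + INR j) * (D * exp (Lam * r) * pw j)) by ring.
      apply Rmult_le_compat_l; [lra|]. apply Hab. lra. }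
    apply Rle_trans with (B / (1 + INR k) * (D * exp (Lam * r) * Series (fun k => / (mu k + Lam)))).
    { apply Rmult_le_compat_l; auto. apply Rmult_le_pos; [auto|left; apply Rinv_0_lt_compat; auto]. }
    replace (B / (1 + INR k) * (D * exp (Lam * r) * Series (fun k => / (mu k + Lam))))
      with (D / (1 + INR k) * exp (Lam * r) * (B * Series (fun k => / (mu k + Lam)))) by (field; lra).
    replace (D / 2 / (1 + INR k) * exp (Lam * r)) with (D / (1 + INR k) * exp (Lam * r) * / 2) by (field; lra).
    apply Rmult_le_compat_l; auto.
    apply Rmult_le_pos; [|left; apply exp_pos]. apply Rmult_le_pos; [auto|left; apply Rinv_0_lt_compat; auto].
Qed.

Fixpoint iter (n : nat) : nat -> R -> R :=
  match n with
  | O => fun k t => exp (- mu k * Rmax 0 t) * alpha k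
  | S m => picard (iter m)
  end.

Lemma iter_good n : good (iter n).
Proof.
  induction n; [|apply picard_good; auto]. split.
  - intros k t. simpl iter. apply (continuous_comp (Rmax 0) (fun s => exp (- mu k * s) * alpha k)).
    + apply Rmax_cont.
    + apply (ex_derive_continuous (V := R_NormedModule)). auto_derive. auto.
  - exists 0. split; [lra|]. intros k t Ht. simpl iter. rewrite Rmax_right by auto.
    eapply Rle_trans; [apply heat_bound; auto|]. lra.
Qed.

Lemma iter_diff n : forall k t, 0 <= t ->
  Rabs (iter (S n) k t - iter n k t) <= B * (/ 2) ^ n * exp (Lam * t) * pw k.
Proof.
  induction n; intros k t Ht.
  - rewrite pow_O, Rmult_1_r. change (iter 1 k t) with (duh (mu k) (alpha k) (forced (iter 0) k) (Rmax 0 t)).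
    change (iter 0 k t) with (exp (- mu k * Rmax 0 t) * alpha k).
    rewrite !Rmax_right, duh_split by auto.
    match goal with |- Rabs (?u + ?v - ?u) <= _ => replace (u + v - u) with v by ring end.
    apply (duh_forced_bound (iter 0)); auto. apply iter_good.
  - replace (B * (/ 2) ^ S n * exp (Lam * t) * pw k) with (B * (/ 2) ^ n / 2 * exp (Lam * t) * pw k)
      by (simpl; field).
    apply (picard_contract (iter (S n)) (iter n)); auto; try apply iter_good.
    apply Rmult_le_pos; auto. apply pow_le. lra.
Qed.

Lemma geom_ex : ex_series (fun n => (/ 2) ^ n).
Proof. apply ex_series_geom. rewrite Rabs_right; lra. Qed.

(** The limit of the iteration, as a telescoping series. *)
Definition sol (k : nat) (t : R) : R :=
  iter 0 k t + Series (fun n => iter (S n) k (Rmax 0 t) - iter n k (Rmax 0 t)).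

Lemma iter_Rmax n k t : iter n k (Rmax 0 t) = iter n k t.
Proof.
  assert (E : Rmax 0 (Rmax 0 t) = Rmax 0 t) by (apply Rmax_right, Rmax_l).
  destruct n; simpl iter; unfold picard; rewrite E; reflexivity.
Qed.

Lemma sol_iter n k t : 0 <= t -> Rabs (sol k t - iter n k t) <= 2 * B * (/ 2) ^ n * exp (Lam * t) * pw k.
Proof.
  intros Ht. unfold sol. rewrite Rmax_right by auto.
  set (d := fun n => iter (S n) k t - iter n k t).
  set (K := B * exp (Lam * t) * pw k).
  assert (Hd : forall n, Rabs (d n) <= K * (/ 2) ^ n).
  { intros m. unfold d, K. eapply Rle_trans; [apply iter_diff; auto|]. right. ring. }
  assert (Ed : ex_series d).
  { apply (ex_series_le_R _ (fun n => K * (/ 2) ^ n)); auto. apply ex_series_scal_R, geom_ex. }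
  assert (E : iter 0 k t + Series d - iter n k t = Series (fun m => d (n + m)%nat)).
  { destruct n as [|n].
    - simpl plus. change (Series (fun m => d (0 + m)%nat)) with (Series d). ring.
    - rewrite (Series_split d n Ed).
      assert (T : iter 0 k t + sum_n d n = iter (S n) k t).
      { clear. induction n.
        - rewrite sum_O. unfold d. ring.
        - rewrite sum_Sn. change (plus (sum_n d n) (d (S n))) with (sum_n d n + d (S n)).
          rewrite <- Rplus_assoc, IHn. unfold d. ring. }
      rewrite <- Rplus_assoc, T. ring. }
  rewrite E.
  eapply Rle_trans; [apply (Series_abs_le _ (fun m => K * (/ 2) ^ n * (/ 2) ^ m))|].
  - intros m. eapply Rle_trans; [apply Hd|]. rewrite pow_add. right. ring.
  - apply ex_series_scal_R, geom_ex.
  - rewrite Series_scal_l, Series_geom by (rewrite Rabs_right; lra). unfold K. right. field.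
Qed.

Lemma sol_good : good sol.
Proof.
  split.
  - intros k t. unfold sol.
    apply (continuous_plus (V := R_NormedModule) (fun t => iter 0 k t)); [apply iter_good|].
    set (T := Rmax 0 t + 1).
    assert (Bound : forall y n, Rmax 0 y <= T ->
      Rabs (iter (S n) k (Rmax 0 y) - iter n k (Rmax 0 y)) <= B * exp (Lam * T) * pw k * (/ 2) ^ n).
    { intros y n HyT. eapply Rle_trans; [apply iter_diff, Rmax_l|].
      assert (exp (Lam * Rmax 0 y) <= exp (Lam * T)) by (apply exp_le, Rmult_le_compat_l; lra).
      pose proof (pw_pos k). assert (0 <= (/ 2) ^ n) by (apply pow_le; lra).
      replace (B * (/ 2) ^ n * exp (Lam * Rmax 0 y) * pw k)
        with (B * pw k * (/ 2) ^ n * exp (Lam * Rmax 0 y)) by ring.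
      replace (B * exp (Lam * T) * pw k * (/ 2) ^ n) with (B * pw k * (/ 2) ^ n * exp (Lam * T)) by ring.
      apply Rmult_le_compat_l; auto. apply Rmult_le_pos; [apply Rmult_le_pos; lra|auto]. }
    apply (flim_series (locally t) (fun n s => iter (S n) k (Rmax 0 s) - iter n k (Rmax 0 s)) _
       (fun n => B * exp (Lam * T) * pw k * (/ 2) ^ n)).
    + apply ex_series_scal_R, geom_ex.
    + exists (mkposreal 1 Rlt_0_1). intros y Hy n. apply Bound.
      assert (Hy' : Rabs (y - t) < 1) by exact Hy. apply Rabs_def2 in Hy'.
      unfold T, Rmax. repeat destruct Rle_dec; lra.
    + intros n. apply Bound. unfold T. lra.
    + intros n. rewrite !iter_Rmax.
      apply (filterlim_ext (fun s => iter (S n) k s - iter n k s)).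
      { intros s. rewrite !iter_Rmax. reflexivity. }
      apply (continuous_minus (V := R_NormedModule) (fun s => iter (S n) k s)); apply iter_good.
  - exists (2 * B). split; [lra|]. intros k t Ht.
    pose proof (sol_iter 0 k t Ht) as H. rewrite pow_O, Rmult_1_r in H.
    pose proof (heat_bound k t Ht) as Hh.
    assert (E : iter 0 k t = exp (- mu k * t) * alpha k) by (simpl iter; rewrite Rmax_right by auto; reflexivity).
    rewrite E in H.
    replace (sol k t) with ((sol k t - exp (- mu k * t) * alpha k) + exp (- mu k * t) * alpha k) by ring.
    eapply Rle_trans; [apply Rabs_triang|]. lra.
Qed.

Lemma sol_fixed k t : 0 <= t -> sol k t = picard sol k t.
Proof.
  intros Ht. apply Rminus_diag_uniq. apply Rabs_eq_0. apply Rle_antisym; [|apply Rabs_pos].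
  apply Rnot_lt_le. intros Hpos.
  set (K := 2 * B * exp (Lam * t) * pw k).
  assert (Hn : forall n, Rabs (sol k t - picard sol k t) <= K * (/ 2) ^ n).
  { intros n.
    assert (H1 := sol_iter (S n) k t Ht).
    assert (H2 := picard_contract sol (iter n) (2 * B * (/ 2) ^ n) sol_good (iter_good n)).
    specialize (H2 ltac:(apply Rmult_le_pos; [lra|apply pow_le; lra]) (fun k t Ht => sol_iter n k t Ht) k t Ht).
    change (picard (iter n) k t) with (iter (S n) k t) in H2.
    replace (sol k t - picard sol k t) with ((sol k t - iter (S n) k t) + - (picard sol k t - iter (S n) k t)) by ring.
    eapply Rle_trans; [apply Rabs_triang|]. rewrite Rabs_Ropp. simpl pow in H1. unfold K.
    apply Rle_trans with (2 * B * (/ 2 * (/ 2) ^ n) * exp (Lam * t) * pw k + 2 * B * (/ 2) ^ n / 2 * exp (Lam * t) * pw k); [lra|].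
    right. field. }
  destruct (pow_lt_1_zero (/ 2) ltac:(rewrite Rabs_right; lra) (Rabs (sol k t - picard sol k t) / (K + 1))) as [n Hp].
  - apply Rdiv_lt_0_compat; auto. unfold K. pose proof (exp_pos (Lam * t)). pose proof (pw_pos k).
    assert (0 <= 2 * B * exp (Lam * t) * pw k) by (repeat apply Rmult_le_pos; lra). lra.
  - specialize (Hp n (le_n n)). specialize (Hn n).
    assert (HK : 0 <= K) by (unfold K; pose proof (exp_pos (Lam * t)); pose proof (pw_pos k); repeat apply Rmult_le_pos; lra).
    rewrite Rabs_right in Hp by (apply Rle_ge, pow_le; lra).
    assert (K * (/ 2) ^ n <= (K + 1) * (/ 2) ^ n) by (apply Rmult_le_compat_r; [apply pow_le; lra|lra]).
    assert ((K + 1) * (/ 2) ^ n < (K + 1) * (Rabs (sol k t - picard sol k t) / (K + 1))) by (apply Rmult_lt_compat_l; lra).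
    replace ((K + 1) * (Rabs (sol k t - picard sol k t) / (K + 1))) with (Rabs (sol k t - picard sol k t)) in H0 by (field; lra).
    lra.
Qed.

End Picard.

(** The exponential weight in time makes the Picard map a contraction on the whole half-line at
    once. *)
Theorem mild_solution (w : R) (N : nat -> (nat -> R) -> R) (B : R) (alpha : nat -> R) :
  0 < w -> 0 <= B ->
  (forall k x, ell x -> Rabs (N k x) <= B / (1 + INR k)) ->
  (forall k x y, ell x -> ell y -> Rabs (N k x - N k y) <= B / (1 + INR k) * dist x y) ->
  ell alpha ->
  exists a : nat -> R -> R,
    (forall k t, continuous (a k) t) /\
    (forall k t, continuous (fun t => N k (fun j => a j (Rmax 0 t))) t) /\
    (forall k t, 0 <= t -> a k t = duh ((INR k * w) ^ 2) (alpha k) (fun t => N k (fun j => a j (Rmax 0 t))) t) /\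
    (forall T, 0 <= T -> exists M, ex_series M /\ forall k t, 0 <= t <= T -> (1 + INR k) * Rabs (a k t) <= M k).
Proof.
  intros Hw HB Hb Hl Ha.
  destruct (resolvent_small w B Hw HB) as [Lam [HLam [Hres Hsmall]]].
  pose proof (sol_good w N B HB Hb Hl alpha Ha Lam HLam Hres Hsmall) as G.
  exists (sol w N alpha). split; [apply G|]. split; [|split].
  - intros k t. exact (forced_cont w N B Hl alpha Ha Lam HLam Hres _ k t G).
  - intros k t Ht. assert (E : sol w N alpha k t = picard w N alpha (sol w N alpha) k t) by exact (sol_fixed w N B HB Hb Hl alpha Ha Lam HLam Hres Hsmall k t Ht).
    rewrite E at 1. unfold picard. rewrite Rmax_right by auto. reflexivity.
  - intros T HT. destruct (good_dom w alpha Lam HLam _ G) as [M [_ HM]].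
    exists (dom w alpha Lam M T). split; [apply dom_ex; auto|]. intros k t Ht. apply HM; auto.
Qed.

(** * Decay of the Fourier coefficients of the tangent *)

Lemma dist_nat_le j k : (dist_nat j k <= j + k)%nat.
Proof. unfold dist_nat. lia. Qed.

Lemma wt_decr q j k : (j <= k)%nat -> wt q k <= wt q j.
Proof.
  intros H. apply le_INR in H. unfold wt. pose proof (pos_INR j).
  apply Rinv_le_contravar; [apply pow_lt; lra|]. apply pow_incr. lra.
Qed.

Lemma sum_wt2_dist k n : sum_n (fun j => wt 2 (dist_nat j k)) n <= 3.
Proof.
  assert (T : forall m, wt 2 (S m) <= / (1 + INR m) - / (2 + INR m)).
  { intros m. unfold wt. rewrite S_INR. pose proof (pos_INR m).
    replace (/ (1 + INR m) - / (2 + INR m)) with (/ ((1 + INR m) * (2 + INR m))) by (field; lra).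
    apply Rinv_le_contravar; [nra|]. simpl. nra. }
  assert (S1 : forall n, (n < k)%nat -> sum_n (fun j => wt 2 (dist_nat j k)) n <= / (INR k - INR n)).
  { intros m. induction m; intros Hm.
    - rewrite sum_O. unfold dist_nat. destruct k as [|k]; [lia|]. simpl minus.
      change (0 + S k)%nat with (S k).
      eapply Rle_trans; [apply T|]. rewrite S_INR. simpl INR. rewrite Rminus_0_r.
      pose proof (pos_INR k). assert (0 < / (2 + INR k)) by (apply Rinv_0_lt_compat; lra).
      rewrite (Rplus_comm (INR k)). lra.
    - rewrite sum_Sn. specialize (IHm ltac:(lia)).
      change (sum_n (fun j => wt 2 (dist_nat j k)) m + wt 2 (dist_nat (S m) k) <= / (INR k - INR (S m))).
      replace (dist_nat (S m) k) with (S (k - S (S m)))%nat by (unfold dist_nat; lia).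
      specialize (T (k - S (S m))%nat). rewrite minus_INR, !S_INR in T by lia. rewrite !S_INR.
      replace (1 + (INR k - (INR m + 1 + 1))) with (INR k - (INR m + 1)) in T by ring.
      replace (2 + (INR k - (INR m + 1 + 1))) with (INR k - INR m) in T by ring. lra. }
  assert (S2 : forall m, sum_n (fun j => wt 2 (dist_nat j k)) (k + m) <= 3 - / (1 + INR m)).
  { induction m.
    - rewrite Nat.add_0_r. simpl INR.
      assert (E : wt 2 (dist_nat k k) <= 1) by apply wt_le_1.
      destruct k as [|k].
      + rewrite sum_O. lra.
      + rewrite sum_Sn. specialize (S1 k ltac:(lia)). rewrite S_INR in S1.
        replace (INR k + 1 - INR k) with 1 in S1 by ring.
        change (sum_n (fun j => wt 2 (dist_nat j (S k))) k + wt 2 (dist_nat (S k) (S k)) <= 3 - / (1 + 0)). lra.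
    - rewrite Nat.add_succ_r, sum_Sn.
      change (sum_n (fun j => wt 2 (dist_nat j k)) (k + m) + wt 2 (dist_nat (S (k + m)) k) <= 3 - / (1 + INR (S m))).
      replace (dist_nat (S (k + m)) k) with (S m) by (unfold dist_nat; lia).
      specialize (T m). rewrite S_INR. replace (1 + (INR m + 1)) with (2 + INR m) by ring. lra. }
  destruct (Nat.lt_ge_cases n k) as [H|H].
  - eapply Rle_trans; [apply S1; auto|].
    assert (1 <= INR k - INR n).
    { rewrite <- minus_INR by lia. replace 1 with (INR 1) by reflexivity. apply le_INR. lia. }
    apply Rle_trans with (/ 1); [apply Rinv_le_contravar; lra|lra].
  - replace n with (k + (n - k))%nat by lia. eapply Rle_trans; [apply S2|].
    pose proof (Rinv_0_lt_compat _ (one_INR_pos (n - k))). lra.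
Qed.

(** Young-type inequality behind the convolution estimate: one of the two factors carries the
    decay in k, the other one stays summable. *)
Lemma wt_conv_term r q j k : (2 <= r)%nat -> (q <= r)%nat ->
  wt r j * wt q (dist_nat j k) <= 2 ^ q * wt q k * (wt 2 j + wt 2 (dist_nat j k)).
Proof.
  intros Hr Hq. set (d := dist_nat j k).
  assert (Hd : INR k <= INR j + INR d).
  { rewrite <- plus_INR. apply le_INR. unfold d, dist_nat. lia. }
  pose proof (pos_INR j). pose proof (pos_INR d). pose proof (pos_INR k).
  assert (P : forall u, INR k <= 2 * INR u + 1 -> wt q u <= 2 ^ q * wt q k).
  { intros u Hu. unfold wt. pose proof (pos_INR u).
    assert (0 < (1 + INR u) ^ q) by (apply pow_lt; lra).
    assert (0 < (1 + INR k) ^ q) by (apply pow_lt; lra).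
    apply Rmult_le_reg_r with ((1 + INR u) ^ q); auto. rewrite Rinv_l by lra.
    apply Rmult_le_reg_r with ((1 + INR k) ^ q); auto.
    replace (2 ^ q * / (1 + INR k) ^ q * (1 + INR u) ^ q * (1 + INR k) ^ q)
      with (2 ^ q * (1 + INR u) ^ q) by (field; lra).
    rewrite Rmult_1_l, <- Rpow_mult_distr. apply pow_incr. lra. }
  pose proof (wt_pos 2 j). pose proof (wt_pos 2 d). pose proof (wt_pos q k).
  assert (0 < 2 ^ q) by (apply pow_lt; lra).
  assert (0 < 2 ^ q * wt q k) by (apply Rmult_lt_0_compat; auto).
  destruct (Rle_dec (INR j) (INR d)) as [Hjd|Hjd].
  - assert (A := P d ltac:(lra)).
    assert (wt r j <= wt 2 j) by (apply wt_anti; auto).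
    pose proof (wt_pos r j). pose proof (wt_pos q d).
    apply Rle_trans with (wt 2 j * (2 ^ q * wt q k)); [apply Rmult_le_compat; lra|]. nra.
  - assert (A := P j ltac:(lra)).
    replace r with (q + (r - q))%nat by lia. rewrite wt_mult.
    assert (M : wt (r - q) j * wt q d <= wt 2 d).
    { (* here 1 + d <= 1 + j, so all the decay may be counted in d *)
      assert (wt (r - q) j <= wt (r - q) d).
      { unfold wt. apply Rinv_le_contravar; [apply pow_lt; lra|]. apply pow_incr. lra. }
      pose proof (wt_pos q d). pose proof (wt_pos (r - q) d).
      apply Rle_trans with (wt (r - q) d * wt q d); [apply Rmult_le_compat_r; lra|].
      rewrite <- wt_mult. apply wt_anti. lia. }
    pose proof (wt_pos (r - q) j). pose proof (wt_pos q j). pose proof (wt_pos q d).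
    assert (0 <= wt (r - q) j * wt q d) by nra.
    apply Rle_trans with (2 ^ q * wt q k * (wt 2 d)); [|nra].
    rewrite Rmult_assoc. apply Rmult_le_compat; lra.
Qed.

Lemma sum_n_le (a b : nat -> R) n : (forall k, a k <= b k) -> sum_n a n <= sum_n b n.
Proof.
  intros H. induction n; [rewrite !sum_O; auto|]. rewrite !sum_Sn.
  apply Rplus_le_compat; auto.
Qed.

Lemma wt_conv r q k n : (2 <= r)%nat -> (q <= r)%nat ->
  sum_n (fun j => wt r j * wt q (dist_nat j k)) n <= 5 * 2 ^ q * wt q k.
Proof.
  intros Hr Hq. set (c := 2 ^ q * wt q k).
  assert (Hc : 0 < c) by (apply Rmult_lt_0_compat; [apply pow_lt; lra|apply wt_pos]).
  eapply Rle_trans; [apply (sum_n_le _ (fun j => c * (wt 2 j + wt 2 (dist_nat j k))))|].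
  - intros j. apply wt_conv_term; auto.
  - assert (E : sum_n (fun j => c * (wt 2 j + wt 2 (dist_nat j k))) n =
      c * (sum_n (wt 2) n + sum_n (fun j => wt 2 (dist_nat j k)) n)).
    { induction n; [rewrite !sum_O; reflexivity|]. rewrite !sum_Sn, IHn.
      unfold plus; simpl. ring. }
    rewrite E. pose proof (sum_wt2 n). pose proof (sum_wt2_dist k n).
    pose proof (Rinv_0_lt_compat _ (one_INR_pos n)).
    replace (5 * 2 ^ q * wt q k) with (c * 5) by (unfold c; ring).
    apply Rmult_le_compat_l; lra.
Qed.

Section Bootstrap.
Variable L : R.
Hypothesis HL : 0 < L.
Notation w := (freq L).
Notation Int := (integ L).
Notation fser := (fser L).

Lemma fser_1_sin x s : fser 1 x s = Series (fun k => - (INR k * w) * x k * sinw L k s).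
Proof. apply Series_ext. intros k. rewrite phase_1. ring. Qed.

Lemma cosw_by_parts k (g g' : R -> R) :
  (forall s, seg L s -> deriv_in (seg L) g s (g' s)) -> cseg L g' ->
  Int (fun s => g s * cosw L (S k) s) = - / (INR (S k) * w) * Int (fun s => g' s * sinw L (S k) s).
Proof.
  intros Hg Cg. pose proof (freq_pos L HL) as Hw. pose proof (pos_INR k) as Hk.
  pose proof (kw_S_pos L HL k) as Hkw.
  pose proof (cseg_deriv L g g' Hg) as Cg0.
  rewrite (Int_ext L HL _ (fun s => cosw L (S k) s * g s)) by (intros; ring).
  rewrite (Int_by_parts L HL (fun s => / (INR (S k) * w) * sinw L (S k) s) g (cosw L (S k)) g'); auto.
  - rewrite sinw_0, sinw_L by auto.
    rewrite (Int_ext L HL _ (fun s => / (INR (S k) * w) * (g' s * sinw L (S k) s))) by (intros; ring).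
    rewrite Int_scal by auto with cseg. ring.
  - intros s Hs.
    apply (deriv_in_eq _ _ _ (/ (INR (S k) * w) * (INR (S k) * w * cosw L (S k) s))).
    + field. split; [lra|]. rewrite S_INR. lra.
    + apply deriv_in_scal. apply is_derive_deriv_in. apply sinw_is_derive; auto.
  - apply cosw_cseg.
Qed.

(** If g' = h theta' and the cosine coefficients of h decay at rate q, those of g decay at
    rate q + 1: integrate by parts and expand theta' in its sine series. *)
Lemma coef_gain p q x C Q (g h : R -> R) : (3 <= p)%nat -> (q + 1 <= p)%nat -> 0 <= C -> 0 <= Q ->
  ell x -> (forall j, Rabs (x (S j)) <= C * wt p (S j)) ->
  cseg L h -> (forall s, seg L s -> deriv_in (seg L) g s (h s * fser 1 x s)) ->
  (forall k, Rabs (Int (fun s => h s * cosw L k s)) <= Q * wt q k) ->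
  forall k, Rabs (Int (fun s => g s * cosw L (S k) s)) <= 10 * 2 ^ q * Q * C * wt (S q) (S k).
Proof.
  intros Hp Hq HC HQ Hell Hx Ch Hg Hh k.
  pose proof (freq_pos L HL) as Hw. pose proof (pos_INR k) as Hk.
  assert (C1 : cseg L (fser 1 x)) by (apply fser_cseg; auto; apply ell_1; auto).
  rewrite (cosw_by_parts k g (fun s => h s * fser 1 x s)); auto with cseg.
  pose proof (kw_S_pos L HL k) as Hkw.
  set (m := S k) in *.
  assert (Hxw : forall j, INR j * w * Rabs (x j) <= w * C * wt (p - 1) j).
  { intros [|j]; [simpl INR; rewrite !Rmult_0_l; apply Rmult_le_pos; [nra|left; apply wt_pos]|].
    specialize (Hx j). pose proof (pos_INR (S j)).
    replace (INR (S j) * w * Rabs (x (S j))) with (w * (INR (S j) * Rabs (x (S j)))) by ring.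
    rewrite Rmult_assoc. apply Rmult_le_compat_l; [lra|].
    replace p with (S (p - 1)) in Hx by lia. rewrite wt_S in Hx.
    apply Rle_trans with (INR (S j) * (C * (wt (p - 1) (S j) / (1 + INR (S j))))); [apply Rmult_le_compat_l; auto|].
    replace (INR (S j) * (C * (wt (p - 1) (S j) / (1 + INR (S j)))))
      with (C * wt (p - 1) (S j) * (INR (S j) * / (1 + INR (S j)))) by (field; lra).
    pose proof (wt_pos (p - 1) (S j)). assert (0 <= C * wt (p - 1) (S j)) by nra.
    assert (INR (S j) * / (1 + INR (S j)) <= 1).
    { apply Rmult_le_reg_r with (1 + INR (S j)); [lra|]. rewrite Rmult_assoc, Rinv_l; lra. }
    nra. }
  set (u := fun j s => - (INR j * w) * x j * (h s * (sinw L j s * sinw L m s))).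
  assert (Cu : forall j, cseg L (u j)) by (intros; unfold u; auto with cseg).
  destruct (seg_bounded L HL h Ch) as [H HH].
  assert (HH0 : 0 <= H) by (eapply Rle_trans; [apply Rabs_pos|apply (HH 0); apply seg_0; auto]).
  assert (E1 : Int (fun s => h s * fser 1 x s * sinw L m s) = Series (fun j => Int (u j))).
  { rewrite <- (Int_series L HL u (fun j => INR j * w * Rabs (x j) * H)); auto.
    - apply Int_ext; auto. intros s _. rewrite fser_1_sin. rewrite (Rmult_comm (h s)), Rmult_assoc, <- Series_scal_r.
      apply Series_ext. intros j. unfold u. ring.
    - apply (ex_series_le_R _ (fun j => w * C * H * wt 2 j)).
      + intros j. rewrite Rabs_right.
        * replace (w * C * H * wt 2 j) with (w * C * wt 2 j * H) by ring.
          apply Rmult_le_compat_r; auto. eapply Rle_trans; [apply Hxw|].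
          apply Rmult_le_compat_l; [nra|]. apply wt_anti. lia.
        * apply Rle_ge. apply Rmult_le_pos; auto. apply Rmult_le_pos; [apply kw_nonneg; auto|apply Rabs_pos].
      + apply ex_series_scal_R, ex_series_wt2.
    - intros j s Hs. unfold u. rewrite !Rabs_mult, Rabs_Ropp, !Rabs_mult.
      rewrite (Rabs_right (INR (S j))) by (apply Rle_ge, pos_INR). rewrite (Rabs_right w) by lra.
      apply Rmult_le_compat_l.
      + apply Rmult_le_pos; [apply kw_nonneg; auto|apply Rabs_pos].
      + specialize (HH s Hs). pose proof (sinw_bound L (S j) s). pose proof (sinw_bound L m s).
        pose proof (Rabs_pos (h s)). pose proof (Rabs_pos (sinw L (S j) s)). pose proof (Rabs_pos (sinw L m s)).
        assert (Rabs (sinw L (S j) s) * Rabs (sinw L m s) <= 1) by nra. nra. }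
  assert (Bu : forall j, Rabs (Int (u j)) <= w * C * Q * (wt (p - 1) j * wt q (dist_nat j m))).
  { intros j. unfold u. rewrite Int_scal by auto with cseg.
    rewrite (Int_ext L HL _ (fun s => / 2 * (h s * cosw L (dist_nat j m) s - h s * cosw L (j + m) s))).
    - rewrite Int_scal, Int_minus by auto with cseg.
      rewrite !Rabs_mult, Rabs_Ropp, (Rabs_right (INR j * w)) by (apply Rle_ge, kw_nonneg; auto).
      rewrite (Rabs_right (/ 2)) by lra.
      assert (A1 := Hh (dist_nat j m)). assert (A2 := Hh (j + m)%nat).
      assert (A3 : wt q (j + m) <= wt q (dist_nat j m)) by (apply wt_decr, dist_nat_le).
      assert (A4 : Rabs (Int (fun s => h s * cosw L (dist_nat j m) s) - Int (fun s => h s * cosw L (j + m) s))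
         <= 2 * (Q * wt q (dist_nat j m))).
      { unfold Rminus. eapply Rle_trans; [apply Rabs_triang|]. rewrite Rabs_Ropp.
        assert (Q * wt q (j + m) <= Q * wt q (dist_nat j m)) by (apply Rmult_le_compat_l; auto). lra. }
      replace (w * C * Q * (wt (p - 1) j * wt q (dist_nat j m)))
        with (w * C * wt (p - 1) j * (Q * wt q (dist_nat j m))) by ring.
      apply Rmult_le_compat; [apply Rmult_le_pos; [apply kw_nonneg; auto|apply Rabs_pos]| |apply Hxw|lra].
      apply Rmult_le_pos; [lra|apply Rabs_pos].
    - intros s _. rewrite sinw_sinw. ring. }
  rewrite E1, Rabs_mult, Rabs_Ropp, Rabs_right by (apply Rle_ge, Rlt_le, Rinv_0_lt_compat; auto).
  assert (BS : Rabs (Series (fun j => Int (u j))) <= w * C * Q * (5 * 2 ^ q * wt q m)).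
  { assert (P0 : forall j, 0 <= wt (p - 1) j * wt q (dist_nat j m)).
    { intros j. apply Rmult_le_pos; left; apply wt_pos. }
    assert (PB : forall n, sum_n (fun j => wt (p - 1) j * wt q (dist_nat j m)) n <= 5 * 2 ^ q * wt q m).
    { intros n. apply wt_conv; lia. }
    eapply Rle_trans; [apply (Series_abs_le _ (fun j => w * C * Q * (wt (p - 1) j * wt q (dist_nat j m)))); auto|].
    - apply ex_series_scal_R. eapply ex_series_bounded; [exact P0|exact PB].
    - rewrite Series_scal_l. apply Rmult_le_compat_l; [apply Rmult_le_pos; [nra|auto]|].
      apply Series_bounded; auto. }
  apply Rle_trans with (/ (INR m * w) * (w * C * Q * (5 * 2 ^ q * wt q m))).
  { apply Rmult_le_compat_l; auto. left. apply Rinv_0_lt_compat; auto. }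
  pose proof (wt_pos q m). assert (0 < 2 ^ q) by (apply pow_lt; lra).
  assert (Z : 0 <= w * C * Q * (5 * 2 ^ q * wt q m)).
  { apply Rmult_le_pos; [apply Rmult_le_pos; [nra|auto]|]. apply Rmult_le_pos; [nra|lra]. }
  apply Rle_trans with (2 / w * wt 1 m * (w * C * Q * (5 * 2 ^ q * wt q m))).
  { apply Rmult_le_compat_r; [auto|apply inv_kw_wt; auto]. }
  replace (S q) with (1 + q)%nat by lia. rewrite wt_mult. right. field. lra.
Qed.

Lemma fser_cos_deriv x s : ell x -> seg L s ->
  deriv_in (seg L) (fun s => cos (fser 0 x s)) s (- sin (fser 0 x s) * fser 1 x s).
Proof.
  intros Hx Hs. apply (deriv_in_comp _ (fser 0 x) cos); [|apply cos_is_derive].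
  apply fser_deriv; auto. apply ell_1; auto.
Qed.

Lemma fser_sin_deriv x s : ell x -> seg L s ->
  deriv_in (seg L) (fun s => sin (fser 0 x s)) s (cos (fser 0 x s) * fser 1 x s).
Proof.
  intros Hx Hs. apply (deriv_in_comp _ (fser 0 x) sin); [|apply sin_is_derive].
  apply fser_deriv; auto. apply ell_1; auto.
Qed.

Lemma fser_0_cseg x : ell x -> cseg L (fser 0 x).
Proof. intros H. apply fser_cseg; auto. apply ell_0; auto. Qed.

Lemma fser_1_cseg x : ell x -> cseg L (fser 1 x).
Proof. intros H. apply fser_cseg; auto. apply ell_1; auto. Qed.

Definition tangent_decay (x : nat -> R) (K : R) (q : nat) : Prop :=
  forall k, Rabs (Int (fun s => cos (fser 0 x s) * cosw L k s)) <= K * wt q k /\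
            Rabs (Int (fun s => sin (fser 0 x s) * cosw L k s)) <= K * wt q k.

(** Iterates [coef_gain] on the pair cos theta, sin theta. *)
Lemma tangent_bootstrap p C : (3 <= p)%nat -> 0 <= C -> forall q, (q <= p)%nat ->
  exists K, 0 <= K /\ forall x, ell x -> (forall j, Rabs (x (S j)) <= C * wt p (S j)) -> tangent_decay x K q.
Proof.
  intros Hp HC.
  assert (Triv : forall x k, ell x -> Rabs (Int (fun s => cos (fser 0 x s) * cosw L k s)) <= L /\
            Rabs (Int (fun s => sin (fser 0 x s) * cosw L k s)) <= L).
  { intros x k Hx. pose proof (fser_0_cseg x Hx).
    assert (B : forall f, cseg L f -> (forall s, seg L s -> Rabs (f s) <= 1) -> Rabs (Int f) <= L).
    { intros f Cf Hf. pose proof (Int_bound L HL f 1 Cf Hf). lra. }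
    split; apply B; auto with cseg; intros s _; rewrite Rabs_mult; pose proof (cosw_bound L k s);
      pose proof (Rabs_pos (cosw L k s)).
    - assert (Rabs (cos (fser 0 x s)) <= 1) by (apply Rabs_le, COS_bound). pose proof (Rabs_pos (cos (fser 0 x s))). nra.
    - assert (Rabs (sin (fser 0 x s)) <= 1) by (apply Rabs_le, SIN_bound). pose proof (Rabs_pos (sin (fser 0 x s))). nra. }
  induction q; intros Hq.
  - exists L. split; [lra|]. intros x Hx _ k. unfold wt. simpl. rewrite Rinv_1, Rmult_1_r. auto.
  - destruct (IHq ltac:(lia)) as [Q [HQ HK]].
    assert (H2 : 0 < 2 ^ q) by (apply pow_lt; lra).
    assert (HP : 0 <= 10 * 2 ^ q * Q * C) by (repeat apply Rmult_le_pos; lra).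
    exists (L + 10 * 2 ^ q * Q * C). split; [lra|]. intros x Hx Hd.
    pose proof (HK x Hx Hd) as HT. pose proof (fser_0_cseg x Hx) as C0.
    assert (Up : forall k, 10 * 2 ^ q * Q * C * wt (S q) (S k) <= (L + 10 * 2 ^ q * Q * C) * wt (S q) (S k)).
    { intros k. apply Rmult_le_compat_r; [left; apply wt_pos|lra]. }
    intros [|k].
    + assert (E : wt (S q) 0 = 1) by (unfold wt; simpl INR; rewrite Rplus_0_r, pow1; apply Rinv_1).
      rewrite E. destruct (Triv x O Hx). split; lra.
    + split; (eapply Rle_trans; [|apply Up]).
      * apply (coef_gain p q x C Q _ (fun s => - sin (fser 0 x s))); auto with cseg; try lia.
        -- intros s Hs. apply fser_cos_deriv; auto.
        -- intros j. rewrite (Int_ext L HL _ (fun s => - (sin (fser 0 x s) * cosw L j s))) by (intros; ring).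
           rewrite Int_opp, Rabs_Ropp by auto with cseg. exact (proj2 (HT j)).
      * apply (coef_gain p q x C Q _ (fun s => cos (fser 0 x s))); auto with cseg; try lia.
        -- intros s Hs. apply fser_sin_deriv; auto.
        -- intros j. exact (proj1 (HT j)).
Qed.

Variables Rc dc : R.
Hypothesis HRc : 0 <= Rc.
Hypothesis Hdc : 0 < dc.

Notation kap := (kap L Rc).
Notation lamc := (lamc L Rc dc).
Notation lams := (lams L Rc dc).
Notation forcing := (forcing L Rc dc).

Definition untruncated (x : nat -> R) : Prop := forall s, seg L s -> Rabs (fser 1 x s) <= Rc.

Lemma kap_id x s : untruncated x -> seg L s -> kap x s = fser 1 x s.
Proof. intros H Hs. unfold kap. apply clamp_id. apply Rabs_le_between, H; auto. Qed.

(** The function -<lambda, T^perp>. *)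
Definition normal_force (x : nat -> R) (s : R) : R :=
  lamc x * sin (fser 0 x s) - lams x * cos (fser 0 x s).

Lemma normal_force_cseg x : ell x -> cseg L (normal_force x).
Proof. intros H. pose proof (fser_0_cseg x H). unfold normal_force. auto with cseg. Qed.

(** Without truncation both formulas of [forcing] give cosine coefficients of the normal force. *)
Lemma forcing_coef x k : ell x -> untruncated x ->
  Int (fun s => normal_force x s * cosw L k s) = mass L k * forcing k x.
Proof.
  intros Hx Hu. pose proof (fser_0_cseg x Hx) as C0. pose proof (fser_1_cseg x Hx) as C1.
  pose proof (freq_pos L HL) as Hw.
  destruct k as [|k].
  - unfold forcing, mass, normal_force.
    rewrite (Int_ext L HL _ (fun s => - (- lamc x * sin (fser 0 x s) + lams x * cos (fser 0 x s)))).
    + rewrite Int_opp by auto with cseg. field. lra.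
    + intros s _. rewrite cosw_O. ring.
  - rewrite (cosw_by_parts k _ (fun s => (lamc x * cos (fser 0 x s) + lams x * sin (fser 0 x s)) * fser 1 x s)); auto with cseg.
    + unfold forcing, mass.
      rewrite (Int_ext L HL (fun s => _ * kap x s * _) (fun s => (lamc x * cos (fser 0 x s) + lams x * sin (fser 0 x s)) * fser 1 x s * sinw L (S k) s)).
      * rewrite S_INR. pose proof (pos_INR k). field. lra.
      * intros s Hs. rewrite kap_id; auto.
    + intros s Hs. unfold normal_force.
      apply (deriv_in_ext _ (fun s => lamc x * sin (fser 0 x s) + - lams x * cos (fser 0 x s))); auto.
      { intros; ring. }
      apply (deriv_in_eq _ _ _ (lamc x * (cos (fser 0 x s) * fser 1 x s) + - lams x * (- sin (fser 0 x s) * fser 1 x s))); [ring|].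
      apply deriv_in_plus; apply deriv_in_scal; [apply fser_sin_deriv|apply fser_cos_deriv]; auto.
Qed.

(** The forcing decays as fast as its argument, although it depends on it nonlinearly. *)
Lemma forcing_decay p C : (3 <= p)%nat -> 0 <= C -> exists K, 0 <= K /\
  forall x, ell x -> untruncated x -> (forall j, Rabs (x (S j)) <= C * wt p (S j)) ->
  forall k, Rabs (forcing (S k) x) <= K * wt p (S k).
Proof.
  intros Hp HC. destruct (tangent_bootstrap p C Hp HC p (le_n _)) as [Q [HQ HT]].
  destruct (lam_bounded L HL Rc dc HRc Hdc) as [B [HB HBl]].
  exists (4 / L * B * Q). split.
  { repeat apply Rmult_le_pos; try lra. left. apply Rinv_0_lt_compat; auto. }
  intros x Hx Hu Hd k. pose proof (fser_0_cseg x Hx) as C0.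
  pose proof (forcing_coef x (S k) Hx Hu) as E. unfold mass in E.
  assert (E2 : forcing (S k) x = 2 / L * Int (fun s => normal_force x s * cosw L (S k) s)).
  { rewrite E. field. lra. }
  rewrite E2. unfold normal_force.
  rewrite (Int_ext L HL _ (fun s => lamc x * (sin (fser 0 x s) * cosw L (S k) s) - lams x * (cos (fser 0 x s) * cosw L (S k) s)))
    by (intros; ring).
  rewrite Int_minus, !Int_scal by auto with cseg.
  destruct (HT x Hx Hd (S k)) as [Tc Ts]. destruct (HBl x Hx) as [Bc Bs].
  assert (0 < 2 / L) by (apply Rdiv_lt_0_compat; lra).
  rewrite Rabs_mult, (Rabs_right (2 / L)) by lra.
  replace (4 / L * B * Q * wt p (S k)) with (2 / L * (B * (Q * wt p (S k)) + B * (Q * wt p (S k)))) by (field; lra).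
  apply Rmult_le_compat_l; [lra|]. unfold Rminus. eapply Rle_trans; [apply Rabs_triang|].
  rewrite Rabs_Ropp, !Rabs_mult.
  apply Rplus_le_compat; apply Rmult_le_compat; auto; apply Rabs_pos.
Qed.

End Bootstrap.

(** * From the coefficient system to a classical solution *)

(** A solution of the truncated coefficient system, in Duhamel form, whose truncations are
    inactive on the time set [J]: there it solves the flow itself.  [J] is [0, t] while the
    truncation is being removed and the whole half-line afterwards. *)
Record flow_solution (L Rc dc : R) (alpha : nat -> R) (a : nat -> R -> R) (J : R -> Prop) : Prop := {
  sol_Rc : 0 <= Rc;
  sol_dc : 0 < dc;
  sol_rapid : rapid alpha;
  sol_ell : forall t, 0 <= t -> ell (fun k => a k t);
  sol_cont : forall k t, continuous (a k) t;
  sol_forcing_cont : forall k t, continuous (fun t => forcing L Rc dc k (fun j => a j (Rmax 0 t))) t;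
  sol_duhamel : forall k t, 0 <= t ->
    a k t = duh ((INR k * freq L) ^ 2) (alpha k) (fun t => forcing L Rc dc k (fun j => a j (Rmax 0 t))) t;
  sol_convex : convex_set J;
  sol_0 : J 0;
  sol_nonneg : forall t, J t -> 0 <= t;
  sol_untruncated : forall t, J t -> untruncated L Rc (fun k => a k t);
  sol_det : forall t, J t -> dc <= det L (fun k => a k t)
}.

Section Solution.
Variable L : R.
Hypothesis HL : 0 < L.
Notation w := (freq L).
Notation Int := (integ L).
Notation fser := (fser L).

Lemma fser_laplacian i x s : fser i (fun k => - (INR k * w) ^ 2 * x k) s = fser (S (S i)) x s.
Proof.
  apply Series_ext. intros k. unfold phase. rewrite !S_INR.
  replace (INR k * w * s + (INR i + 1 + 1) * (PI / 2)) with (INR k * w * s + INR i * (PI / 2) + PI) by field.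
  rewrite neg_cos. simpl. ring.
Qed.

Lemma inv_mu_wt k : / (INR (S k) * w) ^ 2 <= 4 / (w * w) * wt 2 (S k).
Proof.
  pose proof (freq_pos L HL). pose proof (inv_kw_wt L HL k) as H1.
  pose proof (Rinv_0_lt_compat _ (kw_S_pos L HL k)).
  replace (4 / (w * w) * wt 2 (S k)) with ((2 / w * wt 1 (S k)) ^ 2).
  - rewrite <- pow_inv. apply pow_incr. lra.
  - change 2%nat with (1 + 1)%nat at 2. rewrite wt_mult. field. lra.
Qed.

Variables Rc dc : R.
Notation lamc := (lamc L Rc dc).
Notation lams := (lams L Rc dc).
Notation forcing := (forcing L Rc dc).
Variable alpha : nat -> R.
Variable a : nat -> R -> R.
Variable J : R -> Prop.
Hypothesis Sol : flow_solution L Rc dc alpha a J.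

Let HRc := sol_Rc _ _ _ _ _ _ Sol.
Let Hdc := sol_dc _ _ _ _ _ _ Sol.
Let Halpha := sol_rapid _ _ _ _ _ _ Sol.
Let a_ell := sol_ell _ _ _ _ _ _ Sol.
Let a_cont := sol_cont _ _ _ _ _ _ Sol.
Let n_cont := sol_forcing_cont _ _ _ _ _ _ Sol.
Let a_duh := sol_duhamel _ _ _ _ _ _ Sol.
Let J_convex := sol_convex _ _ _ _ _ _ Sol.
Let J_0 := sol_0 _ _ _ _ _ _ Sol.
Let J_nonneg := sol_nonneg _ _ _ _ _ _ Sol.
Let J_untruncated := sol_untruncated _ _ _ _ _ _ Sol.
Let J_det := sol_det _ _ _ _ _ _ Sol.

Definition force (k : nat) (t : R) : R := forcing k (fun j => a j t).

(** The heat semigroup gains two powers of 1/k, uniformly in time. *)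
Lemma duh_gain p K t : 0 <= K -> 0 <= t ->
  (forall k r, 0 <= r <= t -> Rabs (force (S k) r) <= K * wt p (S k)) ->
  forall k, Rabs (a (S k) t) <= Rabs (alpha (S k)) + K * (4 / (w * w)) * wt (p + 2) (S k).
Proof.
  intros HK Ht Hf k. rewrite a_duh, duh_split by auto.
  assert (Hmu : 0 < (INR (S k) * w) ^ 2) by apply pow_lt, kw_S_pos, HL.
  eapply Rle_trans; [apply Rabs_triang|]. apply Rplus_le_compat.
  - rewrite Rabs_mult, (Rabs_right (exp _)) by (apply Rle_ge, Rlt_le, exp_pos).
    assert (exp (- (INR (S k) * w) ^ 2 * t) <= 1).
    { rewrite <- exp_0. apply exp_le. nra. }
    pose proof (Rabs_pos (alpha (S k))). nra.
  - assert (Hb := duh_bound ((INR (S k) * w) ^ 2) (fun t => forcing (S k) (fun j => a j (Rmax 0 t)))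
       (K * wt p (S k)) 0 t).
    rewrite Rmult_0_l, exp_0, Rmult_1_r, Rplus_0_r in Hb.
    eapply Rle_trans; [apply Hb; auto|].
    + apply Rmult_le_pos; [auto|left; apply wt_pos].
    + intros r Hr. rewrite Rmult_0_l, exp_0, Rmult_1_r, Rmax_right by lra. apply (Hf k r Hr).
    + rewrite wt_mult. unfold Rdiv at 1.
      replace (K * (4 / (w * w)) * (wt p (S k) * wt 2 (S k))) with (K * wt p (S k) * (4 / (w * w) * wt 2 (S k))) by ring.
      apply Rmult_le_compat_l; [|apply inv_mu_wt]. apply Rmult_le_pos; [auto|left; apply wt_pos].
Qed.

Lemma initial_decay : exists C, 0 <= C /\ forall k t, 0 <= t -> Rabs (a (S k) t) <= C * wt 3 (S k).
Proof.
  destruct (forcing_bl L HL Rc dc HRc Hdc) as [B [HB [Hb _]]].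
  destruct (Halpha 3%nat) as [A HA].
  pose proof (freq_pos L HL) as Hw. assert (0 < w * w) by (apply Rmult_lt_0_compat; auto).
  assert (H4 : 0 < 4 / (w * w)) by (apply Rdiv_lt_0_compat; lra).
  exists (Rabs A + B * (4 / (w * w))). split.
  { pose proof (Rabs_pos A). nra. }
  intros k t Ht. rewrite Rmult_plus_distr_r.
  eapply Rle_trans; [apply (duh_gain 1 B t HB Ht)|].
  - intros j r Hr. unfold force. eapply Rle_trans; [apply Hb, a_ell; lra|].
    unfold wt. rewrite pow_1. right. reflexivity.
  - apply Rplus_le_compat; [|apply Rle_refl].
    eapply Rle_trans; [apply HA|]. apply Rmult_le_compat_r; [left; apply wt_pos|apply Rle_abs].
Qed.

(** Bootstrap: [forcing_decay] keeps the rate of decay and [duh_gain] raises it by two. *)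
Lemma a_rapid : rapid_on J a.
Proof.
  assert (H : forall m, exists C, 0 <= C /\ forall k t, J t -> Rabs (a (S k) t) <= C * wt (3 + m) (S k)).
  { induction m as [|m [C [HC Hm]]].
    - destruct initial_decay as [C [HC H]]. exists C. split; auto.
    - destruct (forcing_decay L HL Rc dc HRc Hdc (3 + m) C ltac:(lia) HC) as [K [HK HF]].
      destruct (Halpha (3 + S m)%nat) as [A HA].
      pose proof (freq_pos L HL) as Hw. assert (0 < w * w) by (apply Rmult_lt_0_compat; auto).
      assert (H4 : 0 < 4 / (w * w)) by (apply Rdiv_lt_0_compat; lra).
      exists (Rabs A + K * (4 / (w * w))). split; [pose proof (Rabs_pos A); nra|].
      intros k t Ht. rewrite Rmult_plus_distr_r.
      eapply Rle_trans; [apply (duh_gain (3 + m) K t HK (J_nonneg t Ht))|].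
      + intros j r Hr. assert (Jr : J r) by (apply (J_convex 0 t); auto).
        apply HF; auto.
      + apply Rplus_le_compat.
        * eapply Rle_trans; [apply HA|]. apply Rmult_le_compat_r; [left; apply wt_pos|apply Rle_abs].
        * apply Rmult_le_compat_l; [nra|]. apply wt_anti. lia. }
  intros p. destruct (H p) as [C [HC Hp]]. exists C. intros k t Ht.
  eapply Rle_trans; [apply Hp; auto|]. apply Rmult_le_compat_l; auto. apply wt_anti. lia.
Qed.

Lemma force_rapid : rapid_on J force.
Proof.
  intros p. destruct (a_rapid (3 + p)%nat) as [C HC].
  destruct (forcing_decay L HL Rc dc HRc Hdc (3 + p) (Rabs C) ltac:(lia) (Rabs_pos C)) as [K [HK HF]].
  exists K. intros k t Ht. eapply Rle_trans.
  - apply HF; [apply a_ell, J_nonneg; auto|auto|].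
    intros j. eapply Rle_trans; [apply HC; auto|]. apply Rmult_le_compat_r; [left; apply wt_pos|apply Rle_abs].
  - apply Rmult_le_compat_l; auto. apply wt_anti. lia.
Qed.

Lemma a_flim k t : J t -> flim (within J (locally t)) (a k) (a k t).
Proof. intros _. apply within_flim, a_cont. Qed.

Lemma force_flim k t : J t -> flim (within J (locally t)) (force k) (force k t).
Proof.
  intros Ht. assert (H := within_flim J _ t _ (n_cont k t)).
  rewrite Rmax_right in H by (apply J_nonneg; auto).
  eapply filterlim_within_ext; [|exact H]. intros r Hr. simpl.
  rewrite Rmax_right by (apply J_nonneg; auto). reflexivity.
Qed.

Lemma a_deriv k t : J t -> deriv_in J (a k) t (- (INR k * w) ^ 2 * a k t + force k t).
Proof.
  intros Ht. pose proof (J_nonneg t Ht) as H0.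
  eapply deriv_in_ext; [exact Ht| |apply is_derive_deriv_in].
  - intros r Hr. symmetry. apply a_duh, J_nonneg; auto.
  - pose proof (duh_is_derive ((INR k * w) ^ 2) (alpha k) _ t (n_cont k)) as H.
    rewrite <- a_duh, Rmax_right in H by auto. exact H.
Qed.

(** Space derivatives of the angle and of the sum of the forcing modes. *)
Definition ang (i : nat) (s t : R) : R := fser i (fun k => a k t) s.
Definition frc (i : nat) (s t : R) : R := fser i (fun k => force k t) s.

Lemma ang_ds i : ds_rel L J (ang i) (ang (S i)).
Proof. apply (fser_ds_rel L HL J a), a_rapid. Qed.

Lemma frc_ds i : ds_rel L J (frc i) (frc (S i)).
Proof. apply (fser_ds_rel L HL J force), force_rapid. Qed.

Lemma ang_dt i : dt_rel L J (ang i) (fun s t => ang (S (S i)) s t + frc i s t).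
Proof.
  assert (Rlap : rapid_on J (fun k t => - (INR k * w) ^ 2 * a k t)).
  { intros p. destruct (a_rapid (p + 2)%nat) as [C HC].
    exists (w * w * Rabs C). intros k t Ht. specialize (HC k t Ht).
    pose proof (freq_pos L HL) as Hw. pose proof (pos_INR (S k)).
    rewrite Rabs_mult, Rabs_Ropp, Rabs_right by (apply Rle_ge, pow2_ge_0).
    rewrite wt_mult in HC.
    apply Rle_trans with ((INR (S k) * w) ^ 2 * (Rabs C * (wt p (S k) * wt 2 (S k)))).
    - apply Rmult_le_compat_l; [apply pow2_ge_0|]. eapply Rle_trans; [apply HC|].
      apply Rmult_le_compat_r; [|apply Rle_abs]. apply Rmult_le_pos; left; apply wt_pos.
    - replace ((INR (S k) * w) ^ 2 * (Rabs C * (wt p (S k) * wt 2 (S k))))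
        with (w * w * Rabs C * wt p (S k) * (INR (S k) ^ 2 * wt 2 (S k))) by ring.
      assert (INR (S k) ^ 2 * wt 2 (S k) <= 1).
      { unfold wt. apply Rmult_le_reg_r with ((1 + INR (S k)) ^ 2); [apply pow_lt; lra|].
        rewrite Rmult_assoc, Rinv_l; [nra|]. apply pow_nonzero. lra. }
      assert (0 <= w * w * Rabs C * wt p (S k)).
      { pose proof (Rabs_pos C). pose proof (wt_pos p (S k)).
        apply Rmult_le_pos; [|lra]. apply Rmult_le_pos; [nra|auto]. }
      nra. }
  intros s t Hs Ht.
  assert (Ex : forall x, rapid_on J x -> ex_series (fun k => Rabs (x k t) * (INR k * w) ^ i)).
  { intros x Hx. apply (rapid_ex L HL (fun k => x k t)). apply (rapid_on_rapid J x); auto. }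
  apply (deriv_in_eq _ _ _ (fser i (fun k => - (INR k * w) ^ 2 * a k t + force k t) s)).
  - rewrite fser_plus.
    + rewrite fser_laplacian. reflexivity.
    + exact HL.
    + apply (Ex (fun k t => - (INR k * w) ^ 2 * a k t)); auto.
    + apply (Ex force), force_rapid.
  - apply (fser_dt_rel L HL J a (fun k t => - (INR k * w) ^ 2 * a k t + force k t) i); auto.
    + apply a_rapid.
    + intros p. destruct (Rlap p) as [C HC]. destruct (force_rapid p) as [D HD].
      exists (C + D). intros k r Hr. rewrite Rmult_plus_distr_r.
      eapply Rle_trans; [apply Rabs_triang|]. apply Rplus_le_compat; auto.
    + intros k r Hr. apply a_deriv; auto.
Qed.

(** Fourier inversion identifies the sum of the forcing modes. *)
Lemma frc_0 s t : seg L s -> J t -> frc 0 s t = normal_force L Rc dc (fun k => a k t) s.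
Proof.
  intros Hs Ht. unfold frc. rewrite fser_0.
  destruct (rapid_on_dom L HL J force 0 force_rapid) as [M [HM HD]].
  assert (Hell : ell (fun k => a k t)) by (apply a_ell, J_nonneg; auto).
  symmetry. apply (cos_series_repr L HL _ (fun k => force k t) M); auto.
  - apply normal_force_cseg; auto.
  - intros j. specialize (HD j t Ht). rewrite pow_O, Rmult_1_r in HD. exact HD.
  - intros k. apply forcing_coef; auto.
Qed.

Lemma ang_cstrip i : cstrip L J (ang i).
Proof. apply (fser_cstrip L HL J a i a_rapid), a_flim. Qed.

Lemma frc_cstrip i : cstrip L J (frc i).
Proof. apply (fser_cstrip L HL J force i force_rapid), force_flim. Qed.

Definition tcos (s t : R) : R := cos (ang 0 s t).
Definition tsin (s t : R) : R := sin (ang 0 s t).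

(** The multiplier is a rational function of integrals over the segment. *)
Lemma lam_reg m k : (forall m i, strip_reg L J m k (ang i)) ->
  strip_reg L J m k (fun _ t => lamc (fun j => a j t)) /\
  strip_reg L J m k (fun _ t => lams (fun j => a j t)).
Proof.
  intros H.
  assert (Cc : strip_reg L J m k tcos) by (apply strip_reg_cos; auto).
  assert (Cs : strip_reg L J m k tsin) by (apply strip_reg_sin; auto).
  assert (I : forall F, strip_reg L J m k F -> strip_reg L J m k (fun _ t => Int (fun s => F s t))).
  { intros F HF. apply (strip_reg_integ L HL J m m k F); auto. }
  assert (Hss : strip_reg L J m k (fun _ t => mss L (fun j => a j t))).
  { apply (I (fun s t => tsin s t * tsin s t)). apply strip_reg_mult; auto. }
  assert (Hsc : strip_reg L J m k (fun _ t => msc L (fun j => a j t))).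
  { apply (I (fun s t => tsin s t * tcos s t)). apply strip_reg_mult; auto. }
  assert (Hcc : strip_reg L J m k (fun _ t => mcc L (fun j => a j t))).
  { apply (I (fun s t => tcos s t * tcos s t)). apply strip_reg_mult; auto. }
  assert (Kid : forall s t, seg L s -> J t -> kap L Rc (fun j => a j t) s = ang 1 s t).
  { intros s t Hs Ht. apply (kap_id L Rc); auto. }
  assert (Hvc : strip_reg L J m k (fun _ t => vc L Rc (fun j => a j t))).
  { apply (strip_reg_ext L J m k (fun _ t => Int (fun s => ang 1 s t * ang 1 s t * tcos s t))).
    - intros _ t _ Ht. unfold vc. apply Int_ext; auto. intros s Hs. rewrite Kid; auto.
    - apply I. apply (strip_reg_mult L J m k (fun s t => ang 1 s t * ang 1 s t)); auto. apply strip_reg_mult; auto. }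
  assert (Hvs : strip_reg L J m k (fun _ t => vs L Rc (fun j => a j t))).
  { apply (strip_reg_ext L J m k (fun _ t => Int (fun s => ang 1 s t * ang 1 s t * tsin s t))).
    - intros _ t _ Ht. unfold vs. apply Int_ext; auto. intros s Hs. rewrite Kid; auto.
    - apply I. apply (strip_reg_mult L J m k (fun s t => ang 1 s t * ang 1 s t)); auto. apply strip_reg_mult; auto. }
  assert (Hdet : strip_reg L J m k (fun _ t => det L (fun j => a j t))).
  { apply strip_reg_minus; apply strip_reg_mult; auto. }
  assert (Hinv : strip_reg L J m k (fun _ t => / Rmax (det L (fun j => a j t)) dc)).
  { apply (strip_reg_ext L J m k (fun _ t => / det L (fun j => a j t))).
    - intros _ t _ Ht. rewrite Rmax_left; auto.
    - apply (strip_reg_inv L J m k (fun _ t => det L (fun j => a j t))); auto.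
      intros _ t _ Ht. specialize (J_det t Ht). lra. }
  split.
  - apply (strip_reg_mult L J m k (fun _ t => vc L Rc (fun j => a j t) * mcc L (fun j => a j t)
      + vs L Rc (fun j => a j t) * msc L (fun j => a j t))); auto.
    apply strip_reg_plus; apply strip_reg_mult; auto.
  - apply (strip_reg_mult L J m k (fun _ t => vc L Rc (fun j => a j t) * msc L (fun j => a j t)
      + vs L Rc (fun j => a j t) * mss L (fun j => a j t))); auto.
    apply strip_reg_plus; apply strip_reg_mult; auto.
Qed.

Lemma frc_reg k : (forall m i, strip_reg L J m k (ang i)) -> forall i m, strip_reg L J m k (frc i).
Proof.
  intros H. induction i; intros m.
  - apply (strip_reg_ext L J m k (fun s t => lamc (fun j => a j t) * tsin s t - lams (fun j => a j t) * tcos s t)).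
    + intros s t Hs Ht. rewrite frc_0 by auto. reflexivity.
    + destruct (lam_reg m k H) as [H1 H2].
      apply strip_reg_minus; [apply (strip_reg_mult L J m k (fun s t => lamc (fun j => a j t)) tsin)|
         apply (strip_reg_mult L J m k (fun s t => lams (fun j => a j t)) tcos)]; auto.
      * apply strip_reg_sin; auto.
      * apply strip_reg_cos; auto.
  - apply (strip_reg_ds L HL J m k (frc i)); [apply IHi|apply frc_ds].
Qed.

(** Induction on the number of time derivatives: the equation trades one of them for two space
    derivatives, of which there are arbitrarily many. *)
Theorem ang_reg k : forall m i, strip_reg L J m k (ang i).
Proof.
  induction k as [|k IHk].
  - intros m i. apply (fser_strip_reg_s L HL J a a_rapid a_flim).
  - induction m as [|m IHm]; intros i; constructor; try apply ang_cstrip.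
    + intros; discriminate.
    + intros k' E. injection E as <-. exists (fun s t => ang (S (S i)) s t + frc i s t).
      split; [apply ang_dt|]. apply strip_reg_plus; [apply IHk|apply frc_reg; apply IHk].
    + intros m' E. injection E as <-. exists (ang (S i)). split; [apply ang_ds|apply IHm].
    + intros k' E. injection E as <-. exists (fun s t => ang (S (S i)) s t + frc i s t).
      split; [apply ang_dt|]. apply strip_reg_plus; [apply IHk|apply frc_reg; apply IHk].
Qed.

(** * Conservation of the constraint and decay of the bending energy *)

(** The time derivative of the angle. *)
Definition speed (s t : R) : R := ang 2 s t + frc 0 s t.

Lemma ang_cseg i t : J t -> cseg L (fun s => ang i s t).
Proof. intros Ht. apply (cstrip_slice L J (ang i)); auto. apply ang_cstrip. Qed.

Lemma frc_cseg i t : J t -> cseg L (fun s => frc i s t).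
Proof. intros Ht. apply (cstrip_slice L J (frc i)); auto. apply frc_cstrip. Qed.

(** The equation that determines lambda: the velocity preserves the integral of T. *)
Lemma speed_normal t : J t -> Int (fun s => speed s t * tsin s t) = 0 /\ Int (fun s => speed s t * tcos s t) = 0.
Proof.
  intros Ht. pose proof (J_det t Ht) as Hd.
  set (x := fun j => a j t) in *.
  assert (Hx : ell x) by (apply a_ell, J_nonneg; auto).
  pose proof (ang_cseg 0 t Ht) as C0. pose proof (ang_cseg 1 t Ht) as C1. pose proof (ang_cseg 2 t Ht) as C2.
  assert (Hvc : vc L Rc x = Int (fun s => ang 1 s t * ang 1 s t * tcos s t)).
  { apply Int_ext; auto. intros s Hs. rewrite (kap_id L Rc x s (J_untruncated t Ht) Hs). reflexivity. }
  assert (Hvs : vs L Rc x = Int (fun s => ang 1 s t * ang 1 s t * tsin s t)).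
  { apply Int_ext; auto. intros s Hs. rewrite (kap_id L Rc x s (J_untruncated t Ht) Hs). reflexivity. }
  assert (E1 : lamc x * mss L x - lams x * msc L x = vc L Rc x).
  { unfold lamc, lams. rewrite Rmax_left by auto. unfold det in *. field. lra. }
  assert (E2 : lamc x * msc L x - lams x * mcc L x = - vs L Rc x).
  { unfold lamc, lams. rewrite Rmax_left by auto. unfold det in *. field. lra. }
  assert (Z0 : ang 1 0 t = 0) by apply fser_1_0.
  assert (ZL : ang 1 L t = 0) by (apply fser_1_L; auto).
  assert (P1 : Int (fun s => ang 2 s t * tsin s t) = - vc L Rc x).
  { rewrite (Int_by_parts L HL (fun s => ang 1 s t) (fun s => tsin s t) (fun s => ang 2 s t)
      (fun s => tcos s t * ang 1 s t)); unfold tsin, tcos; auto with cseg.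
    - rewrite Z0, ZL, Hvc.
      rewrite (Int_ext L HL (fun x => _ * (_ * _)) (fun s => ang 1 s t * ang 1 s t * tcos s t)) by (intros; unfold tcos; ring). ring.
    - intros s Hs. apply (ang_ds 1); auto.
    - intros s Hs. apply (fser_sin_deriv L HL x s); auto. }
  assert (P2 : Int (fun s => ang 2 s t * tcos s t) = vs L Rc x).
  { rewrite (Int_by_parts L HL (fun s => ang 1 s t) (fun s => tcos s t) (fun s => ang 2 s t)
      (fun s => - tsin s t * ang 1 s t)); unfold tsin, tcos; auto with cseg.
    - rewrite Z0, ZL, Hvs.
      rewrite (Int_ext L HL (fun x => _ * (_ * _)) (fun s => - (ang 1 s t * ang 1 s t * tsin s t))) by (intros; unfold tsin; ring).
      rewrite Int_opp by (unfold tsin; auto with cseg). ring.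
    - intros s Hs. apply (ang_ds 1); auto.
    - intros s Hs. apply (fser_cos_deriv L HL x s); auto. }
  split.
  - rewrite (Int_ext L HL _ (fun s => ang 2 s t * tsin s t + (lamc x * (tsin s t * tsin s t) - lams x * (tsin s t * tcos s t)))).
    + rewrite Int_plus, Int_minus, !Int_scal, P1 by (unfold tsin, tcos; auto 10 with cseg).
      change (Int (fun s => tsin s t * tsin s t)) with (mss L x).
      change (Int (fun s => tsin s t * tcos s t)) with (msc L x). lra.
    + intros s Hs. unfold speed. rewrite frc_0 by auto. unfold normal_force, tsin, tcos, ang. fold x. ring.
  - rewrite (Int_ext L HL _ (fun s => ang 2 s t * tcos s t + (lamc x * (tsin s t * tcos s t) - lams x * (tcos s t * tcos s t)))).
    + rewrite Int_plus, Int_minus, !Int_scal, P2 by (unfold tsin, tcos; auto 10 with cseg).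
      change (Int (fun s => tcos s t * tcos s t)) with (mcc L x).
      change (Int (fun s => tsin s t * tcos s t)) with (msc L x). lra.
    + intros s Hs. unfold speed. rewrite frc_0 by auto. unfold normal_force, tsin, tcos, ang. fold x. ring.
Qed.

Definition energy (t : R) : R := Int (fun s => / 2 * (ang 1 s t * ang 1 s t)).
Definition dissipation (t : R) : R := Int (fun s => speed s t * speed s t).

Lemma speed_cseg t : J t -> cseg L (fun s => speed s t).
Proof. intros Ht. apply cseg_plus; [apply ang_cseg|apply frc_cseg]; auto. Qed.

(** Integrate by parts; the normal force is a combination of cos theta and sin theta, hence
    orthogonal to the velocity. *)
Lemma energy_deriv t : J t -> deriv_in J energy t (- dissipation t).
Proof.
  intros Ht.
  pose proof (speed_cseg t Ht) as CS. pose proof (ang_cseg 1 t Ht) as C1. pose proof (ang_cseg 2 t Ht) as C2.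
  pose proof (ang_cseg 3 t Ht) as C3. pose proof (frc_cseg 1 t Ht) as F1. pose proof (ang_cseg 0 t Ht) as C0.
  apply (deriv_in_eq _ _ _ (Int (fun s => (ang 3 s t + frc 1 s t) * ang 1 s t))).
  - rewrite (Int_by_parts L HL (fun s => speed s t) (fun s => ang 1 s t) (fun s => ang 3 s t + frc 1 s t) (fun s => ang 2 s t)); auto with cseg.
    + assert (Z0 : ang 1 0 t = 0) by apply fser_1_0.
      assert (ZL : ang 1 L t = 0) by (apply fser_1_L; auto).
      rewrite Z0, ZL. unfold dissipation.
      destruct (speed_normal t Ht) as [N1 N2].
      rewrite (Int_ext L HL (fun x => speed x t * ang 2 x t) (fun s => speed s t * speed s t -
         (lamc (fun j => a j t) * (speed s t * tsin s t) - lams (fun j => a j t) * (speed s t * tcos s t)))).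
      * rewrite !Int_minus, !Int_scal, N1, N2 by (unfold tsin, tcos; auto 10 with cseg). ring.
      * intros s Hs. assert (E : ang 2 s t = speed s t - frc 0 s t) by (unfold speed; ring).
        rewrite E, frc_0 by auto. unfold normal_force, tsin, tcos, ang. ring.
    + intros s Hs. apply deriv_in_plus; [apply (ang_ds 2)|apply (frc_ds 0)]; auto.
    + intros s Hs. apply (ang_ds 1); auto.
  - unfold energy.
    apply (deriv_in_eq _ _ _ (Int (fun s => / 2 * ((ang 3 s t + frc 1 s t) * ang 1 s t + ang 1 s t * (ang 3 s t + frc 1 s t))))).
    { apply Int_ext; auto. intros; field. }
    apply (integ_t_deriv L HL J (fun s t => / 2 * (ang 1 s t * ang 1 s t))
      (fun s t => / 2 * ((ang 3 s t + frc 1 s t) * ang 1 s t + ang 1 s t * (ang 3 s t + frc 1 s t)))); auto.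
    + apply (strip_reg_cstrip L J 0 0). apply strip_reg_scal, strip_reg_mult; apply ang_reg.
    + apply (strip_reg_cstrip L J 0 0). pose proof (ang_reg 0) as H. pose proof (frc_reg 0 H) as H'.
      apply strip_reg_scal, strip_reg_plus; apply strip_reg_mult; auto; apply strip_reg_plus; auto.
    + intros s r Hs Hr. apply deriv_in_scal.
      apply (deriv_in_mult J (fun y => ang 1 s y) (fun y => ang 1 s y)); apply (ang_dt 1); auto.
Qed.

Lemma dissipation_nonneg t : J t -> 0 <= dissipation t.
Proof.
  intros Ht. pose proof (speed_cseg t Ht). apply Int_nonneg; auto with cseg.
  intros s _. apply Rle_0_sqr.
Qed.

Lemma energy_decay r t : J r -> J t -> r <= t -> exists c, r <= c <= t /\ energy r - energy t = dissipation c * (t - r).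
Proof.
  intros Hr Ht Hrt.
  destruct (deriv_in_mvt J energy (fun t => - dissipation t) r t Hrt) as [c [Hc E]].
  - intros x Hx. apply (J_convex r t); auto.
  - intros x Hx. apply energy_deriv. apply (J_convex r t); auto.
  - exists c. split; auto. lra.
Qed.

Lemma energy_le t : J t -> energy t <= energy 0.
Proof.
  intros Ht. destruct (energy_decay 0 t J_0 Ht (J_nonneg t Ht)) as [c [Hc E]].
  assert (Jc : J c) by (apply (J_convex 0 t); auto).
  pose proof (dissipation_nonneg c Jc). pose proof (J_nonneg t Ht).
  assert (0 <= dissipation c * (t - 0)) by (apply Rmult_le_pos; lra). lra.
Qed.

Lemma constraint_conserved t : J t ->
  Int (fun s => tcos s t) = Int (fun s => tcos s 0) /\ Int (fun s => tsin s t) = Int (fun s => tsin s 0).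
Proof.
  intros Ht. pose proof (ang_reg 1 0 0) as H.
  assert (D : forall r, J r ->
    deriv_in J (fun t => Int (fun s => tcos s t)) r 0 /\ deriv_in J (fun t => Int (fun s => tsin s t)) r 0).
  { intros r Hr. destruct (speed_normal r Hr) as [N1 N2].
    pose proof (speed_cseg r Hr) as CS. pose proof (ang_cseg 0 r Hr) as C0.
    assert (CSp : strip_reg L J 0 0 speed).
    { apply strip_reg_plus; [apply ang_reg|apply frc_reg; intros; apply ang_reg]. }
    assert (A0 : strip_reg L J 0 0 (ang 0)) by apply ang_reg.
    split.
    - apply (deriv_in_eq _ _ _ (Int (fun s => - tsin s r * speed s r))).
      { rewrite (Int_ext L HL _ (fun s => - (speed s r * tsin s r))) by (intros; ring).
        rewrite Int_opp by (unfold tsin; auto with cseg). rewrite N1. ring. }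
      apply (integ_t_deriv L HL J tcos (fun s t => - tsin s t * speed s t)); auto.
      + apply (strip_reg_cstrip L J 0 0), strip_reg_cos; auto.
      + apply (strip_reg_cstrip L J 0 0), strip_reg_mult; auto. apply strip_reg_opp, strip_reg_sin; auto.
      + intros s y Hs Hy. apply (deriv_in_comp J (fun y => ang 0 s y) cos); [apply (ang_dt 0); auto|apply cos_is_derive].
    - apply (deriv_in_eq _ _ _ (Int (fun s => tcos s r * speed s r))).
      { rewrite (Int_ext L HL _ (fun s => speed s r * tcos s r)) by (intros; ring). exact N2. }
      apply (integ_t_deriv L HL J tsin (fun s t => tcos s t * speed s t)); auto.
      + apply (strip_reg_cstrip L J 0 0), strip_reg_sin; auto.
      + apply (strip_reg_cstrip L J 0 0), strip_reg_mult; auto. apply strip_reg_cos; auto.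
      + intros s y Hs Hy. apply (deriv_in_comp J (fun y => ang 0 s y) sin); [apply (ang_dt 0); auto|apply sin_is_derive]. }
  assert (HJ : forall x, 0 <= x <= t -> J x) by (intros x Hx; apply (J_convex 0 t); auto).
  split; [apply (deriv_in_zero J (fun t => Int (fun s => tcos s t)) 0 t)|
          apply (deriv_in_zero J (fun t => Int (fun s => tsin s t)) 0 t)]; auto;
    intros x Hx; apply D; auto.
Qed.

End Solution.

(** * Nondegeneracy of A_T and removal of the truncation *)

Section Nondegenerate.
Variable L : R.
Hypothesis HL : 0 < L.
Notation Int := (integ L).

Lemma Int_ge_sub (g : R -> R) u v m : cseg L g -> (forall s, seg L s -> 0 <= g s) ->
  0 <= u <= v -> v <= L -> (forall s, u <= s <= v -> m <= g s) -> m * (v - u) <= Int g.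
Proof.
  intros Cg Hg Hu Hv Hm.
  assert (MV : forall x y, 0 <= x <= y -> y <= L -> exists c, x <= c <= y /\
     RInt g 0 y - RInt g 0 x = g c * (y - x)).
  { intros x y Hx Hy. apply (deriv_in_mvt (seg L) (fun z => RInt g 0 z) g); [lra| |].
    - intros z Hz. split; lra.
    - intros z Hz. apply RInt_deriv_in; auto. split; lra. }
  destruct (MV 0 u) as [c1 [Hc1 E1]]; [lra|lra|].
  destruct (MV u v) as [c2 [Hc2 E2]]; [lra|lra|].
  destruct (MV v L) as [c3 [Hc3 E3]]; [lra|lra|].
  rewrite (RInt_point (V := R_CompleteNormedModule) 0 g) in E1. unfold zero in E1; simpl in E1.
  assert (0 <= g c1 * (u - 0)) by (apply Rmult_le_pos; [apply Hg; split; lra|lra]).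
  assert (0 <= g c3 * (L - v)) by (apply Rmult_le_pos; [apply Hg; split; lra|lra]).
  assert (m * (v - u) <= g c2 * (v - u)) by (apply Rmult_le_compat_r; [lra|auto]).
  unfold integ. lra.
Qed.

(** Young's inequality |th'| <= (eta + th'^2/eta)/2; a large [eta] makes the energy term small. *)
Lemma angle_oscillation (th th' : R -> R) (E eta : R) : 0 < eta ->
  (forall s, seg L s -> deriv_in (seg L) th s (th' s)) -> cseg L th' ->
  Int (fun s => / 2 * (th' s * th' s)) <= E ->
  forall x y, seg L x -> seg L y -> Rabs (th x - th y) <= eta / 2 * Rabs (x - y) + E / eta.
Proof.
  intros Heta Hth Cth HE.
  assert (W : forall x y, seg L x -> seg L y -> x <= y -> Rabs (th y - th x) <= eta / 2 * (y - x) + E / eta).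
  { intros x y Hx Hy Hxy.
    set (e := fun s => / 2 * (th' s * th' s)).
    assert (Ce : cseg L e) by (unfold e; auto with cseg).
    assert (He : forall s, 0 <= e s) by (intros s; unfold e; pose proof (Rle_0_sqr (th' s)); unfold Rsqr in *; lra).
    assert (Eint : RInt e 0 y - RInt e 0 x <= E).
    { assert (Mo : forall x y, seg L x -> seg L y -> x <= y -> RInt e 0 x <= RInt e 0 y).
      { intros u v Hu Hv Huv. destruct (deriv_in_mvt (seg L) (fun z => RInt e 0 z) e u v Huv) as [c [Hc Ec]].
        - intros z Hz. destruct Hu, Hv; split; lra.
        - intros z Hz. apply RInt_deriv_in; auto. destruct Hu, Hv; split; lra.
        - assert (0 <= e c * (v - u)) by (apply Rmult_le_pos; [auto|lra]). lra. }
      pose proof (Mo y L Hy (seg_L L HL) (proj2 Hy)) as M1.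
      pose proof (Mo 0 x (seg_0 L HL) Hx (proj1 Hx)) as M2.
      rewrite (RInt_point (V := R_CompleteNormedModule) 0 e) in M2. unfold zero in M2; simpl in M2.
      change (RInt e 0 L <= E) in HE. lra. }
    (* both (eta s + Psi/eta)/2 + th and (eta s + Psi/eta)/2 - th increase, where Psi is the
       integral of th'^2 *)
    assert (Mo : forall sg, (sg = 1 \/ sg = -1) ->
       0 <= (eta / 2 * y + / eta * RInt e 0 y + sg * th y) - (eta / 2 * x + / eta * RInt e 0 x + sg * th x)).
    { intros sg Hsg.
      destruct (deriv_in_mvt (seg L) (fun s => eta / 2 * s + / eta * RInt e 0 s + sg * th s)
        (fun s => eta / 2 * 1 + / eta * e s + sg * th' s) x y Hxy) as [c [Hc Ec]].
      - intros z Hz. destruct Hx, Hy; split; lra.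
      - intros z Hz. assert (seg L z) by (destruct Hx, Hy; split; lra).
        apply (deriv_in_plus _ (fun s => eta / 2 * s + / eta * RInt e 0 s)); [apply (deriv_in_plus _ (fun s => eta / 2 * s))|].
        + apply deriv_in_scal, deriv_in_id.
        + apply deriv_in_scal, RInt_deriv_in; auto.
        + apply deriv_in_scal; auto.
      - rewrite Ec. apply Rmult_le_pos; [|lra]. unfold e.
        apply Rmult_le_reg_l with (2 * eta); [lra|]. rewrite Rmult_0_r.
        replace (2 * eta * (eta / 2 * 1 + / eta * (/ 2 * (th' c * th' c)) + sg * th' c))
          with (eta * eta + th' c * th' c + 2 * sg * eta * th' c) by (field; lra).
        destruct Hsg as [-> | ->].
        + pose proof (Rle_0_sqr (eta + th' c)). unfold Rsqr in *. lra.
        + pose proof (Rle_0_sqr (eta - th' c)). unfold Rsqr in *. lra. }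
    pose proof (Mo 1 ltac:(auto)). pose proof (Mo (-1) ltac:(auto)).
    assert (/ eta * (RInt e 0 y - RInt e 0 x) <= E / eta).
    { unfold Rdiv. rewrite (Rmult_comm E). apply Rmult_le_compat_l; auto. left. apply Rinv_0_lt_compat; auto. }
    apply Rabs_le. lra. }
  intros x y Hx Hy. destruct (Rle_dec x y) as [H|H].
  - rewrite Rabs_minus_sym, (Rabs_minus_sym x y), (Rabs_right (y - x)) by lra. apply W; auto.
  - rewrite (Rabs_right (x - y)) by lra. apply W; auto. lra.
Qed.

(** The two terms come from the two cases of [form_lower_bound]. *)
Definition form_bound (D E : R) : R := Rmin (L - D) (/ 2 * Rmin (/ (8 * (E + 1))) (L / 2)).

Lemma form_bound_pos D E : D < L -> 0 <= E -> 0 < form_bound D E.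
Proof.
  intros HD HE. apply Rmin_glb_lt; [lra|]. apply Rmult_lt_0_compat; [lra|].
  apply Rmin_glb_lt; [apply Rinv_0_lt_compat|]; lra.
Qed.

(** Uniform lower bound for the quadratic form e |-> int <T^perp, e>^2.  Either <T, e> keeps its
    sign, and then the form is at least L - |int T|; or <T, e> vanishes somewhere and, by the energy
    bound, <T^perp, e> stays away from zero on an interval of definite length. *)
Lemma form_lower_bound (th th' : R -> R) (D E e1 e2 : R) : 0 <= D < L -> 0 <= E ->
  (forall s, seg L s -> deriv_in (seg L) th s (th' s)) -> cseg L th' ->
  Int (fun s => / 2 * (th' s * th' s)) <= E ->
  (Int (fun s => cos (th s))) ^ 2 + (Int (fun s => sin (th s))) ^ 2 <= D ^ 2 ->
  e1 ^ 2 + e2 ^ 2 = 1 ->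
  form_bound D E <= Int (fun s => (- sin (th s) * e1 + cos (th s) * e2) ^ 2).
Proof.
  intros HD HE Hth Cth HEn HX He.
  pose proof (cseg_deriv L th th' Hth) as C0.
  set (h := fun s => cos (th s) * e1 + sin (th s) * e2).
  set (g := fun s => (- sin (th s) * e1 + cos (th s) * e2) ^ 2).
  assert (Ch : cseg L h) by (unfold h; auto with cseg).
  assert (Cg : cseg L g) by (unfold g; auto 10 with cseg).
  assert (Egh : forall s, g s = 1 - h s ^ 2).
  { intros s. unfold g, h. pose proof (sin2_cos2 (th s)) as H. unfold Rsqr in H.
    transitivity ((e1 ^ 2 + e2 ^ 2) * (sin (th s) * sin (th s) + cos (th s) * cos (th s)) - (cos (th s) * e1 + sin (th s) * e2) ^ 2); [ring|].
    rewrite He, H. ring. }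
  assert (Hg : forall s, 0 <= g s) by (intros s; apply pow2_ge_0).
  assert (Hh : forall s, -1 <= h s <= 1).
  { intros s. specialize (Hg s). rewrite Egh in Hg. nra. }
  assert (IH : Rabs (Int h) <= D).
  { unfold h. rewrite (Int_ext L HL _ (fun s => e1 * cos (th s) + e2 * sin (th s))) by (intros; ring).
    rewrite Int_plus, !Int_scal by auto with cseg.
    set (X := Int (fun s => cos (th s))) in *. set (Y := Int (fun s => sin (th s))) in *.
    apply Rabs_le.
    assert ((e1 * X + e2 * Y) ^ 2 <= D ^ 2).
    { assert ((e1 * X + e2 * Y) ^ 2 + (e1 * Y - e2 * X) ^ 2 = (e1 ^ 2 + e2 ^ 2) * (X ^ 2 + Y ^ 2)) by ring.
      rewrite He in H. pose proof (pow2_ge_0 (e1 * Y - e2 * X)). lra. }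
    split; nra. }
  destruct (excluded_middle_informative (exists s, seg L s /\ h s = 0)) as [[s0 [Hs0 Z0]]|Hno].
  - unfold form_bound. set (rho := / (8 * (E + 1))). set (m := Rmin rho (L / 2)).
    eapply Rle_trans; [apply Rmin_r|].
    assert (Hrho : 0 < rho) by (apply Rinv_0_lt_compat; lra).
    assert (Hm : 0 < m) by (apply Rmin_glb_lt; lra).
    assert (Hm1 : m <= rho) by apply Rmin_l. assert (Hm2 : m <= L / 2) by apply Rmin_r.
    assert (Near : forall s, seg L s -> Rabs (s - s0) <= m -> / 2 <= g s).
    { intros s Hs Hss.
      assert (O := angle_oscillation th th' E (4 * (E + 1)) ltac:(lra) Hth Cth HEn s s0 Hs Hs0).
      assert (B1 : 4 * (E + 1) / 2 * Rabs (s - s0) <= / 4).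
      { apply Rle_trans with (4 * (E + 1) / 2 * rho); [apply Rmult_le_compat_l; lra|]. unfold rho. right. field. lra. }
      assert (B2 : E / (4 * (E + 1)) <= / 4).
      { apply Rmult_le_reg_r with (4 * (E + 1)); [lra|]. unfold Rdiv. rewrite Rmult_assoc, Rinv_l; lra. }
      set (u := th s - th s0) in *.
      assert (Hu : Rabs u <= / 2) by lra.
      assert (Hhs : Rabs (h s) <= Rabs u).
      { (* h s = <T(s0), e> cos u + <T^perp(s0), e> sin u, and the first product is zero *)
        assert (E1 : h s = sin u * (- sin (th s0) * e1 + cos (th s0) * e2)).
        { transitivity (cos u * h s0 + sin u * (- sin (th s0) * e1 + cos (th s0) * e2)); [|rewrite Z0; ring].
          unfold h. replace (th s) with (u + th s0) by (unfold u; ring). rewrite cos_plus, sin_plus. ring. }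
        rewrite E1, Rabs_mult.
        assert (Rabs (sin u) <= Rabs u).
        { pose proof (sin_lip u 0) as S1. rewrite sin_0, !Rminus_0_r in S1. exact S1. }
        assert (Rabs (- sin (th s0) * e1 + cos (th s0) * e2) <= 1).
        { pose proof (Egh s0) as Eg. rewrite Z0 in Eg. unfold g in Eg.
          apply Rabs_le. nra. }
        pose proof (Rabs_pos (sin u)). pose proof (Rabs_pos (- sin (th s0) * e1 + cos (th s0) * e2)). nra. }
      rewrite Egh, <- (pow2_abs (h s)). pose proof (Rabs_pos (h s)). nra. }
    destruct (Rle_dec s0 (L / 2)) as [Hl|Hl].
    + replace m with (s0 + m - s0) by ring. destruct Hs0. apply Int_ge_sub; auto; try lra.
      intros s Hs. apply Near; [split; lra|]. rewrite Rabs_right; lra.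
    + replace m with (s0 - (s0 - m)) by ring. destruct Hs0. apply Int_ge_sub; auto; try lra.
      intros s Hs. apply Near; [split; lra|]. rewrite Rabs_left1; lra.
  - unfold form_bound. eapply Rle_trans; [apply Rmin_l|].
    assert (Sign : forall x y, seg L x -> seg L y -> h x < 0 -> 0 < h y -> False).
    { intros x y Hx Hy Nx Py. apply Hno.
      destruct (IVT_gen (fun s => h (clamp 0 L s)) x y 0) as [z [Hz E0]].
      - intros s. apply continuity_pt_filterlim. apply (cseg_clamp L HL h Ch).
      - rewrite !clamp_id by auto. rewrite Rmin_left, Rmax_right by lra. lra.
      - exists (clamp 0 L z). split; [apply clamp_in; lra|exact E0]. }
    assert (H0 := seg_0 L HL).
    assert (I1 : Int (fun _ => 1) = L) by (rewrite Int_const; ring).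
    destruct (Rtotal_order (h 0) 0) as [N|[Z|P]].
    + apply Rle_trans with (Int (fun s => 1 + h s)).
      * rewrite Int_plus, I1 by auto with cseg. apply Rabs_le_between in IH. lra.
      * apply Int_le; auto with cseg. intros s Hs. change (1 + h s <= g s). rewrite Egh.
        assert (h s <= 0) by (apply Rnot_lt_le; intros Hp; apply (Sign 0 s); auto).
        specialize (Hh s). nra.
    + exfalso. apply Hno. exists 0. auto.
    + apply Rle_trans with (Int (fun s => 1 - h s)).
      * rewrite Int_minus, I1 by auto with cseg. apply Rabs_le_between in IH. lra.
      * apply Int_le; auto with cseg. intros s Hs. change (1 - h s <= g s). rewrite Egh.
        assert (0 <= h s) by (apply Rnot_lt_le; intros Hp; apply (Sign s 0); auto).
        specialize (Hh s). nra.
Qed.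

(** Use the form at e = (0, 1) and at the multiple of e = (C, B) of length 1, where it is
    proportional to the determinant. *)
Lemma det_lower_bound (th th' : R -> R) (D E : R) : 0 <= D < L -> 0 <= E ->
  (forall s, seg L s -> deriv_in (seg L) th s (th' s)) -> cseg L th' ->
  Int (fun s => / 2 * (th' s * th' s)) <= E ->
  (Int (fun s => cos (th s))) ^ 2 + (Int (fun s => sin (th s))) ^ 2 <= D ^ 2 ->
  form_bound D E ^ 2 <=
    Int (fun s => sin (th s) * sin (th s)) * Int (fun s => cos (th s) * cos (th s))
    - Int (fun s => sin (th s) * cos (th s)) * Int (fun s => sin (th s) * cos (th s)).
Proof.
  intros HD HE Hth Cth HEn HX.
  pose proof (cseg_deriv L th th' Hth) as C0.
  pose proof (form_bound_pos D E (proj2 HD) HE) as Hc. set (c := form_bound D E) in *.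
  set (A := Int (fun s => sin (th s) * sin (th s))). set (B := Int (fun s => sin (th s) * cos (th s))).
  set (C := Int (fun s => cos (th s) * cos (th s))).
  assert (Q : forall e1 e2, e1 ^ 2 + e2 ^ 2 = 1 -> c <= e1 ^ 2 * A - 2 * e1 * e2 * B + e2 ^ 2 * C).
  { intros e1 e2 He. pose proof (form_lower_bound th th' D E e1 e2 HD HE Hth Cth HEn HX He) as F.
    rewrite (Int_ext L HL _ (fun s => (e1 ^ 2 * (sin (th s) * sin (th s)) - 2 * e1 * e2 * (sin (th s) * cos (th s)))
       + e2 ^ 2 * (cos (th s) * cos (th s)))) in F by (intros; ring).
    rewrite Int_plus, Int_minus, !Int_scal in F by auto 10 with cseg. exact F. }
  assert (HC : c <= C).
  { pose proof (Q 0 1 ltac:(ring)). lra. }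
  set (n := sqrt (C ^ 2 + B ^ 2)).
  assert (Hn2 : n ^ 2 = C ^ 2 + B ^ 2).
  { unfold n. rewrite <- Rsqr_pow2, Rsqr_sqrt; auto. pose proof (pow2_ge_0 C). pose proof (pow2_ge_0 B). lra. }
  assert (Hn : 0 < n).
  { apply sqrt_lt_R0. pose proof (pow2_ge_0 B). assert (0 < C ^ 2) by (apply pow_lt; lra). lra. }
  assert (Q1 := Q (C / n) (B / n)).
  replace ((C / n) ^ 2 + (B / n) ^ 2) with ((C ^ 2 + B ^ 2) / n ^ 2) in Q1 by (field; lra).
  rewrite Hn2 in Q1. specialize (Q1 ltac:(field; rewrite <- Hn2; apply pow_nonzero; lra)).
  replace ((C / n) ^ 2 * A - 2 * (C / n) * (B / n) * B + (B / n) ^ 2 * C)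
    with (C * (A * C - B * B) / n ^ 2) in Q1 by (field; lra).
  assert (Q2 : c * n ^ 2 <= C * (A * C - B * B)).
  { apply Rmult_le_reg_r with (/ n ^ 2); [apply Rinv_0_lt_compat, pow_lt; auto|].
    rewrite Rmult_assoc, Rinv_r, Rmult_1_r by (apply pow_nonzero; lra). exact Q1. }
  rewrite Hn2 in Q2. pose proof (pow2_ge_0 B).
  assert (Q3 : c * C ^ 2 <= C * (A * C - B * B)) by nra.
  assert (Q4 : c * C <= A * C - B * B).
  { apply Rmult_le_reg_l with C; [lra|]. replace (C * (c * C)) with (c * C ^ 2) by ring. exact Q3. }
  nra.
Qed.

End Nondegenerate.

(** * Global existence *)

Lemma rapid_ell (x : nat -> R) : rapid x -> ell x.
Proof.
  intros H. destruct (H 3%nat) as [C HC].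
  apply (ex_series_dom _ (fun k => C * wt 2 k)); [|apply ex_series_scal_R, ex_series_wt2].
  intros k. pose proof (one_INR_pos (S k)).
  rewrite Rabs_right by (apply Rle_ge, Rmult_le_pos; [lra|apply Rabs_pos]).
  specialize (HC k). rewrite wt_S in HC.
  replace (C * wt 2 (S k)) with ((1 + INR (S k)) * (C * (wt 2 (S k) / (1 + INR (S k))))) by (field; lra).
  apply Rmult_le_compat_l; lra.
Qed.

Lemma real_induction (P : R -> Prop) : P 0 ->
  (forall t, 0 <= t -> (forall r, 0 <= r <= t -> P r) -> exists d, 0 < d /\ forall r, t <= r < t + d -> P r) ->
  (forall t, 0 < t -> (forall r, 0 <= r < t -> P r) -> P t) ->
  forall t, 0 <= t -> P t.
Proof.
  intros P0 Hopen Hclosed T HT. apply NNPP. intros HnT.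
  set (S := fun t => 0 <= t /\ forall r, 0 <= r <= t -> P r).
  assert (Hb : bound S).
  { exists T. intros t [Ht Hr]. apply Rnot_lt_le. intros Hlt. apply HnT, Hr. lra. }
  assert (H0 : S 0).
  { split; [lra|]. intros r Hr. replace r with 0 by lra. auto. }
  destruct (completeness S Hb (ex_intro _ 0 H0)) as [m [Hm1 Hm2]].
  assert (Hm : 0 <= m) by (apply Hm1; auto).
  assert (Hlt : forall r, 0 <= r < m -> P r).
  { intros r Hr. apply NNPP. intros Hn.
    assert (m <= r); [|lra]. apply Hm2. intros t [Ht Hall]. apply Rnot_lt_le. intros Hrt. apply Hn, Hall. lra. }
  assert (Hle : forall r, 0 <= r <= m -> P r).
  { intros r Hr. destruct (Rle_lt_or_eq_dec r m (proj2 Hr)) as [H| ->]; [apply Hlt; lra|].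
    destruct Hm as [Hm|Hm]; [apply Hclosed; auto|rewrite <- Hm; auto]. }
  destruct (Hopen m Hm Hle) as [d [Hd Hr]].
  assert (m + d / 2 <= m); [|lra]. apply Hm1. split; [lra|]. intros r Hr'.
  destruct (Rle_dec r m); [apply Hle; lra|apply Hr; lra].
Qed.

Section Global.
Variable L : R.
Hypothesis HL : 0 < L.
Notation w := (freq L).
Notation Int := (integ L).
Notation fser := (fser L).

Lemma fser_ext i (x y : nat -> R) s : (forall k, x k = y k) -> fser i x s = fser i y s.
Proof. intros H. apply Series_ext. intros k. rewrite H. reflexivity. Qed.

(** The bound is independent of the truncation level [Rc], which can therefore be chosen after
    it. *)
Lemma forcing_energy_bound Rc dc E x k : 0 < dc -> 0 <= E -> ell x -> untruncated L Rc x -> dc <= det L x ->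
  Int (fun s => / 2 * (fser 1 x s * fser 1 x s)) <= E ->
  Rabs (forcing L Rc dc (S k) x) <= 4 / (L * w) * (4 * E * L / dc * (L + 2 * E)) * wt 1 (S k).
Proof.
  intros Hdc HE Hx Hu Hd HEn.
  pose proof (freq_pos L HL) as Hw. pose proof (pos_INR k) as Hk.
  pose proof (fser_0_cseg L HL x Hx) as C0. pose proof (fser_1_cseg L HL x Hx) as C1.
  assert (Sq : Int (fun s => fser 1 x s * fser 1 x s) <= 2 * E).
  { rewrite Int_scal in HEn by auto with cseg. lra. }
  assert (U : forall f, cseg L f -> (forall s, Rabs (f s) <= 1) -> Rabs (Int f) <= L).
  { intros f Cf Hf. pose proof (Int_bound L HL f 1 Cf (fun s _ => Hf s)). lra. }
  assert (S1 : forall u, Rabs (sin u) <= 1) by (intros; apply Rabs_le, SIN_bound).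
  assert (C1' : forall u, Rabs (cos u) <= 1) by (intros; apply Rabs_le, COS_bound).
  assert (M : forall u v, Rabs u <= 1 -> Rabs v <= 1 -> Rabs (u * v) <= 1).
  { intros u v Hu' Hv. rewrite Rabs_mult. pose proof (Rabs_pos u). pose proof (Rabs_pos v). nra. }
  assert (Bss : Rabs (mss L x) <= L) by (apply U; auto with cseg).
  assert (Bsc : Rabs (msc L x) <= L) by (apply U; auto with cseg).
  assert (Bcc : Rabs (mcc L x) <= L) by (apply U; auto with cseg).
  assert (V : forall f, cseg L f -> (forall s, Rabs (f s) <= 1) ->
     Rabs (Int (fun s => kap L Rc x s * kap L Rc x s * f s)) <= 2 * E).
  { intros f Cf Hf.
    rewrite (Int_ext L HL _ (fun s => fser 1 x s * fser 1 x s * f s)).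
    - eapply Rle_trans; [|exact Sq]. apply Int_abs_le; auto with cseg. intros s Hs.
      pose proof (Rle_0_sqr (fser 1 x s)) as Hq. unfold Rsqr in Hq. rewrite Rabs_mult, Rabs_right by lra.
      specialize (Hf s). nra.
    - intros s Hs. rewrite (kap_id L Rc x s Hu Hs). reflexivity. }
  assert (Vc : Rabs (vc L Rc x) <= 2 * E) by (apply V; auto with cseg).
  assert (Vs : Rabs (vs L Rc x) <= 2 * E) by (apply V; auto with cseg).
  assert (Lam : forall p q, Rabs p <= L -> Rabs q <= L ->
     Rabs ((vc L Rc x * p + vs L Rc x * q) * / Rmax (det L x) dc) <= 4 * E * L / dc).
  { intros p q Hp Hq. rewrite Rmax_left by auto. unfold Rdiv. rewrite Rabs_mult.
    apply Rmult_le_compat; try apply Rabs_pos.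
    - eapply Rle_trans; [apply Rabs_triang|]. rewrite !Rabs_mult.
      assert (Rabs (vc L Rc x) * Rabs p <= 2 * E * L) by (apply Rmult_le_compat; auto; apply Rabs_pos).
      assert (Rabs (vs L Rc x) * Rabs q <= 2 * E * L) by (apply Rmult_le_compat; auto; apply Rabs_pos). lra.
    - rewrite Rabs_right; [apply Rinv_le_contravar; auto|]. apply Rle_ge, Rlt_le, Rinv_0_lt_compat. lra. }
  assert (Lc : Rabs (lamc L Rc dc x) <= 4 * E * L / dc) by (apply Lam; auto).
  assert (Ls : Rabs (lams L Rc dc x) <= 4 * E * L / dc) by (apply Lam; auto).
  set (B := 4 * E * L / dc) in *.
  assert (HB : 0 <= B) by (eapply Rle_trans; [apply Rabs_pos|exact Lc]).
  set (A := fun s => (lamc L Rc dc x * cos (fser 0 x s) + lams L Rc dc x * sin (fser 0 x s)) * fser 1 x s * sinw L (S k) s).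
  assert (HA : Rabs (Int A) <= B * (L + 2 * E)).
  { apply Rle_trans with (Int (fun s => B * (1 + fser 1 x s * fser 1 x s))).
    - apply Int_abs_le; auto with cseg.
      + unfold A. auto 10 with cseg.
      + intros s Hs. unfold A. rewrite !Rabs_mult.
        assert (Hl : Rabs (lamc L Rc dc x * cos (fser 0 x s) + lams L Rc dc x * sin (fser 0 x s)) <= 2 * B).
        { eapply Rle_trans; [apply Rabs_triang|]. rewrite !Rabs_mult.
          pose proof (S1 (fser 0 x s)). pose proof (C1' (fser 0 x s)).
          pose proof (Rabs_pos (sin (fser 0 x s))). pose proof (Rabs_pos (cos (fser 0 x s))).
          pose proof (Rabs_pos (lamc L Rc dc x)). pose proof (Rabs_pos (lams L Rc dc x)). nra. }
        pose proof (sinw_bound L (S k) s). pose proof (Rabs_pos (sinw L (S k) s)).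
        set (z := fser 1 x s) in *. pose proof (Rabs_pos z).
        assert (Hz : 2 * Rabs z <= 1 + z * z).
        { replace (z * z) with (Rabs z * Rabs z) by (rewrite <- Rabs_mult; apply Rabs_right; pose proof (Rle_0_sqr z); unfold Rsqr in *; lra).
          pose proof (Rle_0_sqr (Rabs z - 1)). unfold Rsqr in *. lra. }
        set (l := Rabs (lamc L Rc dc x * cos (fser 0 x s) + lams L Rc dc x * sin (fser 0 x s))) in *.
        apply Rle_trans with (2 * B * Rabs z * 1).
        * apply Rmult_le_compat; auto.
          -- apply Rmult_le_pos; auto. apply Rabs_pos.
          -- apply Rmult_le_compat_r; auto.
        * nra.
    - rewrite Int_scal, Int_plus, Int_const by auto with cseg.
      apply Rmult_le_compat_l; auto. lra. }
  unfold forcing. fold A.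
  rewrite (Int_ext L HL _ A).
  2:{ intros s Hs. unfold A. rewrite (kap_id L Rc x s Hu Hs). reflexivity. }
  pose proof (kw_S_pos L HL k) as Hkw. pose proof (inv_kw_wt L HL k) as Hinv.
  assert (H2L : 0 < 2 / L) by (apply Rdiv_lt_0_compat; lra).
  assert (Ik : 0 < / (INR (S k) * w)) by (apply Rinv_0_lt_compat; auto).
  replace (2 / (L * (INR (S k) * w))) with (2 / L * / (INR (S k) * w))
    by (unfold Rdiv; rewrite (Rinv_mult L); ring).
  replace (4 / (L * w) * (B * (L + 2 * E)) * wt 1 (S k))
    with (2 / L * (2 / w * wt 1 (S k)) * (B * (L + 2 * E))) by (field; lra).
  rewrite !Rabs_mult, Rabs_Ropp, Rabs_mult, (Rabs_right (2 / L)), (Rabs_right (/ _)) by lra.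
  apply Rmult_le_compat; auto; [apply Rmult_le_pos; lra|apply Rabs_pos|apply Rmult_le_compat_l; lra].
Qed.

Variable alpha : nat -> R.
Hypothesis Halpha : rapid alpha.
Hypothesis Hshort :
  (Int (fun s => cos (fser 0 alpha s))) ^ 2 + (Int (fun s => sin (fser 0 alpha s))) ^ 2 < L ^ 2.

(** The a priori estimate and the truncation are matched: as long as the truncation is inactive,
    the energy and the constraint give bounds strictly inside its thresholds, so it never acts. *)
Theorem global_solution : exists Rc dc a, flow_solution L Rc dc alpha a ray.
Proof.
  pose proof (freq_pos L HL) as Hw. assert (Hww : 0 < w * w) by (apply Rmult_lt_0_compat; auto).
  pose proof (rapid_ell alpha Halpha) as Ealpha.
  set (X := Int (fun s => cos (fser 0 alpha s))) in *. set (Y := Int (fun s => sin (fser 0 alpha s))) in *.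
  set (D := sqrt (X ^ 2 + Y ^ 2)).
  assert (HXY : 0 <= X ^ 2 + Y ^ 2) by (pose proof (pow2_ge_0 X); pose proof (pow2_ge_0 Y); lra).
  assert (HD2 : D ^ 2 = X ^ 2 + Y ^ 2) by (unfold D; rewrite <- Rsqr_pow2, Rsqr_sqrt; auto).
  assert (HD : 0 <= D < L).
  { pose proof (sqrt_pos (X ^ 2 + Y ^ 2)) as HD0. fold D in HD0. split; auto.
    apply Rnot_le_lt. intros Hle. assert (L ^ 2 <= D ^ 2) by (apply pow_incr; lra). lra. }
  set (E := Int (fun s => / 2 * (fser 1 alpha s * fser 1 alpha s))).
  assert (C1a := fser_1_cseg L HL alpha Ealpha).
  assert (HE : 0 <= E).
  { apply Int_nonneg; auto with cseg. intros s _. pose proof (Rle_0_sqr (fser 1 alpha s)). unfold Rsqr in *. lra. }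
  pose proof (form_bound_pos L HL D E (proj2 HD) HE) as Hfb.
  set (c0 := form_bound L D E ^ 2).
  assert (Hc0 : 0 < c0) by (apply pow_lt; auto).
  set (dc := c0 / 2). assert (Hdc : 0 < dc) by (unfold dc; lra).
  set (K := 4 / (L * w) * (4 * E * L / dc * (L + 2 * E))).
  assert (HK : 0 <= K).
  { unfold K. repeat apply Rmult_le_pos; try lra; left; apply Rinv_0_lt_compat; auto. apply Rmult_lt_0_compat; auto. }
  set (u := fun k => (Rabs (alpha k) + K * (4 / (w * w)) * wt 3 k) * (INR k * w)).
  assert (Hu : ex_series u).
  { apply (ex_series_le_R _ (fun k => Rabs (alpha k) * (INR k * w) ^ 1 + K * (4 / (w * w)) * w * wt 2 k)).
    - intros k. unfold u. pose proof (kw_nonneg L HL k). pose proof (Rabs_pos (alpha k)). pose proof (wt_pos 3 k).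
      assert (0 <= K * (4 / (w * w))) by (apply Rmult_le_pos; [auto|apply Rlt_le, Rdiv_lt_0_compat; lra]).
      assert (0 <= K * (4 / (w * w)) * wt 3 k) by (apply Rmult_le_pos; lra).
      rewrite Rabs_right by (apply Rle_ge, Rmult_le_pos; lra). rewrite pow_1, Rmult_plus_distr_r.
      apply Rplus_le_compat_l. pose proof (kw_wt L HL 1 k) as Hkw. rewrite !pow_1 in Hkw. simpl plus in Hkw.
      replace (K * (4 / (w * w)) * wt 3 k * (INR k * w)) with (K * (4 / (w * w)) * (INR k * w * wt 3 k)) by ring.
      rewrite (Rmult_assoc (K * (4 / (w * w))) w). apply Rmult_le_compat_l; auto.
    - apply ex_series_plus_R; [apply rapid_ex; auto|apply ex_series_scal_R, ex_series_wt2]. }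
  set (R0 := Series u).
  assert (HR0 : 0 <= R0).
  { unfold R0. replace 0 with (Series (fun _ : nat => 0 * 0)) by (rewrite Series_scal_l; ring).
    apply Series_le; auto. intros k. rewrite Rmult_0_l. split; [lra|]. unfold u.
    apply Rmult_le_pos; [|apply kw_nonneg; auto]. pose proof (Rabs_pos (alpha k)). pose proof (wt_pos 3 k).
    assert (0 <= K * (4 / (w * w)) * wt 3 k) by (apply Rmult_le_pos; [apply Rmult_le_pos; [auto|apply Rlt_le, Rdiv_lt_0_compat; lra]|lra]).
    lra. }
  set (Rc := R0 + 1). assert (HRc : 0 <= Rc) by (unfold Rc; lra).
  destruct (forcing_bl L HL Rc dc HRc Hdc) as [B [HB [FB FL]]].
  destruct (mild_solution w (forcing L Rc dc) B alpha Hw HB FB FL Ealpha) as [a [a_cont [n_cont [a_duh a_dom]]]].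
  assert (a_ell : forall t, 0 <= t -> ell (fun k => a k t)).
  { intros t Ht. destruct (a_dom t Ht) as [M [HM HM']]. apply (ell_dominated _ M); auto. intros k. apply HM'. lra. }
  assert (a_0 : forall k, a k 0 = alpha k) by (intros k; rewrite a_duh by lra; apply duh_0).
  set (good := fun t => untruncated L Rc (fun k => a k t) /\ dc <= det L (fun k => a k t)).
  set (strict := fun t => (forall s, seg L s -> Rabs (fser 1 (fun k => a k t) s) <= R0) /\ c0 <= det L (fun k => a k t)).
  assert (Hstrict : forall t, 0 <= t -> (forall r, 0 <= r <= t -> good r) -> strict t).
  { intros t Ht Hg. set (J := fun r => 0 <= r <= t).
    assert (Jc : convex_set J) by (intros x y z Hx Hy Hz; unfold J in *; lra).
    assert (J0 : J 0) by (unfold J; lra). assert (Jt : J t) by (unfold J; lra).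
    assert (Jp : forall r, J r -> 0 <= r) by (unfold J; intros; lra).
    assert (Ju : forall r, J r -> untruncated L Rc (fun k => a k r)) by (intros r Hr; apply Hg; auto).
    assert (Jd : forall r, J r -> dc <= det L (fun k => a k r)) by (intros r Hr; apply Hg; auto).
    assert (SJ : flow_solution L Rc dc alpha a J) by (constructor; auto).
    assert (En : forall r, J r -> Int (fun s => / 2 * (fser 1 (fun k => a k r) s * fser 1 (fun k => a k r) s)) <= E).
    { intros r Hr.
      eapply Rle_trans; [apply (energy_le L HL Rc dc alpha a J SJ r Hr)|].
      right. apply Int_ext; auto. intros s _. unfold ang. rewrite (fser_ext 1 (fun k => a k 0) alpha s a_0). reflexivity. }
    destruct (constraint_conserved L HL Rc dc alpha a J SJ t Jt) as [EX EY].
    split.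
    - intros s _.
      assert (HG := duh_gain L HL Rc dc alpha a J SJ 1 K t HK Ht).
      assert (HG' : forall k, Rabs (a (S k) t) <= Rabs (alpha (S k)) + K * (4 / (w * w)) * wt 3 (S k)).
      { apply HG. intros k r Hr. apply (forcing_energy_bound Rc dc E); auto. }
      eapply Rle_trans; [apply fser_bound; auto; apply ell_1, a_ell; auto|].
      apply Series_le; auto. intros [|k].
      + unfold u. simpl INR. rewrite !Rmult_0_l, pow_1, !Rmult_0_r. lra.
      + rewrite pow_1. pose proof (kw_nonneg L HL (S k)). split; [apply Rmult_le_pos; [apply Rabs_pos|auto]|].
        apply Rmult_le_compat_r; auto.
    - apply (det_lower_bound L HL (fun s => fser 0 (fun k => a k t) s) (fun s => fser 1 (fun k => a k t) s) D E); auto.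
      + intros s Hs. apply fser_deriv; auto. apply ell_1; auto.
      + apply fser_1_cseg; auto.
      + rewrite HD2.
        assert (EX' : Int (fun s => cos (fser 0 (fun k => a k t) s)) = X).
        { etransitivity; [exact EX|]. apply Int_ext; auto. intros s _. unfold tcos, ang. rewrite (fser_ext 0 (fun k => a k 0) alpha s a_0). reflexivity. }
        assert (EY' : Int (fun s => sin (fser 0 (fun k => a k t) s)) = Y).
        { etransitivity; [exact EY|]. apply Int_ext; auto. intros s _. unfold tsin, ang. rewrite (fser_ext 0 (fun k => a k 0) alpha s a_0). reflexivity. }
        rewrite EX', EY'. lra. }
  destruct (bl_det L HL) as [_ [Bd [HBd [_ Ld]]]].
  assert (Near : forall t0 eps, 0 <= t0 -> 0 < eps -> exists d, 0 < d /\ forall t, 0 <= t -> Rabs (t - t0) < d ->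
     (forall s, Rabs (fser 1 (fun k => a k t) s - fser 1 (fun k => a k t0) s) < eps) /\
     Rabs (det L (fun k => a k t) - det L (fun k => a k t0)) < eps).
  { intros t0 eps Ht0 Heps. destruct (a_dom (t0 + 1)) as [M [HM HM']]; [lra|].
    assert (Hd : flim (within (fun t => 0 <= t) (locally t0)) (fun t => dist (fun k => a k t) (fun k => a k t0)) 0).
    { apply (dist_flim (within (fun t => 0 <= t) (locally t0)) a (fun k => a k t0) M); auto.
      - exists (mkposreal 1 Rlt_0_1). intros y Hy Hy0 k. apply HM'.
        assert (Hy' : Rabs (y - t0) < 1) by exact Hy. apply Rabs_def2 in Hy'. lra.
      - intros k. apply HM'. lra.
      - intros k. apply within_flim, a_cont. }
    flim_unfold Hd.
    assert (Hm : 0 < eps / (w + Bd + 1)) by (apply Rdiv_lt_0_compat; lra).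
    destruct (Hd _ Hm) as [d Hd']. exists d. split; [apply cond_pos|]. intros t Ht Htt.
    specialize (Hd' t Htt Ht). rewrite Rminus_0_r in Hd'.
    pose proof (dist_nonneg _ _ (a_ell t Ht) (a_ell t0 Ht0)) as Hdn. rewrite Rabs_right in Hd' by lra.
    set (dd := dist (fun k => a k t) (fun k => a k t0)) in *.
    assert (Hdd : (w + Bd + 1) * dd < eps).
    { apply Rlt_le_trans with ((w + Bd + 1) * (eps / (w + Bd + 1))); [apply Rmult_lt_compat_l; lra|].
      right. field. lra. }
    assert (0 <= w * dd) by (apply Rmult_le_pos; lra). assert (0 <= Bd * dd) by (apply Rmult_le_pos; lra).
    split.
    - intros s. eapply Rle_lt_trans; [apply fser_1_lip; auto|]. fold dd. lra.
    - eapply Rle_lt_trans; [apply (Ld O 0 (fun k => a k t) (fun k => a k t0)); auto; apply seg_0; auto|]. fold dd. lra. }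
  assert (Open : forall t0 t, strict t0 -> (forall s, Rabs (fser 1 (fun k => a k t) s - fser 1 (fun k => a k t0) s) < Rmin 1 (c0 / 2)) ->
     Rabs (det L (fun k => a k t) - det L (fun k => a k t0)) < Rmin 1 (c0 / 2) -> good t).
  { intros t0 t [S1 S2] H1 H2. pose proof (Rmin_l 1 (c0 / 2)). pose proof (Rmin_r 1 (c0 / 2)). split.
    - intros s Hs. specialize (S1 s Hs). specialize (H1 s).
      pose proof (Rabs_triang_inv (fser 1 (fun k => a k t) s) (fser 1 (fun k => a k t0) s)). unfold Rc. lra.
    - unfold dc. apply Rabs_def2 in H2. lra. }
  assert (Hmin : 0 < Rmin 1 (c0 / 2)) by (apply Rmin_glb_lt; lra).
  assert (All : forall t, 0 <= t -> good t).
  { apply real_induction.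
    - split.
      + intros s Hs. rewrite (fser_ext 1 _ alpha s a_0).
        eapply Rle_trans; [apply fser_bound; auto; apply ell_1; auto|].
        apply Rle_trans with R0; [|unfold Rc; lra]. apply Series_le; auto. intros k. rewrite pow_1.
        pose proof (kw_nonneg L HL k). split; [apply Rmult_le_pos; [apply Rabs_pos|auto]|].
        unfold u. apply Rmult_le_compat_r; auto. pose proof (wt_pos 3 k).
        assert (0 <= K * (4 / (w * w)) * wt 3 k) by (apply Rmult_le_pos; [apply Rmult_le_pos; [auto|apply Rlt_le, Rdiv_lt_0_compat; lra]|lra]).
        lra.
      + apply Rle_trans with c0; [unfold dc; lra|].
        apply (det_lower_bound L HL (fun s => fser 0 (fun k => a k 0) s) (fun s => fser 1 (fun k => a k 0) s) D E); auto.
        * intros s Hs. apply fser_deriv; auto. apply ell_1, a_ell; lra.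
        * apply fser_1_cseg; auto. apply a_ell; lra.
        * right. apply Int_ext; auto. intros s _. rewrite (fser_ext 1 _ alpha s a_0). reflexivity.
        * rewrite HD2. right. f_equal; f_equal; apply Int_ext; auto; intros s _; rewrite (fser_ext 0 _ alpha s a_0); reflexivity.
    - intros t Ht Hg. destruct (Near t _ Ht Hmin) as [d [Hd Hn]]. exists d. split; auto. intros r Hr.
      destruct (Hn r) as [N1 N2]; [lra|rewrite Rabs_right; lra|].
      apply (Open t r); auto.
    - intros t Ht Hg. destruct (Near t _ (Rlt_le _ _ Ht) Hmin) as [d [Hd Hn]].
      set (r := Rmax 0 (t - d / 2)).
      assert (Hr : 0 <= r < t) by (unfold r, Rmax; destruct Rle_dec; lra).
      destruct (Hn r) as [N1 N2]; [lra| |].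
      { rewrite Rabs_left by lra. unfold r, Rmax. destruct Rle_dec; lra. }
      apply (Open r t).
      + apply Hstrict; [lra|]. intros r' Hr'. apply Hg. lra.
      + intros s. rewrite Rabs_minus_sym. apply N1.
      + rewrite Rabs_minus_sym. apply N2. }
  exists Rc, dc, a. constructor; auto.
  - apply ray_convex.
  - apply Rle_refl.
  - intros t Ht. apply All; auto.
  - intros t Ht. apply All; auto.
Qed.

End Global.

(** * Plane-valued functions *)

Lemma norm_R2 (u : R2) : norm u = sqrt (fst u ^ 2 + snd u ^ 2).
Proof.
  unfold norm; simpl. unfold prod_norm. unfold norm; simpl. unfold abs; simpl.
  f_equal. rewrite !Rmult_1_r, <- !Rabs_mult.
  rewrite !Rabs_right; auto; apply Rle_ge, Rle_0_sqr.
Qed.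

Lemma norm_R2_sq (u : R2) : norm u ^ 2 = fst u ^ 2 + snd u ^ 2.
Proof.
  rewrite norm_R2, <- Rsqr_pow2. apply Rsqr_sqrt.
  pose proof (pow2_ge_0 (fst u)). pose proof (pow2_ge_0 (snd u)). lra.
Qed.

Lemma norm_R2_le (u : R2) : norm u <= Rabs (fst u) + Rabs (snd u).
Proof.
  rewrite norm_R2. pose proof (Rabs_pos (fst u)). pose proof (Rabs_pos (snd u)).
  rewrite <- (sqrt_Rsqr (Rabs (fst u) + Rabs (snd u))) by lra.
  apply sqrt_le_1_alt. rewrite <- (pow2_abs (fst u)), <- (pow2_abs (snd u)). unfold Rsqr. nra.
Qed.

Lemma norm_R2_fst (u : R2) : Rabs (fst u) <= norm u.
Proof.
  rewrite norm_R2, <- sqrt_Rsqr_abs. apply sqrt_le_1_alt. unfold Rsqr.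
  pose proof (pow2_ge_0 (snd u)). lra.
Qed.

Lemma norm_R2_snd (u : R2) : Rabs (snd u) <= norm u.
Proof.
  rewrite norm_R2, <- sqrt_Rsqr_abs. apply sqrt_le_1_alt. unfold Rsqr.
  pose proof (pow2_ge_0 (fst u)). lra.
Qed.

Lemma fst_taylor (u v l : R2) (c : R) : fst (minus (minus u v) (scal c l) : R2) = fst u - fst v - fst l * c.
Proof.
  unfold minus, plus, opp, scal; simpl. unfold prod_plus, prod_opp, prod_scal; simpl.
  unfold plus, opp, scal; simpl. unfold mult; simpl. ring.
Qed.

Lemma snd_taylor (u v l : R2) (c : R) : snd (minus (minus u v) (scal c l) : R2) = snd u - snd v - snd l * c.
Proof.
  unfold minus, plus, opp, scal; simpl. unfold prod_plus, prod_opp, prod_scal; simpl.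
  unfold plus, opp, scal; simpl. unfold mult; simpl. ring.
Qed.

Lemma is_derive_in_R2_eps (D : R -> Prop) (g : R -> R2) (x : R) (l : R2) : D x ->
  is_derive_in D g x l <->
  forall eps, 0 < eps -> exists d, 0 < d /\ forall y, D y -> Rabs (y - x) < d ->
    norm (minus (minus (g y) (g x)) (scal (y - x) l) : R2) <= eps * Rabs (y - x).
Proof.
  intros Dx. split.
  - intros [_ H] eps He.
    assert (Hl : is_filter_lim (within D (locally x)) x).
    { intros P HP. unfold within. revert HP. apply filter_imp. auto. }
    destruct (H x Hl (mkposreal eps He)) as [d Hd].
    exists d; split; [apply cond_pos|]. intros y Dy Hy. exact (Hd y Hy Dy).
  - intros H. split; [apply (is_linear_scal_l (K := R_AbsRing) l)|].
    intros x' Hx'.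
    assert (x' = x).
    { apply eq_sym, (eq_close x x'). intros eps.
      assert (Hb : locally x' (fun y => ball x' eps y)) by (exists eps; auto).
      specialize (Hx' _ Hb). apply locally_singleton in Hx'. apply ball_sym. auto. }
    subst x'. intros eps.
    destruct (H eps (cond_pos eps)) as [d [Hd H']].
    exists (mkposreal d Hd). intros y Hy Dy. exact (H' y Dy Hy).
Qed.

Lemma is_derive_in_fst_snd (D : R -> Prop) (g : R -> R2) (x : R) (l : R2) : D x ->
  is_derive_in D g x l ->
  deriv_in D (fun y => fst (g y)) x (fst l) /\ deriv_in D (fun y => snd (g y)) x (snd l).
Proof.
  intros Dx H. rewrite is_derive_in_R2_eps in H by auto.
  split; apply deriv_in_eps; intros eps He; destruct (H eps He) as [d [Hd H']];
    exists d; split; auto; intros y Dy Hy; specialize (H' y Dy Hy);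
    (eapply Rle_trans; [|exact H']).
  - eapply Rle_trans; [|apply norm_R2_fst]. rewrite fst_taylor. apply Rle_refl.
  - eapply Rle_trans; [|apply norm_R2_snd]. rewrite snd_taylor. apply Rle_refl.
Qed.

Lemma is_derive_in_pair (D : R -> Prop) (g : R -> R2) (x l1 l2 : R) : D x ->
  deriv_in D (fun y => fst (g y)) x l1 -> deriv_in D (fun y => snd (g y)) x l2 ->
  is_derive_in D g x ((l1, l2) : R2).
Proof.
  intros Dx H1 H2. rewrite deriv_in_eps in H1, H2. apply is_derive_in_R2_eps; auto.
  intros eps He. destruct (H1 (eps / 2)) as [d1 [Hd1 P1]]; [lra|].
  destruct (H2 (eps / 2)) as [d2 [Hd2 P2]]; [lra|].
  exists (Rmin d1 d2). split; [apply Rmin_glb_lt; auto|]. intros y Dy Hy.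
  assert (A1 := P1 y Dy (Rlt_le_trans _ _ _ Hy (Rmin_l _ _))).
  assert (A2 := P2 y Dy (Rlt_le_trans _ _ _ Hy (Rmin_r _ _))).
  eapply Rle_trans; [apply norm_R2_le|].
  rewrite fst_taylor, snd_taylor. simpl fst at 3. simpl snd at 3. lra.
Qed.

Lemma Derive_in_eq (D : R -> Prop) (g : R -> R2) (x l1 l2 : R) : D x -> accum D x ->
  deriv_in D (fun y => fst (g y)) x l1 -> deriv_in D (fun y => snd (g y)) x l2 ->
  Derive_in D g x = (l1, l2).
Proof.
  intros Dx A H1 H2. unfold Derive_in. f_equal.
  - apply (iota_unique (V := R_CompleteNormedModule)).
    + intros y Hy. apply is_derive_in_deriv in Hy; auto. apply (deriv_in_unique D (fun y => fst (g y)) x); auto.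
    + apply is_derive_in_deriv; auto.
  - apply (iota_unique (V := R_CompleteNormedModule)).
    + intros y Hy. apply is_derive_in_deriv in Hy; auto. apply (deriv_in_unique D (fun y => snd (g y)) x); auto.
    + apply is_derive_in_deriv; auto.
Qed.

Lemma ex_derive_in_Derive (D : R -> Prop) (g : R -> R2) (x : R) : D x -> accum D x ->
  ex_derive_in D g x ->
  deriv_in D (fun y => fst (g y)) x (fst (Derive_in D g x)) /\
  deriv_in D (fun y => snd (g y)) x (snd (Derive_in D g x)).
Proof.
  intros Dx A [l Hl]. destruct (is_derive_in_fst_snd D g x l Dx Hl) as [H1 H2].
  rewrite (Derive_in_eq D g x _ _ Dx A H1 H2). auto.
Qed.

Lemma accum_ray t : ray t -> accum ray t.
Proof.
  intros Ht d Hd. unfold ray in *. exists (t + d / 2). repeat split; try lra. rewrite Rabs_right; lra.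
Qed.

Lemma cstrip_continuous_strip L (F : R -> R -> R2) :
  cstrip L ray (fun s t => fst (F s t)) -> cstrip L ray (fun s t => snd (F s t)) ->
  continuous_strip L F.
Proof.
  intros H1 H2 s t Hs Ht. apply (proj2 (filterlim_locally (U := prod_UniformSpace R_UniformSpace R_UniformSpace) _ _)).
  intros eps.
  pose proof (proj1 (filterlim_locally _ _) (H1 s t Hs Ht) eps) as A1.
  pose proof (proj1 (filterlim_locally _ _) (H2 s t Hs Ht) eps) as A2.
  generalize (filter_and _ _ A1 A2). apply filter_imp. intros p [P1 P2]. split; auto.
Qed.

Lemma strip_reg_Ck L (HL : 0 < L) n : forall m k F,
  (n <= m)%nat -> (n <= k)%nat ->
  strip_reg L ray m k (fun s t => fst (F s t)) -> strip_reg L ray m k (fun s t => snd (F s t)) ->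
  Ck_strip L n F.
Proof.
  induction n as [|n IH]; intros m k F Hm Hk H1 H2; (split; [apply cstrip_continuous_strip;
    [eapply strip_reg_cstrip; exact H1|eapply strip_reg_cstrip; exact H2]|]); auto.
  destruct m as [|m]; [lia|]. destruct k as [|k]; [lia|].
  destruct (strip_reg_s _ _ _ _ _ H1) as [Fs1 [Ds1 Rs1]]. destruct (strip_reg_s _ _ _ _ _ H2) as [Fs2 [Ds2 Rs2]].
  destruct (strip_reg_t _ _ _ _ _ H1) as [Ft1 [Dt1 Rt1]]. destruct (strip_reg_t _ _ _ _ _ H2) as [Ft2 [Dt2 Rt2]].
  assert (Es : forall s t, seg L s -> ray t -> Ds L F s t = (Fs1 s t, Fs2 s t)).
  { intros s t Hs Ht. apply Derive_in_eq; auto. apply accum_seg; auto. }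
  assert (Et : forall s t, seg L s -> ray t -> Dt F s t = (Ft1 s t, Ft2 s t)).
  { intros s t Hs Ht. apply Derive_in_eq; auto. apply accum_ray; auto. }
  split; [|split].
  - intros s t Hs Ht. split.
    + exists (Fs1 s t, Fs2 s t). apply is_derive_in_pair; auto.
    + exists (Ft1 s t, Ft2 s t). apply is_derive_in_pair; auto.
  - apply (IH m (S k)); try lia.
    + apply (strip_reg_ext L ray m (S k) Fs1); auto. intros s t Hs Ht. rewrite Es; auto.
    + apply (strip_reg_ext L ray m (S k) Fs2); auto. intros s t Hs Ht. rewrite Es; auto.
  - apply (IH (S m) k); try lia.
    + apply (strip_reg_ext L ray (S m) k Ft1); auto. intros s t Hs Ht. rewrite Et; auto.
    + apply (strip_reg_ext L ray (S m) k Ft2); auto. intros s t Hs Ht. rewrite Et; auto.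
Qed.

Section Angle.
Variable L : R.
Hypothesis HL : 0 < L.
Notation Int := (integ L).

Variable T : R -> R2.
Variables th th1 th2 : R -> R.
Hypothesis HT : forall s, seg L s -> T s = (cos (th s), sin (th s)).
Hypothesis Hth : forall s, seg L s -> deriv_in (seg L) th s (th1 s).
Hypothesis Hth1 : forall s, seg L s -> deriv_in (seg L) th1 s (th2 s).

Lemma tangent_Derive s : seg L s -> Derive_in (seg L) T s = (- sin (th s) * th1 s, cos (th s) * th1 s).
Proof.
  intros Hs. apply Derive_in_eq; auto; [apply accum_seg; auto| |].
  - apply (deriv_in_ext _ (fun y => cos (th y))); auto; [intros y Hy; rewrite HT; auto|].
    apply deriv_in_comp; auto. apply cos_is_derive.
  - apply (deriv_in_ext _ (fun y => sin (th y))); auto; [intros y Hy; rewrite HT; auto|].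
    apply deriv_in_comp; auto. apply sin_is_derive.
Qed.

Lemma tangent_norm s : seg L s -> norm (T s) = 1.
Proof.
  intros Hs. rewrite norm_R2, HT by auto. simpl fst; simpl snd.
  rewrite <- sqrt_1. f_equal. pose proof (sin2_cos2 (th s)) as H. unfold Rsqr in H. lra.
Qed.

Lemma nabla_tangent s : seg L s -> nabla_s L T T s = (- sin (th s) * th1 s, cos (th s) * th1 s).
Proof.
  intros Hs. unfold nabla_s. rewrite tangent_Derive, HT by auto.
  unfold dot, perp, scal; simpl. unfold prod_scal, scal; simpl. unfold mult; simpl.
  pose proof (sin2_cos2 (th s)) as H. unfold Rsqr in H.
  replace (- sin (th s) * th1 s * - sin (th s) + cos (th s) * th1 s * cos (th s))
    with ((sin (th s) * sin (th s) + cos (th s) * cos (th s)) * th1 s) by ring.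
  rewrite H. f_equal; ring.
Qed.

(** In terms of the angle the flow is a scalar heat equation. *)
Lemma flow_rhs_angle (l : R2) s : seg L s ->
  flow_rhs L T l s = (- sin (th s) * (th2 s + (fst l * sin (th s) - snd l * cos (th s))),
                      cos (th s) * (th2 s + (fst l * sin (th s) - snd l * cos (th s)))).
Proof.
  intros Hs. unfold flow_rhs.
  assert (E : nabla_s L T (nabla_s L T T) s = (- sin (th s) * th2 s, cos (th s) * th2 s)).
  { unfold nabla_s at 1.
    rewrite (Derive_in_eq (seg L) (nabla_s L T T) s
      (- (cos (th s) * th1 s) * th1 s + - sin (th s) * th2 s)
      (- sin (th s) * th1 s * th1 s + cos (th s) * th2 s)); auto; [|apply accum_seg; auto| |].
    - rewrite HT by auto. unfold dot, perp, scal; simpl. unfold prod_scal, scal; simpl. unfold mult; simpl.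
      pose proof (sin2_cos2 (th s)) as H. unfold Rsqr in H.
      replace ((- (cos (th s) * th1 s) * th1 s + - sin (th s) * th2 s) * - sin (th s) +
         (- sin (th s) * th1 s * th1 s + cos (th s) * th2 s) * cos (th s))
        with ((sin (th s) * sin (th s) + cos (th s) * cos (th s)) * th2 s) by ring.
      rewrite H. f_equal; ring.
    - apply (deriv_in_ext _ (fun y => - sin (th y) * th1 y)); auto.
      { intros y Hy. rewrite nabla_tangent; auto. }
      apply (deriv_in_mult _ (fun y => - sin (th y)) th1); auto.
      apply (deriv_in_ext _ (fun y => -1 * sin (th y))); auto; [intros; ring|].
      apply (deriv_in_eq _ _ _ (-1 * (cos (th s) * th1 s))); [ring|].
      apply deriv_in_scal. apply deriv_in_comp; auto. apply sin_is_derive.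
    - apply (deriv_in_ext _ (fun y => cos (th y) * th1 y)); auto.
      { intros y Hy. rewrite nabla_tangent; auto. }
      apply (deriv_in_mult _ (fun y => cos (th y)) th1); auto.
      apply deriv_in_comp; auto. apply cos_is_derive. }
  rewrite E, HT by auto. destruct l as [l1 l2].
  unfold dot, perp, minus, plus, opp, scal; simpl. unfold prod_plus, prod_opp, prod_scal, plus, opp, scal; simpl. unfold mult; simpl.
  f_equal; ring.
Qed.

Hypothesis Cth1 : cseg L th1.

(** A_T has rows (A, -B) and (-B, C), and its inverse is the adjugate over the determinant. *)
Lemma multiplier_angle (l1 l2 : R) :
  let A := Int (fun s => sin (th s) * sin (th s)) in
  let B := Int (fun s => sin (th s) * cos (th s)) in
  let C := Int (fun s => cos (th s) * cos (th s)) in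
  let vc := Int (fun s => th1 s * th1 s * cos (th s)) in
  let vs := Int (fun s => th1 s * th1 s * sin (th s)) in
  A * C - B * B <> 0 ->
  l1 = (vc * C + vs * B) / (A * C - B * B) -> l2 = (vc * B + vs * A) / (A * C - B * B) ->
  is_multiplier L T (l1, l2).
Proof.
  intros A B C vc vs Hdet El1 El2.
  set (d := A * C - B * B) in *.
  pose proof (cseg_deriv L th th1 Hth) as C0.
  assert (EA : A_mat L T = mk_matrix 2 2 (fun i j => match i, j with O, O => A | O, _ => - B | _, O => - B | _, _ => C end)).
  { unfold A_mat. apply mk_matrix_ext. intros i j Hi Hj.
    assert (Ent : forall s, seg L s -> coeff_mat 0 (Mmult (col (perp (T s))) (row (perp (T s)))) i j =
      match i, j with O, O => sin (th s) * sin (th s) | O, _ => - (sin (th s) * cos (th s))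
        | _, O => - (sin (th s) * cos (th s)) | _, _ => cos (th s) * cos (th s) end).
    { intros s Hs. rewrite HT by auto. unfold Mmult. rewrite coeff_mat_bij by lia.
      rewrite sum_O. destruct i as [|[|i]]; [| |lia]; destruct j as [|[|j]]; try lia;
        simpl; unfold coeff_mat; simpl; unfold mult; simpl; ring. }
    change (Int (fun s => coeff_mat 0 (Mmult (col (perp (T s))) (row (perp (T s)))) i j) =
      match i, j with O, O => A | O, _ => - B | _, O => - B | _, _ => C end).
    rewrite (Int_ext L HL _ _ Ent).
    destruct i as [|i]; destruct j as [|j]; try reflexivity; rewrite Int_opp; auto with cseg. }
  exists (mk_matrix 2 2 (fun i j => match i, j with O, O => C / d | O, _ => B / d | _, O => B / d | _, _ => A / d end)).
  rewrite EA. unfold Mmult, Mone.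
  split; [|split].
  - apply mk_matrix_ext. intros i j Hi Hj.
    destruct i as [|[|i]]; [| |lia]; destruct j as [|[|j]]; try lia;
      change (pred 2) with 1%nat; rewrite sum_Sn, sum_O; simpl; unfold coeff_mat; simpl; unfold plus, mult, one, zero; simpl; unfold d; field; exact Hdet.
  - apply mk_matrix_ext. intros i j Hi Hj.
    destruct i as [|[|i]]; [| |lia]; destruct j as [|[|j]]; try lia;
      change (pred 2) with 1%nat; rewrite sum_Sn, sum_O; simpl; unfold coeff_mat; simpl; unfold plus, mult, one, zero; simpl; unfold d; field; exact Hdet.
  - assert (EV : vint (fun s => scal (norm (Derive_in (seg L) T s) ^ 2) (T s)) 0 L = (vc, vs)).
    { unfold vint.
      assert (N : forall s, seg L s -> norm (Derive_in (seg L) T s) ^ 2 = th1 s * th1 s).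
      { intros s Hs. rewrite norm_R2_sq, tangent_Derive by auto. simpl fst; simpl snd.
        pose proof (sin2_cos2 (th s)) as H. unfold Rsqr in H.
        transitivity ((sin (th s) * sin (th s) + cos (th s) * cos (th s)) * (th1 s * th1 s)); [ring|]. rewrite H. ring. }
      f_equal.
      - apply Int_ext; auto. intros s Hs. rewrite N, HT by auto. reflexivity.
      - apply Int_ext; auto. intros s Hs. rewrite N, HT by auto. reflexivity. }
    rewrite EV. apply mk_matrix_ext. intros i j Hi Hj.
    destruct i as [|i]; [|lia]. destruct j as [|[|j]]; try lia;
      change (pred 2) with 1%nat; rewrite sum_Sn, sum_O; simpl; unfold coeff_mat; simpl; unfold plus, mult; simpl;
      [rewrite El1|rewrite El2]; field; exact Hdet.
Qed.

End Angle.

(** * The angle of the initial tangent and the decay of its Fourier coefficients *)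

Lemma angle_exists (x y : R) : x ^ 2 + y ^ 2 = 1 -> exists phi, Rabs phi <= PI /\ cos phi = x /\ sin phi = y.
Proof.
  intros H. assert (Hx : -1 <= x <= 1) by nra.
  assert (E : sin (acos x) = Rabs y).
  { rewrite sin_acos by auto. rewrite <- sqrt_Rsqr_abs. f_equal. unfold Rsqr. nra. }
  pose proof (acos_bound x) as Hb.
  destruct (Rle_dec 0 y) as [Hy|Hy].
  - exists (acos x). split; [apply Rabs_le; lra|].
    rewrite cos_acos by auto. rewrite E, Rabs_right; lra.
  - exists (- acos x). split; [apply Rabs_le; lra|].
    rewrite cos_neg, sin_neg, cos_acos by auto. rewrite E, Rabs_left; lra.
Qed.

Section Initial.
Variable L : R.
Hypothesis HL : 0 < L.
Notation w := (freq L).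
Notation Int := (integ L).

(** [m] times differentiable on the segment; with [flat = true] the function and these derivatives
    also vanish at both end points, so that integrations by parts leave no boundary terms. *)
Fixpoint seg_reg (flat : bool) (m : nat) (g : R -> R) : Prop :=
  cseg L g /\ (flat = true -> g 0 = 0 /\ g L = 0) /\
  match m with
  | O => True
  | S m' => exists g', (forall s, seg L s -> deriv_in (seg L) g s (g' s)) /\ seg_reg flat m' g'
  end.

Lemma seg_reg_cseg b m g : seg_reg b m g -> cseg L g.
Proof. destruct m; intros [H _]; auto. Qed.

Lemma seg_reg_flat m g : seg_reg true m g -> g 0 = 0 /\ g L = 0.
Proof. destruct m; intros [_ [H _]]; auto. Qed.

Lemma seg_reg_pred b m g : seg_reg b (S m) g -> seg_reg b m g.
Proof.
  revert g. induction m; intros g [C [F [g' [D R]]]].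
  - simpl. auto.
  - split; [auto|split; [auto|]]. exists g'. split; auto.
Qed.

Lemma seg_reg_plus b m : forall f g, seg_reg b m f -> seg_reg b m g -> seg_reg b m (fun s => f s + g s).
Proof.
  induction m; intros f g [Cf [Ff Rf]] [Cg [Fg Rg]]; split; auto with cseg; split.
  - intros E. destruct (Ff E), (Fg E). lra.
  - exact I.
  - intros E. destruct (Ff E), (Fg E). lra.
  - destruct Rf as [f' [Df Rf]]. destruct Rg as [g' [Dg Rg]]. exists (fun s => f' s + g' s). split; auto.
    intros s Hs. apply deriv_in_plus; auto.
Qed.

Lemma seg_reg_mult b m : forall f g, seg_reg b m f -> seg_reg false m g -> seg_reg b m (fun s => f s * g s).
Proof.
  induction m; intros f g Hf Hg; pose proof Hf as [Cf [Ff Rf]]; pose proof Hg as [Cg [Fg Rg]]; split; auto with cseg; split.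
  - intros E. destruct (Ff E) as [-> ->]. lra.
  - exact I.
  - intros E. destruct (Ff E) as [-> ->]. lra.
  - destruct Rf as [f' [Df Rf]]. destruct Rg as [g' [Dg Rg]]. exists (fun s => f' s * g s + f s * g' s). split.
    + intros s Hs. apply deriv_in_mult; auto.
    + apply seg_reg_plus; apply IHm; auto; apply seg_reg_pred; auto.
Qed.

Lemma seg_reg_ext b m : forall f g, (forall s, seg L s -> f s = g s) -> seg_reg b m f -> seg_reg b m g.
Proof.
  destruct m; intros f g E [C [F R]]; (split; [apply (cseg_ext L f); auto|split]).
  - intros Eb. destruct (F Eb). rewrite <- !E; auto; [apply seg_L|apply seg_0]; auto.
  - exact I.
  - intros Eb. destruct (F Eb). rewrite <- !E; auto; [apply seg_L|apply seg_0]; auto.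
  - destruct R as [f' [D R]]. exists f'. split; auto. intros s Hs. apply (deriv_in_ext _ f); auto.
Qed.

(** Each integration by parts against a cosine or sine gains a factor 1/k. *)
Lemma flat_coef_decay m : forall g, seg_reg true m g -> exists C, 0 <= C /\ forall k,
  Rabs (Int (fun s => g s * cosw L (S k) s)) <= C * wt m (S k) /\
  Rabs (Int (fun s => g s * sinw L (S k) s)) <= C * wt m (S k).
Proof.
  pose proof (freq_pos L HL) as Hw.
  induction m; intros g Hg.
  - pose proof (seg_reg_cseg _ _ _ Hg) as C. destruct (seg_bounded L HL g C) as [M HM].
    assert (HM0 : 0 <= M) by (eapply Rle_trans; [apply Rabs_pos|apply (HM 0), seg_0; auto]).
    exists (L * M). split; [apply Rmult_le_pos; lra|]. intros k. unfold wt. simpl. rewrite Rinv_1, Rmult_1_r.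
    split; apply Int_bound; auto with cseg; intros s Hs; rewrite Rabs_mult; specialize (HM s Hs).
    + pose proof (cosw_bound L (S k) s). pose proof (Rabs_pos (g s)). pose proof (Rabs_pos (cosw L (S k) s)). nra.
    + pose proof (sinw_bound L (S k) s). pose proof (Rabs_pos (g s)). pose proof (Rabs_pos (sinw L (S k) s)). nra.
  - pose proof (seg_reg_flat _ _ Hg) as [G0 GL]. destruct Hg as [C [_ [g' [D R]]]].
    pose proof (seg_reg_cseg _ _ _ R) as C'.
    destruct (IHm g' R) as [K [HK Hb]].
    exists (2 / w * K). split; [apply Rmult_le_pos; [apply Rlt_le, Rdiv_lt_0_compat; lra|auto]|].
    assert (Gain : forall k u, Rabs u <= K * wt m (S k) -> / (INR (S k) * w) * Rabs u <= 2 / w * K * wt (S m) (S k)).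
    { intros k u Hu. pose proof (inv_kw_wt L HL k). pose proof (Rinv_0_lt_compat _ (kw_S_pos L HL k)).
      replace (2 / w * K * wt (S m) (S k)) with (2 / w * wt 1 (S k) * (K * wt m (S k))).
      - apply Rmult_le_compat; auto; [lra|apply Rabs_pos].
      - replace (S m) with (1 + m)%nat by lia. rewrite wt_mult. ring. }
    intros k. destruct (Hb k) as [Hc Hs].
    pose proof (kw_S_pos L HL k) as Hkw.
    split.
    + rewrite (cosw_by_parts L HL k g g'); auto.
      rewrite Rabs_mult, Rabs_Ropp, (Rabs_right (/ _)) by (apply Rle_ge, Rlt_le, Rinv_0_lt_compat; auto).
      apply Gain; auto.
    + rewrite (Int_ext L HL _ (fun s => sinw L (S k) s * g s)) by (intros; ring).
      rewrite (Int_by_parts L HL (fun s => - / (INR (S k) * w) * cosw L (S k) s) g (sinw L (S k)) g'); auto.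
      * rewrite G0, GL.
        rewrite (Int_ext L HL _ (fun s => - / (INR (S k) * w) * (g' s * cosw L (S k) s))) by (intros; ring).
        rewrite Int_scal by auto with cseg.
        match goal with |- Rabs ?x <= _ => replace x with (/ (INR (S k) * w) * Int (fun s => g' s * cosw L (S k) s)) by ring end.
        rewrite Rabs_mult, (Rabs_right (/ _)) by (apply Rle_ge, Rlt_le, Rinv_0_lt_compat; auto).
        apply Gain; auto.
      * intros s Hs'.
        apply (deriv_in_eq _ _ _ (- / (INR (S k) * w) * (- (INR (S k) * w) * sinw L (S k) s))).
        -- field. split; [lra|]. pose proof (pos_INR k). rewrite S_INR. lra.
        -- apply deriv_in_scal. apply is_derive_deriv_in. apply cosw_is_derive.
      * apply sinw_cseg.
Qed.

Lemma angle_lift (x1 y1 x2 y2 : R -> R) :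
  (forall s, seg L s -> deriv_in (seg L) x1 s (x2 s)) -> (forall s, seg L s -> deriv_in (seg L) y1 s (y2 s)) ->
  cseg L x2 -> cseg L y2 -> (forall s, seg L s -> x1 s ^ 2 + y1 s ^ 2 = 1) ->
  exists th, (forall s, seg L s -> deriv_in (seg L) th s (x1 s * y2 s - y1 s * x2 s)) /\
    forall s, seg L s -> cos (th s) = x1 s /\ sin (th s) = y1 s.
Proof.
  intros Dx Dy C2 C2' H1.
  pose proof (cseg_deriv L x1 x2 Dx) as Cx. pose proof (cseg_deriv L y1 y2 Dy) as Cy.
  set (k := fun s => x1 s * y2 s - y1 s * x2 s).
  assert (Ck : cseg L k) by (unfold k; auto with cseg).
  assert (S0 := seg_0 L HL).
  destruct (angle_exists _ _ (H1 0 S0)) as [phi [_ [Hc Hs]]].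
  set (th := fun s => phi + RInt k 0 s).
  assert (Dth : forall s, seg L s -> deriv_in (seg L) th s (k s)).
  { intros s Ss. apply (deriv_in_eq _ _ _ (0 + k s)); [ring|].
    apply (deriv_in_plus _ (fun _ => phi)); [apply deriv_in_const|apply RInt_deriv_in; auto]. }
  exists th. split; auto.
  assert (Orth : forall s, seg L s -> x1 s * x2 s + y1 s * y2 s = 0).
  { intros s Ss.
    assert (2 * (x1 s * x2 s + y1 s * y2 s) = 0); [|lra].
    apply (deriv_in_unique (seg L) (fun s => x1 s * x1 s + y1 s * y1 s) s); [apply accum_seg; auto| |].
    - apply (deriv_in_eq _ _ _ ((x2 s * x1 s + x1 s * x2 s) + (y2 s * y1 s + y1 s * y2 s))); [ring|].
      apply (deriv_in_plus _ (fun s => x1 s * x1 s)); apply deriv_in_mult; auto.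
    - apply (deriv_in_ext _ (fun _ => 1)); auto; [|apply deriv_in_const].
      intros y Hy. specialize (H1 y Hy). nra. }
  (* <(cos th, sin th), (x1, y1)> is constant, as both unit vectors rotate with speed k *)
  assert (P : forall s, seg L s -> cos (th s) * x1 s + sin (th s) * y1 s = 1).
  { intros s Ss.
    assert (E : cos (th s) * x1 s + sin (th s) * y1 s = cos (th 0) * x1 0 + sin (th 0) * y1 0).
    { apply (deriv_in_zero (seg L) (fun s => cos (th s) * x1 s + sin (th s) * y1 s) 0 s); [apply Ss| |].
      - intros z Hz. destruct Ss; split; lra.
      - intros z Hz. assert (Sz : seg L z) by (destruct Ss; split; lra).
        apply (deriv_in_eq _ _ _ ((- sin (th z) * k z * x1 z + cos (th z) * x2 z) + (cos (th z) * k z * y1 z + sin (th z) * y2 z))).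
        + specialize (Orth z Sz). specialize (H1 z Sz).
          assert (Ex : x2 z = - k z * y1 z).
          { unfold k. transitivity ((x1 z ^ 2 + y1 z ^ 2) * x2 z - x1 z * (x1 z * x2 z + y1 z * y2 z)); [rewrite H1, Orth; ring|ring]. }
          assert (Ey : y2 z = k z * x1 z).
          { unfold k. transitivity ((x1 z ^ 2 + y1 z ^ 2) * y2 z - y1 z * (x1 z * x2 z + y1 z * y2 z)); [rewrite H1, Orth; ring|ring]. }
          rewrite Ex, Ey. ring.
        + apply (deriv_in_plus _ (fun s => cos (th s) * x1 s)).
          * apply (deriv_in_mult _ (fun s => cos (th s))); auto. apply deriv_in_comp; auto. apply cos_is_derive.
          * apply (deriv_in_mult _ (fun s => sin (th s))); auto. apply deriv_in_comp; auto. apply sin_is_derive. }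
    rewrite E. unfold th. rewrite (RInt_point (V := R_CompleteNormedModule) 0 k).
    change (cos (phi + 0) * x1 0 + sin (phi + 0) * y1 0 = 1). rewrite Rplus_0_r, Hc, Hs.
    specialize (H1 0 S0). nra. }
  intros s Ss. specialize (P s Ss). specialize (H1 s Ss).
  pose proof (sin2_cos2 (th s)) as Hsc. unfold Rsqr in Hsc.
  assert (Z : (cos (th s) - x1 s) ^ 2 + (sin (th s) - y1 s) ^ 2 = 0) by nra.
  pose proof (pow2_ge_0 (cos (th s) - x1 s)). pose proof (pow2_ge_0 (sin (th s) - y1 s)).
  split; apply Rminus_diag_uniq; apply Rsqr_0_uniq; unfold Rsqr; lra.
Qed.

Lemma smooth_in_components (g : R -> R2) : smooth_in (seg L) g -> forall n s, seg L s ->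
  deriv_in (seg L) (fun y => fst (Derive_n_in (seg L) g n y)) s (fst (Derive_n_in (seg L) g (S n) s)) /\
  deriv_in (seg L) (fun y => snd (Derive_n_in (seg L) g n y)) s (snd (Derive_n_in (seg L) g (S n) s)).
Proof.
  intros H n s Hs. apply (ex_derive_in_Derive (seg L) (Derive_n_in (seg L) g n) s Hs); [apply accum_seg; auto|].
  apply H; auto.
Qed.

Lemma Derive_n_in_add (D : R -> Prop) (g : R -> R2) m n :
  Derive_n_in D (Derive_n_in D g m) n = Derive_n_in D g (n + m).
Proof. induction n; simpl; [reflexivity|rewrite IHn; reflexivity]. Qed.

(** The curvature is flat at both ends, so integrations by parts give the rapid decay. *)
Theorem initial_angle (f0 : R -> R2) :
  smooth_in (seg L) f0 ->
  (forall s, seg L s -> norm (Derive_in (seg L) f0 s) = 1) ->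
  (forall l, Derive_n_in (seg L) (Derive_n_in (seg L) f0 2) l 0 = zero /\
             Derive_n_in (seg L) (Derive_n_in (seg L) f0 2) l L = zero) ->
  exists alpha, rapid alpha /\
    (forall s, seg L s -> Derive_in (seg L) f0 s = (cos (fser L 0 alpha s), sin (fser L 0 alpha s))) /\
    Int (fun s => cos (fser L 0 alpha s)) = fst (f0 L) - fst (f0 0) /\
    Int (fun s => sin (fser L 0 alpha s)) = snd (f0 L) - snd (f0 0).
Proof.
  intros Hsm Hn Hk.
  set (x := fun n s => fst (Derive_n_in (seg L) f0 n s)).
  set (y := fun n s => snd (Derive_n_in (seg L) f0 n s)).
  assert (Dx : forall n s, seg L s -> deriv_in (seg L) (x n) s (x (S n) s)).
  { intros n s Hs. apply (smooth_in_components f0 Hsm n s Hs). }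
  assert (Dy : forall n s, seg L s -> deriv_in (seg L) (y n) s (y (S n) s)).
  { intros n s Hs. apply (smooth_in_components f0 Hsm n s Hs). }
  assert (Cx : forall n, cseg L (x n)) by (intros n; apply (cseg_deriv L (x n) (x (S n))); auto).
  assert (Cy : forall n, cseg L (y n)) by (intros n; apply (cseg_deriv L (y n) (y (S n))); auto).
  assert (Fl : forall n, (x (n + 2)%nat 0 = 0 /\ x (n + 2)%nat L = 0) /\ (y (n + 2)%nat 0 = 0 /\ y (n + 2)%nat L = 0)).
  { intros n. destruct (Hk n) as [K0 KL]. rewrite Derive_n_in_add in K0, KL. unfold x, y. rewrite K0, KL.
    repeat split; reflexivity. }
  assert (Rx : forall m n, seg_reg false m (x n)).
  { induction m; intros n; (split; [auto|split; [discriminate|]]); auto. exists (x (S n)). auto. }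
  assert (Ry : forall m n, seg_reg false m (y n)).
  { induction m; intros n; (split; [auto|split; [discriminate|]]); auto. exists (y (S n)). auto. }
  assert (Rx' : forall m n, seg_reg true m (x (n + 2)%nat)).
  { induction m; intros n; (split; [auto|split; [intros _; apply Fl|]]); auto. exists (x (S n + 2)%nat).
    split; [intros s Hs; apply (Dx (n + 2)%nat); auto|apply IHm]. }
  assert (Ry' : forall m n, seg_reg true m (y (n + 2)%nat)).
  { induction m; intros n; (split; [auto|split; [intros _; apply Fl|]]); auto. exists (y (S n + 2)%nat).
    split; [intros s Hs; apply (Dy (n + 2)%nat); auto|apply IHm]. }
  assert (Unit : forall s, seg L s -> x 1%nat s ^ 2 + y 1%nat s ^ 2 = 1).
  { intros s Hs. unfold x, y. pose proof (norm_R2_sq (Derive_in (seg L) f0 s)) as E. rewrite Hn in E by auto.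
    simpl Derive_n_in. lra. }
  destruct (angle_lift (x 1%nat) (y 1%nat) (x 2%nat) (y 2%nat)) as [th [Dth Hth]]; auto.
  set (k := fun s => x 1%nat s * y 2%nat s - y 1%nat s * x 2%nat s) in *.
  assert (Rk : forall m, seg_reg true m k).
  { intros m. apply (seg_reg_ext true m (fun s => y 2%nat s * x 1%nat s + x 2%nat s * (-1 * y 1%nat s))).
    - intros; unfold k; ring.
    - apply (seg_reg_plus true m (fun s => y 2%nat s * x 1%nat s)).
      + apply (seg_reg_mult true m (y 2%nat) (x 1%nat)); [apply (Ry' m O)|auto].
      + apply (seg_reg_mult true m (x 2%nat) (fun s => -1 * y 1%nat s)); [apply (Rx' m O)|].
        apply (seg_reg_mult false m (fun _ => -1)); auto.
        clear. assert (forall c, seg_reg false m (fun _ => c)); [|auto].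
        induction m; intros c; (split; [auto with cseg|split; [discriminate|]]); auto.
        exists (fun _ => 0). split; auto. intros; apply deriv_in_const. }
  pose proof (cseg_deriv L th k Dth) as Cth. pose proof (seg_reg_cseg _ _ _ (Rk O)) as Ck.
  set (alpha := fun j => / mass L j * Int (fun s => th s * cosw L j s)).
  assert (Halpha : rapid alpha).
  { intros p. destruct (flat_coef_decay p k (Rk p)) as [C [HC Hb]].
    pose proof (freq_pos L HL) as Hw.
    exists (2 / L * / w * C). intros j. unfold alpha, mass. rewrite (cosw_by_parts L HL j th k); auto.
    destruct (Hb j) as [_ Hs]. pose proof (pos_INR j).
    pose proof (kw_S_pos L HL j) as Hkw.
    rewrite !Rabs_mult, Rabs_Ropp, !Rabs_right by (apply Rle_ge, Rlt_le, Rinv_0_lt_compat; lra).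
    replace (/ (L / 2)) with (2 / L) by (field; lra).
    assert (0 < 2 / L) by (apply Rdiv_lt_0_compat; lra).
    rewrite !Rmult_assoc. apply Rmult_le_compat_l; [lra|].
    apply Rmult_le_compat; auto; [apply Rlt_le, Rinv_0_lt_compat; auto|apply Rabs_pos|].
    apply Rinv_le_contravar; auto. apply kw_S_ge; auto. }
  assert (Eth : forall s, seg L s -> th s = fser L 0 alpha s).
  { intros s Hs. rewrite fser_0.
    destruct (rapid_on_dom L HL (fun _ => True) (fun j _ => alpha j) 0) as [M [HM HD]].
    { intros p. destruct (Halpha p) as [C HC]. exists C. auto. }
    apply (cos_series_repr L HL th alpha M); auto.
    - intros j. specialize (HD j 0 I). rewrite pow_O, Rmult_1_r in HD. exact HD.
    - intros j. unfold alpha. pose proof (mass_pos L HL j). field. lra. }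
  exists alpha. split; auto.
  assert (EX : forall s, seg L s -> cos (fser L 0 alpha s) = x 1%nat s).
  { intros s Hs. rewrite <- Eth by auto. apply Hth; auto. }
  assert (EY : forall s, seg L s -> sin (fser L 0 alpha s) = y 1%nat s).
  { intros s Hs. rewrite <- Eth by auto. apply Hth; auto. }
  split; [|split].
  - intros s Hs. rewrite EX, EY by auto. unfold x, y. simpl Derive_n_in. apply surjective_pairing.
  - rewrite (Int_ext L HL _ _ EX). apply (Int_FTC L HL (x O) (x 1%nat)); auto.
  - rewrite (Int_ext L HL _ _ EY). apply (Int_FTC L HL (y O) (y 1%nat)); auto.
Qed.

End Initial.

(** * Subconvergence of the Fourier coefficients *)

Lemma is_lim_seq_eps (u : nat -> R) (l : R) :
  is_lim_seq u l <-> forall eps, 0 < eps -> exists N, forall n, (N <= n)%nat -> Rabs (u n - l) < eps.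
Proof.
  split; intros H.
  - apply is_lim_seq_spec in H. intros eps He. exact (H (mkposreal eps He)).
  - apply is_lim_seq_spec. intros eps. exact (H eps (cond_pos eps)).
Qed.

Lemma bounded_subseq (u : nat -> R) (M : R) : (forall n, Rabs (u n) <= M) ->
  exists phi : nat -> nat, (forall n, (n <= phi n)%nat) /\ exists l : R, is_lim_seq (fun n => u (phi n)) l.
Proof.
  intros HM.
  destruct (Bolzano_Weierstrass u (fun x => - M <= x <= M) (compact_P3 (- M) M)) as [l Hl].
  { intros n. apply Rabs_le_between. auto. }
  assert (H : forall n : nat, exists p, (n <= p)%nat /\ Rabs (u p - l) < / (INR n + 1)).
  { intros n. assert (Hp : 0 < / (INR n + 1)) by (apply Rinv_0_lt_compat; pose proof (pos_INR n); lra).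
    apply (Hl (disc l (mkposreal _ Hp)) n). exists (mkposreal _ Hp). unfold included. auto. }
  set (phi := fun n => proj1_sig (constructive_indefinite_description _ (H n))).
  assert (Hphi : forall n, (n <= phi n)%nat /\ Rabs (u (phi n) - l) < / (INR n + 1)).
  { intros n. unfold phi. destruct (constructive_indefinite_description _ (H n)). auto. }
  exists phi. split; [apply Hphi|]. exists l. apply is_lim_seq_eps. intros eps He.
  destruct (INR_unbounded (/ eps)) as [N HN]. exists N. intros n Hn.
  eapply Rlt_trans; [apply Hphi|]. apply le_INR in Hn.
  assert (0 < / eps) by (apply Rinv_0_lt_compat; auto).
  rewrite <- (Rinv_inv eps). apply Rinv_lt_contravar; [|lra]. apply Rmult_lt_0_compat; lra.
Qed.

(** Cantor's diagonal argument for countably many bounded sequences. *)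
Lemma diagonal_subseq (u : nat -> nat -> R) : (forall k, exists M, forall n, Rabs (u k n) <= M) ->
  exists phi : nat -> nat, (forall n, (n <= phi n)%nat) /\ forall k, exists l : R, is_lim_seq (fun n => u k (phi n)) l.
Proof.
  intros HM.
  assert (H : forall v : nat -> R, exists psi : nat -> nat, (forall n, (n <= psi n)%nat) /\
     ((exists M, forall n, Rabs (v n) <= M) -> exists l : R, is_lim_seq (fun n => v (psi n)) l)).
  { intros v. destruct (excluded_middle_informative (exists M, forall n, Rabs (v n) <= M)) as [[M Hv]|Hn].
    - destruct (bounded_subseq v M Hv) as [psi [H1 H2]]. exists psi. auto.
    - exists (fun n => n). split; auto. tauto. }
  set (psi := fun v => proj1_sig (constructive_indefinite_description _ (H v))).
  assert (Hpsi : forall v, (forall n, (n <= psi v n)%nat) /\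
     ((exists M, forall n, Rabs (v n) <= M) -> exists l : R, is_lim_seq (fun n => v (psi v n)) l)).
  { intros v. unfold psi. destruct (constructive_indefinite_description _ (H v)). auto. }
  set (Phi := fix Phi (k : nat) : nat -> nat := match k with
     | O => fun n => n | S j => fun n => Phi j (psi (fun m => u j (Phi j m)) n) end).
  assert (Nest : forall k d, exists rho : nat -> nat, (forall m, (m <= rho m)%nat) /\ forall m, Phi (d + k)%nat m = Phi k (rho m)).
  { intros k. induction d as [|d [rho [H1 H2]]].
    - exists (fun m => m). auto.
    - set (v := fun m => u (d + k)%nat (Phi (d + k)%nat m)).
      exists (fun m => rho (psi v m)). split.
      + intros m. destruct (Hpsi v) as [P _]. specialize (P m). specialize (H1 (psi v m)). lia.
      + intros m. rewrite <- H2. reflexivity. }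
  exists (fun n => Phi n n). split.
  - intros n. destruct (Nest O n) as [rho [H1 H2]]. rewrite Nat.add_0_r in H2. rewrite H2. apply H1.
  - intros k. destruct (Hpsi (fun m => u k (Phi k m))) as [_ Hl].
    destruct Hl as [l Hl]. { destruct (HM k) as [M Hk]. exists M. auto. }
    exists l. rewrite is_lim_seq_eps in Hl. apply is_lim_seq_eps. intros eps He.
    destruct (Hl eps He) as [N HN]. exists (max N (S k)). intros n Hn.
    destruct (Nest (S k) (n - S k)%nat) as [rho [H1 H2]].
    replace (n - S k + S k)%nat with n in H2 by lia. rewrite H2.
    apply (HN (rho n)). specialize (H1 n). lia.
Qed.

Section Limit.
Variable L : R.
Hypothesis HL : 0 < L.
Notation w := (freq L).
Notation Int := (integ L).
Notation fser := (fser L).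

Lemma fser_0_split x s : ell x -> fser 0 x s = x O + Series (fun k => x (S k) * (INR (S k) * w) ^ 0 * phase L 0 (S k) s).
Proof.
  intros Hx. unfold fser. rewrite Series_incr_1.
  - rewrite phase_0, cosw_O. simpl. ring.
  - apply (ex_series_le_R _ _ (fun k => fser_term_bound L HL 0 x k s)). apply ell_0; auto.
Qed.

(** Lets the mean angle be reduced modulo 2 PI, where it stays in a compact set. *)
Lemma fser_mean_shift x y s : ell x -> ell y -> (forall k, x (S k) = y (S k)) ->
  cos (x O) = cos (y O) -> sin (x O) = sin (y O) ->
  cos (fser 0 x s) = cos (fser 0 y s) /\ sin (fser 0 x s) = sin (fser 0 y s) /\ fser 1 x s = fser 1 y s.
Proof.
  intros Hx Hy E Ec Es. rewrite !fser_0_split by auto.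
  rewrite (Series_ext (fun k => x (S k) * _ * _) (fun k => y (S k) * (INR (S k) * w) ^ 0 * phase L 0 (S k) s))
    by (intros; rewrite E; auto).
  rewrite !cos_plus, !sin_plus, Ec, Es. repeat split; auto.
  apply Series_ext. intros [|k]; [simpl INR; ring|rewrite E; auto].
Qed.

Variables Rc dc : R.
Notation forcing := (forcing L Rc dc).

Lemma forcing_congr x y k : (forall s, cos (fser 0 x s) = cos (fser 0 y s) /\ sin (fser 0 x s) = sin (fser 0 y s) /\ fser 1 x s = fser 1 y s) ->
  forcing k x = forcing k y.
Proof.
  intros H.
  assert (Ec : forall s, cos (fser 0 x s) = cos (fser 0 y s)) by apply H.
  assert (Es : forall s, sin (fser 0 x s) = sin (fser 0 y s)) by apply H.
  assert (Ek : forall s, kap L Rc x s = kap L Rc y s) by (intros s; unfold kap; destruct (H s) as [_ [_ ->]]; auto).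
  assert (Ess : mss L x = mss L y) by (apply Int_ext; auto; intros s _; rewrite Es; auto).
  assert (Esc : msc L x = msc L y) by (apply Int_ext; auto; intros s _; rewrite Es, Ec; auto).
  assert (Ecc : mcc L x = mcc L y) by (apply Int_ext; auto; intros s _; rewrite Ec; auto).
  assert (Evc : vc L Rc x = vc L Rc y) by (apply Int_ext; auto; intros s _; rewrite Ec, Ek; auto).
  assert (Evs : vs L Rc x = vs L Rc y) by (apply Int_ext; auto; intros s _; rewrite Es, Ek; auto).
  assert (Elc : lamc L Rc dc x = lamc L Rc dc y) by (unfold lamc, det; rewrite Ess, Esc, Ecc, Evc, Evs; auto).
  assert (Els : lams L Rc dc x = lams L Rc dc y) by (unfold lams, det; rewrite Ess, Esc, Ecc, Evc, Evs; auto).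
  destruct k; unfold forcing; f_equal; apply Int_ext; auto; intros s _; rewrite Elc, Els, ?Ec, ?Es, ?Ek; auto.
Qed.

Variable alpha : nat -> R.
Variable a : nat -> R -> R.
Hypothesis Sol : flow_solution L Rc dc alpha a ray.

Notation force := (force L Rc dc a).
Notation speed := (speed L Rc dc a).
Notation energy := (energy L a).
Notation dissipation := (dissipation L Rc dc a).

Let HRc := sol_Rc _ _ _ _ _ _ Sol.
Let Hdc := sol_dc _ _ _ _ _ _ Sol.
Let a_ell := sol_ell _ _ _ _ _ _ Sol.
Let a_untruncated := sol_untruncated _ _ _ _ _ _ Sol.
Let arapid := a_rapid L HL Rc dc alpha a ray Sol.
Let frapid := force_rapid L HL Rc dc alpha a ray Sol.

(** The energy converges, and its decrease over [n, n+1] is the dissipation at some time between. *)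
Lemma low_dissipation_times : exists tau : nat -> R,
  (forall n, INR n <= tau n) /\ is_lim_seq (fun n => dissipation (tau n)) 0.
Proof.
  assert (H : forall n, exists c, INR n <= c /\ energy (INR n) - energy (INR (S n)) = dissipation c).
  { intros n. pose proof (pos_INR n).
    destruct (energy_decay L HL Rc dc alpha a ray Sol (INR n) (INR (S n))) as [c [Hc E]].
    - exact H.
    - unfold ray. rewrite S_INR. lra.
    - rewrite S_INR. lra.
    - exists c. split; [apply Hc|]. rewrite E, S_INR. ring. }
  set (tau := fun n => proj1_sig (constructive_indefinite_description _ (H n))).
  assert (Htau : forall n, INR n <= tau n /\ energy (INR n) - energy (INR (S n)) = dissipation (tau n)).
  { intros n. unfold tau. destruct (constructive_indefinite_description _ (H n)). auto. }
  exists tau. split; [apply Htau|].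
  assert (Dn : forall t, 0 <= t -> 0 <= dissipation t).
  { intros t Ht. apply (dissipation_nonneg L HL Rc dc alpha a ray Sol t Ht). }
  destruct (ex_finite_lim_seq_decr (fun n => energy (INR n)) 0) as [l Hl].
  - intros n. destruct (Htau n) as [H1 H2]. pose proof (Dn (tau n) ltac:(pose proof (pos_INR n); lra)). lra.
  - intros n. apply Int_nonneg; auto.
    + assert (Hr : ray (INR n)) by apply pos_INR.
      pose proof (ang_cseg L HL Rc dc alpha a ray Sol 1 (INR n) Hr). auto with cseg.
    + intros s _. match goal with |- 0 <= _ * (?z * ?z) => pose proof (Rle_0_sqr z) as Hz end. unfold Rsqr in Hz. lra.
  - apply (is_lim_seq_ext (fun n => energy (INR n) - energy (INR (S n)))); [intros n; apply Htau|].
    replace (Finite 0) with (Finite (l - l)) by (f_equal; ring).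
    apply is_lim_seq_minus'; auto. apply (is_lim_seq_incr_1 (fun n => energy (INR n))); auto.
Qed.

Lemma speed_coef k t : ray t ->
  Int (fun s => speed s t * cosw L k s) = mass L k * (- (INR k * w) ^ 2 * a k t + force k t).
Proof.
  intros Ht.
  assert (Ra : rapid (fun k => a k t)) by (apply (rapid_on_rapid ray a t Ht arapid)).
  assert (Rf : rapid (fun k => force k t)) by (apply (rapid_on_rapid ray force t Ht frapid)).
  set (z := fun k => - (INR k * w) ^ 2 * a k t + force k t).
  assert (Ex2 : ex_series (fun k => Rabs (- (INR k * w) ^ 2 * a k t) * (INR k * w) ^ 0)).
  { apply (ex_series_ext (fun k => Rabs (a k t) * (INR k * w) ^ 2)); [|apply (rapid_ex L HL (fun k => a k t)); auto].
    intros k0. rewrite Rabs_mult, Rabs_Ropp, (Rabs_right (_ ^ 2)) by (apply Rle_ge, pow2_ge_0). simpl. ring. }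
  assert (Ex0 := rapid_ex L HL (fun k => force k t) 0 Rf).
  rewrite (Int_ext L HL _ (fun s => Series (fun j => z j * cosw L j s) * cosw L k s)).
  - apply (cos_series_coef L HL z (fun k => Rabs (- (INR k * w) ^ 2 * a k t) * (INR k * w) ^ 0 + Rabs (force k t) * (INR k * w) ^ 0)).
    + apply ex_series_plus_R; auto.
    + intros j. rewrite !pow_O, !Rmult_1_r. apply Rabs_triang.
  - intros s _. f_equal. unfold speed, ang, frc.
    rewrite <- fser_0. unfold z. rewrite fser_plus; auto. rewrite fser_laplacian. reflexivity.
Qed.

(** Young's inequality for |v| with weight [eps]. *)
Lemma small_coef (v : R -> R) k eps : cseg L v -> 0 < eps ->
  Rabs (Int (fun s => v s * cosw L k s)) <= eps * L / 2 + Int (fun s => v s * v s) / (2 * eps).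
Proof.
  intros Cv He.
  apply Rle_trans with (Int (fun s => eps / 2 + / (2 * eps) * (v s * v s))).
  - apply Int_abs_le; auto with cseg. intros s _. rewrite Rabs_mult.
    pose proof (cosw_bound L k s). pose proof (Rabs_pos (cosw L k s)). pose proof (Rabs_pos (v s)).
    apply Rle_trans with (Rabs (v s) * 1); [apply Rmult_le_compat_l; auto|].
    replace (v s * v s) with (Rabs (v s) * Rabs (v s)) by (rewrite <- Rabs_mult; apply Rabs_right, Rle_ge, Rle_0_sqr).
    set (z := Rabs (v s)) in *. pose proof (Rle_0_sqr (z - eps)) as Hz. unfold Rsqr in Hz.
    apply Rmult_le_reg_l with (2 * eps); [lra|].
    replace (2 * eps * (eps / 2 + / (2 * eps) * (z * z))) with (eps * eps + z * z) by (field; lra). lra.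
  - rewrite Int_plus, Int_scal, Int_const by auto with cseg. right. unfold Rdiv. ring.
Qed.

(** The limit along times of vanishing dissipation is a stationary solution of the coefficient
    system: by diagonal extraction all modes converge, and the forcing passes to the limit. *)
Theorem stationary_limit : exists (tau : nat -> R) (u : nat -> nat -> R) (b : nat -> R),
  (forall n, INR n <= tau n) /\
  (forall n s, cos (fser 0 (u n) s) = cos (fser 0 (fun k => a k (tau n)) s) /\
               sin (fser 0 (u n) s) = sin (fser 0 (fun k => a k (tau n)) s)) /\
  (forall k, is_lim_seq (fun n => u n k) (b k)) /\
  (forall p, exists C, forall n k, Rabs (u n (S k)) <= C * wt p (S k)) /\
  rapid b /\
  (forall s, seg L s -> fser 2 b s + normal_force L Rc dc b s = 0).
Proof.
  destruct low_dissipation_times as [tau0 [Htau0 Hdis0]].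
  assert (H0 : forall n, ray (tau0 n)) by (intros n; specialize (Htau0 n); pose proof (pos_INR n); unfold ray; lra).
  assert (Hang : forall n, exists phi, Rabs phi <= PI /\ cos phi = cos (a O (tau0 n)) /\ sin phi = sin (a O (tau0 n))).
  { intros n. apply angle_exists. pose proof (sin2_cos2 (a O (tau0 n))) as E. unfold Rsqr in E. lra. }
  set (mean := fun n => proj1_sig (constructive_indefinite_description _ (Hang n))).
  assert (Hmean : forall n, Rabs (mean n) <= PI /\ cos (mean n) = cos (a O (tau0 n)) /\ sin (mean n) = sin (a O (tau0 n))).
  { intros n. unfold mean. destruct (constructive_indefinite_description _ (Hang n)). auto. }
  set (v := fun k n => match k with O => mean n | S j => a (S j) (tau0 n) end).
  assert (Hv : forall p, exists C, forall n k, Rabs (v (S k) n) <= C * wt p (S k)).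
  { intros p. destruct (arapid p) as [C HC]. exists C. intros n k. apply HC; auto. }
  destruct (diagonal_subseq v) as [phi [Hphi Hlim]].
  { intros [|k]; [exists PI; intros n; apply Hmean|]. destruct (Hv O) as [C HC]. exists (C * wt 0 (S k)). intros n; apply HC. }
  set (b := fun k => proj1_sig (constructive_indefinite_description _ (Hlim k))).
  assert (Hb : forall k, is_lim_seq (fun n => v k (phi n)) (b k)).
  { intros k. unfold b. destruct (constructive_indefinite_description _ (Hlim k)). auto. }
  set (tau := fun n => tau0 (phi n)). set (u := fun n k => v k (phi n)).
  assert (Ht : forall n, INR n <= tau n).
  { intros n. eapply Rle_trans; [apply le_INR, Hphi|apply Htau0]. }
  assert (Htr : forall n, ray (tau n)) by (intros n; apply H0).
  assert (Hu : forall p, exists C, forall n k, Rabs (u n (S k)) <= C * wt p (S k)).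
  { intros p. destruct (Hv p) as [C HC]. exists C. intros n k. apply HC. }
  assert (lim_le : forall k (M : R), (forall n, Rabs (u n k) <= M) -> Rabs (b k) <= M).
  { intros k M HM. assert (Rbar_le (Rabs (b k)) M); [|auto].
    apply (is_lim_seq_le (fun n => Rabs (u n k)) (fun _ => M)); auto; [|apply is_lim_seq_const].
    apply (is_lim_seq_abs (fun n => u n k) (b k)). apply Hb. }
  assert (Rb : rapid b).
  { intros p. destruct (Hu p) as [C HC]. exists C. intros k. apply lim_le. intros n; apply HC. }
  assert (Ru : forall n, rapid (u n)) by (intros n p; destruct (Hu p) as [C HC]; exists C; auto).
  assert (Eb := rapid_ell b Rb). assert (Eu : forall n, ell (u n)) by (intros; apply rapid_ell; auto).
  assert (Shift : forall n s, cos (fser 0 (u n) s) = cos (fser 0 (fun k => a k (tau n)) s) /\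
      sin (fser 0 (u n) s) = sin (fser 0 (fun k => a k (tau n)) s) /\ fser 1 (u n) s = fser 1 (fun k => a k (tau n)) s).
  { intros n s. apply fser_mean_shift; auto.
    - apply a_ell, Htr.
    - apply (Hmean (phi n)).
    - apply (Hmean (phi n)). }
  destruct (Hu 3%nat) as [C3 HC3].
  set (M := fun k => (PI + Rabs C3) * wt 2 k).
  assert (HM : ex_series M) by (apply ex_series_scal_R, ex_series_wt2).
  assert (HuM : forall n k, (1 + INR k) * Rabs (u n k) <= M k).
  { intros n [|k]; unfold M.
    - unfold wt. simpl. rewrite Rplus_0_r, !Rmult_1_r, Rinv_1, Rmult_1_l, Rmult_1_r.
      pose proof (Rabs_pos C3). pose proof (proj1 (Hmean (phi n))). unfold u, v. lra.
    - specialize (HC3 n k). rewrite wt_S in HC3. pose proof (one_INR_pos (S k)). pose proof (wt_pos 2 (S k)).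
      pose proof PI_RGT_0. pose proof (Rle_abs C3).
      apply Rle_trans with ((1 + INR (S k)) * (C3 * (wt 2 (S k) / (1 + INR (S k))))); [apply Rmult_le_compat_l; lra|].
      replace ((1 + INR (S k)) * (C3 * (wt 2 (S k) / (1 + INR (S k))))) with (C3 * wt 2 (S k)) by (field; lra).
      apply Rmult_le_compat_r; lra. }
  assert (HbM : forall k, (1 + INR k) * Rabs (b k) <= M k).
  { intros k. pose proof (one_INR_pos k).
    apply Rmult_le_reg_l with (/ (1 + INR k)); [apply Rinv_0_lt_compat; auto|].
    rewrite <- Rmult_assoc, Rinv_l, Rmult_1_l by lra. apply lim_le. intros n.
    apply Rmult_le_reg_l with (1 + INR k); auto. rewrite <- Rmult_assoc, Rinv_r, Rmult_1_l by lra. apply HuM. }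
  destruct (forcing_bl L HL Rc dc HRc Hdc) as [B [HB [_ FL]]].
  assert (Fl : forall k, is_lim_seq (fun n => forcing k (u n)) (forcing k b)).
  { intros k. apply (lip_flim eventually (forcing k) (B / (1 + INR k)) (fun j n => u n j) b M); auto.
    apply filter_forall. auto. }
  assert (Dt : is_lim_seq (fun n => dissipation (tau n)) 0).
  { rewrite is_lim_seq_eps in *. intros eps He. destruct (Hdis0 eps He) as [N HN]. exists N. intros n Hn.
    apply HN. specialize (Hphi n). lia. }
  assert (Stat : forall k, - (INR k * w) ^ 2 * b k + forcing k b = 0).
  { intros k.
    assert (E1 : is_lim_seq (fun n => - (INR k * w) ^ 2 * u n k + forcing k (u n)) (- (INR k * w) ^ 2 * b k + forcing k b)).
    { apply is_lim_seq_plus'; [apply (is_lim_seq_scal_l (fun n => u n k) (- (INR k * w) ^ 2) (b k)), Hb|apply Fl]. }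
    assert (E2 : is_lim_seq (fun n => - (INR k * w) ^ 2 * u n k + forcing k (u n)) 0).
    { apply is_lim_seq_eps. intros eps He. pose proof (mass_pos L HL k) as Hmk.
      set (e := eps * mass L k). assert (He' : 0 < e) by (apply Rmult_lt_0_compat; auto).
      rewrite is_lim_seq_eps in Dt.
      destruct (Dt (e / 2 * (2 * (e / L)))) as [N HN].
      { apply Rmult_lt_0_compat; [lra|]. apply Rmult_lt_0_compat; [lra|]. apply Rdiv_lt_0_compat; auto. }
      exists N. intros n Hn. rewrite Rminus_0_r.
      assert (Ef : forcing k (u n) = force k (tau n)).
      { apply forcing_congr. apply Shift. }
      assert (Ek : - (INR k * w) ^ 2 * u n k = - (INR k * w) ^ 2 * a k (tau n)).
      { destruct k; [simpl INR; ring|reflexivity]. }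
      rewrite Ef, Ek.
      assert (CS := speed_cseg L HL Rc dc alpha a ray Sol (tau n) (Htr n)).
      assert (HeL : 0 < e / L) by (apply Rdiv_lt_0_compat; auto).
      pose proof (small_coef (fun s => speed s (tau n)) k (e / L) CS HeL) as Hs.
      cbv beta in Hs. rewrite speed_coef in Hs by auto.
      fold (dissipation (tau n)) in Hs.
      specialize (HN n Hn). rewrite Rminus_0_r in HN. apply Rabs_def2 in HN.
      rewrite Rabs_mult, (Rabs_right (mass L k)) in Hs by lra.
      replace (e / L * L / 2) with (e / 2) in Hs by (field; lra).
      assert (Hd : dissipation (tau n) / (2 * (e / L)) < e / 2).
      { apply Rmult_lt_reg_r with (2 * (e / L)); [lra|]. unfold Rdiv at 1. rewrite Rmult_assoc, Rinv_l by lra. lra. }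
      apply Rmult_lt_reg_l with (mass L k); auto.
      apply Rle_lt_trans with (e / 2 + dissipation (tau n) / (2 * (e / L))); [exact Hs|].
      replace (mass L k * eps) with e by (unfold e; ring). lra. }
    apply is_lim_seq_unique in E1. apply is_lim_seq_unique in E2. rewrite E1 in E2. injection E2. auto. }
  assert (Ub : untruncated L Rc b).
  { intros s Hs. assert (Rbar_le (Rabs (fser 1 b s)) Rc); [|auto].
    apply (is_lim_seq_le (fun n => Rabs (fser 1 (u n) s)) (fun _ => Rc)).
    - intros n. destruct (Shift n s) as [_ [_ ->]]. apply a_untruncated; auto.
    - apply (is_lim_seq_abs (fun n => fser 1 (u n) s) (fser 1 b s)).
      apply (lip_flim eventually (fun x => fser 1 x s) w (fun j n => u n j) b M); auto.
      + intros x y Hx Hy. apply fser_1_lip; auto.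
      + apply filter_forall. auto.
    - apply is_lim_seq_const. }
  exists tau, u, b. split; auto. split; [intros n s; destruct (Shift n s) as [S1 [S2 _]]; auto|].
  do 3 (split; auto).
  assert (C2 : cseg L (fser 2 b)) by (apply fser_cseg; auto; apply rapid_ex; auto).
  assert (CN := normal_force_cseg L HL Rc dc b Eb).
  apply (cos_coef_unique L HL (fun s => fser 2 b s + normal_force L Rc dc b s)); auto with cseg.
  intros k.
  rewrite (Int_ext L HL _ (fun s => fser 2 b s * cosw L k s + normal_force L Rc dc b s * cosw L k s)) by (intros; ring).
  rewrite Int_plus, (forcing_coef L HL Rc dc b k Eb Ub) by auto with cseg.
  set (z := fun j => - (INR j * w) ^ 2 * b j).
  rewrite (Int_ext L HL (fun s => fser 2 b s * cosw L k s) (fun s => Series (fun j => z j * cosw L j s) * cosw L k s)).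
  - rewrite (cos_series_coef L HL z (fun k => Rabs (b k) * (INR k * w) ^ 2)).
    + unfold z. rewrite <- Rmult_plus_distr_l, Stat. ring.
    + apply rapid_ex; auto.
    + intros j. unfold z. rewrite Rabs_mult, Rabs_Ropp, Rabs_right by (apply Rle_ge, pow2_ge_0). right. ring.
  - intros s _. f_equal. rewrite <- fser_0. unfold z. rewrite fser_laplacian. reflexivity.
Qed.

End Limit.

(** * Smooth convergence of the curves *)

Section Curves.
Variable L : R.
Hypothesis HL : 0 < L.
Variable J : R -> Prop.

Lemma strip_reg_primitive m F p : strip_reg L J m 0 F ->
  strip_reg L J (S m) 0 (fun s t => p + RInt (fun x => F x t) 0 s).
Proof.
  intros HF. pose proof (strip_reg_cstrip _ _ _ _ _ HF) as CF.
  constructor; [|intros m' E; injection E as <-|intros; discriminate].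
  - intros s0 t0 Hs0 Ht0. apply flim_eps; [typeclasses eauto|]. intros eps He.
    destruct (cstrip_tube L J F t0 CF Ht0 (eps / (4 * L))) as [d1 [Hd1 T1]].
    { apply Rdiv_lt_0_compat; lra. }
    pose proof (cstrip_slice L J F t0 CF Ht0) as C0.
    pose proof (deriv_in_cont _ _ _ _ (RInt_deriv_in L HL _ C0 s0 Hs0)) as Cp. flim_unfold Cp.
    destruct (Cp (eps / 2)) as [d2 T2]; [lra|].
    assert (Hd : 0 < Rmin d1 d2) by (apply Rmin_glb_lt; [auto|apply cond_pos]).
    exists (mkposreal _ Hd). intros [s t] [Bs Bt] [Hs Ht]. simpl fst in *; simpl snd in *.
    pose proof (cstrip_slice L J F t CF Ht) as Ct.
    assert (Bs' : Rabs (s - s0) < Rmin d1 d2) by exact Bs.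
    assert (Bt' : Rabs (t - t0) < Rmin d1 d2) by exact Bt.
    specialize (T2 s (Rlt_le_trans _ _ _ Bs' (Rmin_r _ _)) Hs).
    assert (E1 : Rabs (RInt (fun x => F x t) 0 s - RInt (fun x => F x t0) 0 s) <= eps / 4).
    { destruct Hs as [Hs1 Hs2].
      assert (Ex1 : ex_RInt (fun x => F x t) 0 s) by (apply (cseg_ex_RInt_sub L HL); auto; lra).
      assert (Ex2 : ex_RInt (fun x => F x t0) 0 s) by (apply (cseg_ex_RInt_sub L HL); auto; lra).
      rewrite <- (RInt_minus (V := R_CompleteNormedModule) (fun x => F x t) (fun x => F x t0)) by auto.
      eapply Rle_trans; [apply (abs_RInt_le_const _ 0 s (eps / (4 * L)))|].
      - lra.
      - apply (ex_RInt_minus (V := R_NormedModule)); auto.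
      - intros x Hx. left. apply T1; [split; lra|auto|eapply Rlt_le_trans; [exact Bt'|apply Rmin_l]].
      - apply Rle_trans with (L * (eps / (4 * L))).
        + apply Rmult_le_compat_r; [apply Rlt_le, Rdiv_lt_0_compat; lra|lra].
        + right. field. lra. }
    apply Rle_lt_trans with (Rabs (RInt (fun x => F x t) 0 s - RInt (fun x => F x t0) 0 s) +
      Rabs (RInt (fun x => F x t0) 0 s - RInt (fun x => F x t0) 0 s0)); [|lra].
    eapply Rle_trans; [|apply Rabs_triang]. right. f_equal. ring.
  - exists F. split; auto. intros s t Hs Ht.
    apply (deriv_in_eq _ _ _ (0 + F s t)); [ring|].
    apply (deriv_in_plus _ (fun _ => p)); [apply deriv_in_const|].
    apply (RInt_deriv_in L HL (fun x => F x t)); auto. apply (cstrip_slice L J F); auto.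
Qed.

(** The derivatives are given by functions on the strip, for all slices at once. *)
Lemma Derive_n_in_strip j : forall m F1 F2, strip_reg L J (j + m) 0 F1 -> strip_reg L J (j + m) 0 F2 ->
  exists G1 G2, strip_reg L J m 0 G1 /\ strip_reg L J m 0 G2 /\
    forall t g, J t -> (forall s, seg L s -> g s = (F1 s t, F2 s t)) ->
      forall s, seg L s -> Derive_n_in (seg L) g j s = (G1 s t, G2 s t).
Proof.
  induction j as [|j IH]; intros m F1 F2 H1 H2.
  - exists F1, F2. auto.
  - destruct (IH (S m) F1 F2) as [G1 [G2 [R1 [R2 E]]]];
      [replace (j + S m)%nat with (S j + m)%nat by lia; auto..|].
    destruct (strip_reg_s _ _ _ _ _ R1) as [G1' [D1 R1']]. destruct (strip_reg_s _ _ _ _ _ R2) as [G2' [D2 R2']].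
    exists G1', G2'. split; [auto|split; [auto|]]. intros t g Ht Hg s Hs. simpl Derive_n_in.
    specialize (E t g Ht Hg).
    apply Derive_in_eq; auto; [apply accum_seg; auto| |].
    + apply (deriv_in_ext _ (fun y => G1 y t)); auto. intros y Hy. rewrite E; auto.
    + apply (deriv_in_ext _ (fun y => G2 y t)); auto. intros y Hy. rewrite E; auto.
Qed.

Lemma smooth_in_slice F1 F2 : (forall m, strip_reg L J m 0 F1) -> (forall m, strip_reg L J m 0 F2) ->
  forall t g, J t -> (forall s, seg L s -> g s = (F1 s t, F2 s t)) -> smooth_in (seg L) g.
Proof.
  intros H1 H2 t g Ht Hg n s Hs.
  destruct (Derive_n_in_strip n 1 F1 F2 (H1 _) (H2 _)) as [G1 [G2 [R1 [R2 E]]]].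
  specialize (E t g Ht Hg).
  destruct (strip_reg_s _ _ _ _ _ R1) as [G1' [D1 _]]. destruct (strip_reg_s _ _ _ _ _ R2) as [G2' [D2 _]].
  exists (G1' s t, G2' s t). apply is_derive_in_pair; auto.
  - apply (deriv_in_ext _ (fun y => G1 y t)); auto. intros y Hy. rewrite E; auto.
  - apply (deriv_in_ext _ (fun y => G2 y t)); auto. intros y Hy. rewrite E; auto.
Qed.

End Curves.

(** A convergent sequence is a continuous family over the compact set {0} + {1/(n+1)}; this turns
    smooth convergence into joint continuity of the space derivatives. *)
Definition seq_time (t : R) : Prop := t = 0 \/ exists n : nat, t = / (INR n + 1).

Lemma seq_time_pos (n : nat) : 0 < / (INR n + 1).
Proof. apply Rinv_0_lt_compat. pose proof (pos_INR n). lra. Qed.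

Definition time_index (t : R) : nat := epsilon (inhabits O) (fun n => t = / (INR n + 1)).

Lemma time_index_inv n : time_index (/ (INR n + 1)) = n.
Proof.
  unfold time_index.
  pose proof (epsilon_spec (inhabits O) (fun m => / (INR n + 1) = / (INR m + 1)) (ex_intro _ n eq_refl)) as H.
  set (m := epsilon _ _) in *. cbv beta in H.
  apply INR_eq. pose proof (pos_INR n). pose proof (pos_INR m).
  apply (f_equal Rinv) in H. rewrite !Rinv_inv in H. lra.
Qed.

Definition seq_family (u : nat -> nat -> R) (b : nat -> R) (k : nat) (t : R) : R :=
  if Req_EM_T t 0 then b k else u (time_index t) k.

Lemma seq_family_0 u b k : seq_family u b k 0 = b k.
Proof. unfold seq_family. destruct (Req_EM_T 0 0); congruence. Qed.

Lemma seq_family_n u b k n : seq_family u b k (/ (INR n + 1)) = u n k.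
Proof.
  unfold seq_family. destruct (Req_EM_T (/ (INR n + 1)) 0) as [E|_].
  - pose proof (seq_time_pos n). lra.
  - rewrite time_index_inv. reflexivity.
Qed.

Lemma seq_time_isolated n t : seq_time t ->
  Rabs (t - / (INR n + 1)) < / (INR n + 1) - / (INR n + 2) -> t = / (INR n + 1).
Proof.
  intros Ht H. apply Rabs_def2 in H. pose proof (pos_INR n).
  assert (H2 : 0 < / (INR n + 2)) by (apply Rinv_0_lt_compat; lra).
  destruct Ht as [->|[m ->]]; [lra|]. pose proof (pos_INR m).
  destruct (Nat.lt_trichotomy m n) as [Hmn|[->|Hmn]]; auto; exfalso.
  - assert (INR m + 1 <= INR n) by (rewrite <- S_INR; apply le_INR; lia).
    assert (0 < INR n) by lra.
    assert (/ INR n <= / (INR m + 1)) by (apply Rinv_le_contravar; lra).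
    (* 1/n - 1/(n+1) >= 1/(n+1) - 1/(n+2) by convexity *)
    assert (/ (INR n + 1) - / (INR n + 2) <= / INR n - / (INR n + 1)).
    { replace (/ (INR n + 1) - / (INR n + 2)) with (/ ((INR n + 1) * (INR n + 2))) by (field; lra).
      replace (/ INR n - / (INR n + 1)) with (/ (INR n * (INR n + 1))) by (field; lra).
      apply Rinv_le_contravar; nra. }
    lra.
  - assert (INR n + 2 <= INR m + 1).
    { assert (HS : INR (S n) <= INR m) by (apply le_INR; lia). rewrite S_INR in HS. lra. }
    assert (/ (INR m + 1) <= / (INR n + 2)) by (apply Rinv_le_contravar; lra). lra.
Qed.

Lemma seq_family_cont (u : nat -> nat -> R) (b : nat -> R) k t : is_lim_seq (fun n => u n k) (b k) -> seq_time t ->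
  flim (within seq_time (locally t)) (seq_family u b k) (seq_family u b k t).
Proof.
  intros Hl Ht. apply flim_eps; [typeclasses eauto|]. intros eps He.
  destruct Ht as [->|[n ->]].
  - destruct (proj1 (is_lim_seq_eps _ _) Hl eps He) as [N HN].
    exists (mkposreal _ (seq_time_pos N)). intros t Ht Jt.
    assert (Ht' : Rabs (t - 0) < / (INR N + 1)) by exact Ht. rewrite Rminus_0_r in Ht'.
    rewrite seq_family_0. destruct Jt as [->|[n ->]].
    + rewrite seq_family_0, Rminus_diag, Rabs_R0. auto.
    + rewrite seq_family_n. apply HN. pose proof (seq_time_pos n). rewrite Rabs_right in Ht' by lra.
      apply Nat.lt_le_incl, INR_lt. pose proof (pos_INR n). pose proof (pos_INR N).
      assert (INR N + 1 < INR n + 1); [|lra].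
      apply Rnot_le_lt. intros Hle. assert (/ (INR N + 1) <= / (INR n + 1)) by (apply Rinv_le_contravar; lra). lra.
  - pose proof (pos_INR n).
    assert (Hd : 0 < / (INR n + 1) - / (INR n + 2)).
    { assert (/ (INR n + 2) < / (INR n + 1)) by (apply Rinv_lt_contravar; nra). lra. }
    exists (mkposreal _ Hd). intros t Hb Jt. rewrite (seq_time_isolated n t Jt Hb), Rminus_diag, Rabs_R0. auto.
Qed.

Lemma seq_family_rapid u b : (forall p, exists C, forall n k, Rabs (u n (S k)) <= C * wt p (S k)) -> rapid b ->
  rapid_on seq_time (seq_family u b).
Proof.
  intros Hu Hb p. destruct (Hu p) as [C HC]. destruct (Hb p) as [C' HC'].
  exists (Rmax C C'). intros k t [->|[n ->]]; [rewrite seq_family_0|rewrite seq_family_n];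
    (eapply Rle_trans; [apply HC || apply HC'|]); apply Rmult_le_compat_r; try (left; apply wt_pos);
    [apply Rmax_r|apply Rmax_l].
Qed.

Section Limit_curve.
Variable L : R.
Hypothesis HL : 0 < L.
Notation fser := (fser L).

Definition tangent_of (x : nat -> R) (s : R) : R2 := (cos (fser 0 x s), sin (fser 0 x s)).

Lemma fst_curve p T s : fst (curve_of p T s) = fst p + RInt (fun x => fst (T x)) 0 s.
Proof. reflexivity. Qed.

Lemma snd_curve p T s : snd (curve_of p T s) = snd p + RInt (fun x => snd (T x)) 0 s.
Proof. reflexivity. Qed.

(** The coefficients converge with uniform rapid decay, so the angles form a family over
    [seq_time] that is continuous with all its space derivatives; uniform convergence at time 0 is
    [cstrip_tube]. *)
Theorem curves_converge (p q : R2) (u : nat -> nat -> R) (b : nat -> R) (Tn : nat -> R -> R2) (l : R2) :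
  (forall n s, Tn n s = tangent_of (u n) s) ->
  (forall k, is_lim_seq (fun n => u n k) (b k)) ->
  (forall p, exists C, forall n k, Rabs (u n (S k)) <= C * wt p (S k)) -> rapid b ->
  (forall n, curve_of p (Tn n) L = q) ->
  (forall s, seg L s -> fser 2 b s + (fst l * sin (fser 0 b s) - snd l * cos (fser 0 b s)) = 0) ->
  cvg_smooth L (fun n => curve_of p (Tn n)) (curve_of p (tangent_of b)) /\
  is_equilibrium L p q (curve_of p (tangent_of b)).
Proof.
  intros HT Hlim Hu Hb Hend Hstat.
  set (A := seq_family u b). set (J := seq_time).
  pose proof (seq_family_rapid u b Hu Hb) as RA. fold A J in RA.
  assert (CA : forall k t, J t -> flim (within J (locally t)) (A k) (A k t)).
  { intros k t Ht. apply seq_family_cont; auto. }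
  assert (Rang : forall m, strip_reg L J m 0 (fun s t => fser 0 (fun k => A k t) s)).
  { intros m. apply fser_strip_reg_s; auto. }
  set (F1 := fun s t => cos (fser 0 (fun k => A k t) s)). set (F2 := fun s t => sin (fser 0 (fun k => A k t) s)).
  assert (R1 : forall m, strip_reg L J m 0 F1) by (intros m; apply strip_reg_cos; auto).
  assert (R2 : forall m, strip_reg L J m 0 F2) by (intros m; apply strip_reg_sin; auto).
  set (X := fun s t => fst p + RInt (fun x => F1 x t) 0 s). set (Y := fun s t => snd p + RInt (fun x => F2 x t) 0 s).
  assert (RX : forall m, strip_reg L J m 0 X).
  { intros m. apply (strip_reg_le L J (S m) 0); auto. apply strip_reg_primitive; auto. }
  assert (RY : forall m, strip_reg L J m 0 Y).
  { intros m. apply (strip_reg_le L J (S m) 0); auto. apply strip_reg_primitive; auto. }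
  assert (J0 : J 0) by (left; auto).
  assert (Jn : forall n, J (/ (INR n + 1))) by (intros n; right; exists n; auto).
  assert (A0 : forall k, A k 0 = b k) by (intros; apply seq_family_0).
  assert (An : forall n k, A k (/ (INR n + 1)) = u n k) by (intros; apply seq_family_n).
  assert (Einf : forall s, curve_of p (tangent_of b) s = (X s 0, Y s 0)).
  { intros s. rewrite (surjective_pairing (curve_of _ _ s)), fst_curve, snd_curve. unfold X, Y.
    f_equal; f_equal; apply (RInt_ext (V := R_CompleteNormedModule)); intros x _; unfold F1, F2;
      rewrite (fser_ext L 0 _ b x A0); reflexivity. }
  assert (En : forall n s, curve_of p (Tn n) s = (X s (/ (INR n + 1)), Y s (/ (INR n + 1)))).
  { intros n s. rewrite (surjective_pairing (curve_of _ _ s)), fst_curve, snd_curve. unfold X, Y.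
    f_equal; f_equal; apply (RInt_ext (V := R_CompleteNormedModule)); intros x _; rewrite HT; unfold F1, F2;
      rewrite (fser_ext L 0 _ (u n) x (An n)); reflexivity. }
  split.
  - intros k eps.
    destruct (Derive_n_in_strip L HL J k 0 X Y (RX _) (RY _)) as [G1 [G2 [H1 [H2 E]]]].
    pose proof (strip_reg_cstrip _ _ _ _ _ H1) as C1. pose proof (strip_reg_cstrip _ _ _ _ _ H2) as C2.
    assert (He : 0 < eps / 2) by (pose proof (cond_pos eps); lra).
    destruct (cstrip_tube L J G1 0 C1 J0 _ He) as [d1 [Hd1 T1]].
    destruct (cstrip_tube L J G2 0 C2 J0 _ He) as [d2 [Hd2 T2]].
    set (d := Rmin d1 d2). assert (Hd : 0 < d) by (apply Rmin_glb_lt; auto).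
    destruct (INR_unbounded (/ d)) as [N HN]. exists N. intros n Hn s Hs.
    rewrite (E 0 (curve_of p (tangent_of b)) J0 (fun s _ => Einf s) s Hs).
    rewrite (E (/ (INR n + 1)) (curve_of p (Tn n)) (Jn n) (fun s _ => En n s) s Hs).
    assert (Hsmall : Rabs (/ (INR n + 1) - 0) < d).
    { rewrite Rminus_0_r, Rabs_right by (apply Rle_ge, Rlt_le, seq_time_pos).
      apply le_INR in Hn. assert (0 < / d) by (apply Rinv_0_lt_compat; auto).
      rewrite <- (Rinv_inv d). apply Rinv_lt_contravar; [|lra]. apply Rmult_lt_0_compat; lra. }
    specialize (T1 s _ Hs (Jn n) (Rlt_le_trans _ _ _ Hsmall (Rmin_l _ _))).
    specialize (T2 s _ Hs (Jn n) (Rlt_le_trans _ _ _ Hsmall (Rmin_r _ _))).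
    eapply Rle_lt_trans; [apply norm_R2_le|].
    change (Rabs (G1 s (/ (INR n + 1)) - G1 s 0) + Rabs (G2 s (/ (INR n + 1)) - G2 s 0) < eps). lra.
  - assert (Eb := rapid_ell b Hb).
    assert (C0 := fser_0_cseg L HL b Eb).
    assert (D0 : forall s, seg L s -> deriv_in (seg L) (fser 0 b) s (fser 1 b s)).
    { intros s Hs. apply fser_deriv; auto. apply rapid_ex; auto. }
    assert (D1 : forall s, seg L s -> deriv_in (seg L) (fser 1 b) s (fser 2 b s)).
    { intros s Hs. apply fser_deriv; auto. apply rapid_ex; auto. }
    assert (ET : forall s, seg L s -> Derive_in (seg L) (curve_of p (tangent_of b)) s = (cos (fser 0 b s), sin (fser 0 b s))).
    { intros s Hs. apply Derive_in_eq; auto; [apply accum_seg; auto| |].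
      - apply (deriv_in_eq _ _ _ (0 + cos (fser 0 b s))); [ring|].
        apply (deriv_in_plus _ (fun _ => fst p) (fun y => RInt (fun x => cos (fser 0 b x)) 0 y)); [apply deriv_in_const|].
        apply (RInt_deriv_in L HL (fun x => cos (fser 0 b x))); auto with cseg.
      - apply (deriv_in_eq _ _ _ (0 + sin (fser 0 b s))); [ring|].
        apply (deriv_in_plus _ (fun _ => snd p) (fun y => RInt (fun x => sin (fser 0 b x)) 0 y)); [apply deriv_in_const|].
        apply (RInt_deriv_in L HL (fun x => sin (fser 0 b x))); auto with cseg. }
    assert (ET2 : forall s, seg L s -> Derive_n_in (seg L) (curve_of p (tangent_of b)) 2 s =
       (- sin (fser 0 b s) * fser 1 b s, cos (fser 0 b s) * fser 1 b s)).
    { intros s Hs. apply (tangent_Derive L HL (Derive_in (seg L) (curve_of p (tangent_of b))) (fser 0 b) (fser 1 b)); auto. }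
    split; [|split; [|split; [|split; [|split; [|split]]]]].
    + apply (smooth_in_slice L HL J X Y RX RY 0); auto.
    + intros s Hs. rewrite ET by auto. apply (tangent_norm L (tangent_of b) (fser 0 b)); auto.
    + unfold curve_of, vint. rewrite !(RInt_point (V := R_CompleteNormedModule)). apply (plus_zero_r (G := prod_AbelianMonoid _ _)).
    + rewrite Einf.
      assert (Lim : forall F, (forall m, strip_reg L J m 0 F) -> forall c e, (forall n, c + RInt (fun x => F x (/ (INR n + 1))) 0 L = e) ->
         c + RInt (fun x => F x 0) 0 L = e).
      { intros F HF c e Hc.
        pose proof (integ_t_cont L HL J F 0 (strip_reg_cstrip _ _ _ _ _ (HF O)) J0) as Hi. flim_unfold Hi.
        assert (Z : forall eta, 0 < eta -> Rabs (e - (c + RInt (fun x => F x 0) 0 L)) < eta).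
        { intros eta Heta. destruct (Hi eta Heta) as [d Hd]. destruct (INR_unbounded (/ d)) as [n Hn].
          assert (Hsm : Rabs (/ (INR n + 1) - 0) < d).
          { rewrite Rminus_0_r, Rabs_right by (apply Rle_ge, Rlt_le, seq_time_pos).
            assert (0 < / d) by (apply Rinv_0_lt_compat, cond_pos).
            rewrite <- (Rinv_inv d). apply Rinv_lt_contravar; [|lra]. apply Rmult_lt_0_compat; lra. }
          specialize (Hd _ Hsm (Jn n)). unfold integ in Hd. rewrite <- (Hc n).
          eapply Rle_lt_trans; [|exact Hd]. right. f_equal. ring. }
        apply NNPP. intros Hne. specialize (Z (Rabs (e - (c + RInt (fun x => F x 0) 0 L)))).
        assert (0 < Rabs (e - (c + RInt (fun x => F x 0) 0 L))) by (apply Rabs_pos_lt; lra). lra. }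
      rewrite (surjective_pairing q). unfold X, Y. f_equal.
      * apply (Lim F1 R1). intros n. specialize (Hend n). rewrite En in Hend. rewrite <- Hend. reflexivity.
      * apply (Lim F2 R2). intros n. specialize (Hend n). rewrite En in Hend. rewrite <- Hend. reflexivity.
    + rewrite ET2 by (apply seg_0; auto). rewrite fser_1_0, !Rmult_0_r. reflexivity.
    + rewrite ET2 by (apply seg_L; auto). rewrite fser_1_L, !Rmult_0_r by auto. reflexivity.
    + exists l. intros s Hs.
      rewrite (flow_rhs_angle L HL _ (fser 0 b) (fser 1 b) (fser 2 b)); auto.
      rewrite Hstat, !Rmult_0_r by auto. reflexivity.
Qed.

End Limit_curve.

(** * The flow of inextensible curves *)

Theorem theorem1 :
  forall (L : R) (f0 : R -> R2),
    0 < L ->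
    smooth_in (seg L) f0 ->
    (forall s : R, seg L s -> norm (Derive_in (seg L) f0 s) = 1) ->
    norm (minus (f0 L) (f0 0)) < L ->
    (forall l : nat,
       Derive_n_in (seg L) (Derive_n_in (seg L) f0 2) l 0 = zero /\
       Derive_n_in (seg L) (Derive_n_in (seg L) f0 2) l L = zero) ->
    exists (T : R -> R -> R2) (lam : R -> R2),
      smooth_strip L T /\
      (forall s t : R, seg L s -> ray t -> norm (T s t) = 1) /\
      (forall t : R, ray t -> is_multiplier L (fun s => T s t) (lam t)) /\
      (forall s t : R, seg L s -> ray t ->
         Dt T s t = flow_rhs L (fun x => T x t) (lam t) s) /\
      (forall s : R, seg L s -> T s 0 = Derive_in (seg L) f0 s) /\
      (forall t : R, ray t -> Ds L T 0 t = zero /\ Ds L T L t = zero) /\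
      (forall t : R, ray t ->
         vint (fun s => T s t) 0 L = minus (f0 L) (f0 0)) /\
      (exists (ti : nat -> R) (f_inf : R -> R2),
         (forall i : nat, ray (ti i)) /\
         is_lim_seq ti p_infty /\
         cvg_smooth L (fun i => curve_of (f0 0) (fun s => T s (ti i))) f_inf /\
         is_equilibrium L (f0 0) (f0 L) f_inf).
Proof.
  intros L f0 HL Hsm Hunit Hshort Hflat.
  destruct (initial_angle L HL f0 Hsm Hunit Hflat) as [alpha [Halpha [Hinit [HX HY]]]].
  set (D1 := fst (f0 L) - fst (f0 0)) in *. set (D2 := snd (f0 L) - snd (f0 0)) in *.
  assert (HD : minus (f0 L) (f0 0) = (D1, D2)).
  { rewrite (surjective_pairing (minus (f0 L) (f0 0))). reflexivity. }
  assert (Hs2 : D1 ^ 2 + D2 ^ 2 < L ^ 2).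
  { pose proof (norm_R2_sq (minus (f0 L) (f0 0))) as E. rewrite HD in E, Hshort. simpl fst in E; simpl snd in E.
    pose proof (norm_ge_0 ((D1, D2) : R2)) as H0.
    change (norm ((D1, D2) : R2)) with (norm (D1, D2)) in *. rewrite <- E.
    assert (0 <= norm (D1, D2)) by exact H0. nra. }
  destruct (global_solution L HL alpha Halpha) as [Rc [dc [a Sol]]].
  { rewrite HX, HY. exact Hs2. }
  pose proof Sol as [HRc Hdc _ a_ell _ _ a_duh _ _ _ a_unt a_det].
  pose proof (ang_reg L HL Rc dc alpha a ray Sol) as Reg.
  pose proof (ang_ds L HL Rc dc alpha a ray Sol) as Dsr.
  pose proof (ang_dt L HL Rc dc alpha a ray Sol) as Dtr.
  pose proof (frc_0 L HL Rc dc alpha a ray Sol) as Frc.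
  pose proof (constraint_conserved L HL Rc dc alpha a ray Sol) as Cons.
  set (th := fun i s t => ang L a i s t) in *.
  assert (a_0 : forall k, a k 0 = alpha k) by (intros k; rewrite a_duh by lra; apply duh_0).
  assert (th0 : forall i s, th i s 0 = fser L i alpha s) by (intros; apply fser_ext; auto).
  set (T := fun s t => (cos (th O s t), sin (th O s t)) : R2).
  set (lam := fun t => (lamc L Rc dc (fun k => a k t), lams L Rc dc (fun k => a k t)) : R2).
  assert (Dth0 : forall t s, ray t -> seg L s -> deriv_in (seg L) (fun x => th O x t) s (th 1%nat s t)) by (intros; apply (Dsr O); auto).
  assert (Dth1 : forall t s, ray t -> seg L s -> deriv_in (seg L) (fun x => th 1%nat x t) s (th 2%nat s t)) by (intros; apply (Dsr 1%nat); auto).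
  assert (Cth1 : forall t, ray t -> cseg L (fun x => th 1%nat x t)).
  { intros t Ht. apply (cseg_deriv L _ (fun x => th 2%nat x t)). auto. }
  assert (Hvint : forall t, ray t -> vint (fun s => T s t) 0 L = (D1, D2)).
  { intros t Ht. destruct (Cons t Ht) as [EX EY]. unfold vint. f_equal.
    - transitivity (integ L (fun s => cos (fser L 0 alpha s))); [|exact HX].
      etransitivity; [exact EX|]. apply Int_ext; auto. intros s _. unfold tcos. fold (th O s 0). rewrite th0. reflexivity.
    - transitivity (integ L (fun s => sin (fser L 0 alpha s))); [|exact HY].
      etransitivity; [exact EY|]. apply Int_ext; auto. intros s _. unfold tsin. fold (th O s 0). rewrite th0. reflexivity. }
  exists T, lam. split; [|split; [|split; [|split; [|split; [|split; [|split]]]]]].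
  - intros n. apply (strip_reg_Ck L HL n n n); auto.
    + apply (strip_reg_cos L ray n n (th O)). apply Reg.
    + apply (strip_reg_sin L ray n n (th O)). apply Reg.
  - intros s t Hs Ht. apply (tangent_norm L (fun x => T x t) (fun x => th O x t)); auto.
  - intros t Ht. pose proof (a_det t Ht) as Hd.
    assert (Kid : forall s, seg L s -> kap L Rc (fun k => a k t) s = th 1%nat s t).
    { intros s Hs. apply (kap_id L Rc); auto. }
    assert (Evc : vc L Rc (fun k => a k t) = integ L (fun s => th 1%nat s t * th 1%nat s t * cos (th O s t))).
    { apply Int_ext; auto. intros s Hs. rewrite Kid by auto. reflexivity. }
    assert (Evs : vs L Rc (fun k => a k t) = integ L (fun s => th 1%nat s t * th 1%nat s t * sin (th O s t))).
    { apply Int_ext; auto. intros s Hs. rewrite Kid by auto. reflexivity. }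
    apply (multiplier_angle L HL (fun x => T x t) (fun x => th O x t) (fun x => th 1%nat x t)); auto.
    + change (det L (fun k => a k t) <> 0). lra.
    + unfold lamc. rewrite Rmax_left, Evc, Evs by auto. reflexivity.
    + unfold lams. rewrite Rmax_left, Evc, Evs by auto. reflexivity.
  - intros s t Hs Ht.
    rewrite (flow_rhs_angle L HL (fun x => T x t) (fun x => th O x t) (fun x => th 1%nat x t) (fun x => th 2%nat x t)); auto.
    apply Derive_in_eq; auto; [apply accum_ray; auto| |].
    + apply (deriv_in_eq _ _ _ (- sin (th O s t) * (th 2%nat s t + frc L Rc dc a 0 s t))).
      { rewrite Frc by auto. reflexivity. }
      apply (deriv_in_comp ray (fun y => th O s y) cos); [apply (Dtr O); auto|apply cos_is_derive].
    + apply (deriv_in_eq _ _ _ (cos (th O s t) * (th 2%nat s t + frc L Rc dc a 0 s t))).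
      { rewrite Frc by auto. reflexivity. }
      apply (deriv_in_comp ray (fun y => th O s y) sin); [apply (Dtr O); auto|apply sin_is_derive].
  - intros s Hs. rewrite Hinit by auto. unfold T. rewrite th0. reflexivity.
  - intros t Ht. unfold Ds.
    assert (E : forall s, seg L s -> Derive_in (seg L) (fun x => T x t) s = (- sin (th O s t) * th 1%nat s t, cos (th O s t) * th 1%nat s t)).
    { intros s Hs. apply (tangent_Derive L HL (fun x => T x t) (fun x => th O x t) (fun x => th 1%nat x t)); auto. }
    split; rewrite E by (apply seg_0 || apply seg_L; auto).
    + assert (Z : th 1%nat 0 t = 0) by apply fser_1_0. rewrite Z, !Rmult_0_r. reflexivity.
    + assert (Z : th 1%nat L t = 0) by (apply fser_1_L; auto). rewrite Z, !Rmult_0_r. reflexivity.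
  - intros t Ht. rewrite HD. auto.
  - destruct (stationary_limit L HL Rc dc alpha a Sol)
      as [tau [u [b [Htau [Hshift [Hlim [Hdec [Hb Hstat]]]]]]]].
    assert (Hr : forall n, ray (tau n)) by (intros n; pose proof (Htau n); pose proof (pos_INR n); unfold ray; lra).
    exists tau, (curve_of (f0 0) (tangent_of L b)). split; auto. split.
    + apply (is_lim_seq_le_p_loc INR); [apply filter_forall; auto|apply is_lim_seq_INR].
    + apply (curves_converge L HL (f0 0) (f0 L) u b (fun n s => T s (tau n))
        (lamc L Rc dc b, lams L Rc dc b)); auto.
      * intros n s. destruct (Hshift n s) as [E1 E2]. unfold T, tangent_of. rewrite E1, E2. reflexivity.
      * intros n. unfold curve_of. rewrite Hvint by auto.
        rewrite (surjective_pairing (f0 L)). unfold D1, D2, plus; simpl. unfold prod_plus, plus; simpl. f_equal; ring.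
Qed.
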